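(* Let $\lambda$ be a partition of $n$, $E_\lambda:=E_{t^\lambda}$, and let $c_\lambda:C(\lambda)\to C(\lambda)^{\circledast}$ be the $RS_n$-homomorphism $c_\lambda(a)(b)=(a,b)_\lambda$. (a) There is $a_\lambda\in\mathbb Q$ with $a_\lambda E_\lambda\in RS_n y_{\lambda'}s_{\lambda'}x_\lambda\subseteq RS_n$ such that, under the isomorphisms $\operatorname{Ind}(\lambda)\cong C(\lambda)$ and $C(\lambda)^{\circledast}\cong RS_n y_{\lambda'}s_{\lambda'}x_\lambda$ and Frobenius reciprocity $\operatorname{Hom}_{RS_n}(\operatorname{Ind}(\lambda),N)\cong\operatorname{Hom}_{\operatorname{GZ}_n}(1_\lambda,N)$, the map $c_\lambda$ corresponds to $1\mapsto a_\lambda E_\lambda$; i.e. $c_\lambda$ becomes $w\otimes1\mapsto w\,a_\lambda E_\lambda$ ($w\in RS_n$). (b) The reduction $\overline{c_\lambda}:\overline{C(\lambda)}\to\overline{C(\lambda)}^{\circledast}$ modulo $p$ has image the $\mathbb F_pS_n$-submodule generated by $\overline{a_\lambda E_\lambda}$, and hence $D(\lambda)\cong\mathbb F_pS_n\,\overline{a_\lambda E_\lambda}$ (a left ideal of $\mathbb F_pS_n$).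
   Context: $p$ prime, $R$ the localization of $\mathbb Z$ at $(p)$, $\mathbb F_p=R/pR$, $\overline{x}$ the reduction modulo $p$. Permutations act on the right on tableaux and multiply left to right. Jucys–Murphy elements $L_1=0$, $L_k=\sum_{j<k}(j,k)$; content $r_t(k)=j-i$ if $k$ is in node $[i,j]$; $E_t:=\prod_{c=-n+1}^{n-1}\prod_{i:\,r_t(i)\neq c}\frac{L_i-c}{r_t(i)-c}\in\mathbb QS_n$. $t^\lambda$ is the $\lambda$-tableau with $1,\dots,n$ along rows, $r_\lambda(i):=r_{t^\lambda}(i)$, $d(t)$ is defined by $t^\lambda d(t)=t$; $\lambda'$ is the conjugate partition; $s_{\lambda'}:=d(t_{\lambda'})$ where $t_{\lambda'}$ is the $\lambda'$-tableau with $1,\dots,n$ entered down the columns. For a partition $\mu$, $x_\mu$ and $y_\mu$ are the sum and the signed sum of the elements of the row stabilizer of $t^\mu$. Murphy basis $x_{st}=d(s)^{-1}x_\lambda d(t)$ ($s,t$ standard of the same shape) is an $R$-basis of $RS_n$; $RS_n^{\rhd\lambda}$ is the span of $x_{uv}$ with shape $\mu\rhd\lambda$ in dominance order; $C(\lambda):=(RS_nx_\lambda+RS_n^{\rhd\lambda})/RS_n^{\rhd\lambda}$, free with basis the images $x_{s\lambda}$ of $x_{st^\lambda}$, $s$ standard; $\overline{C(\lambda)}:=C(\lambda)\otimes_R\mathbb F_p$. The form $(\cdot,\cdot)_\lambda$ on $C(\lambda)$: $(x_{s\lambda},x_{t\lambda})_\lambda$ is the coefficient of $x_\lambda$ in the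 expansion of $x_{t^\lambda s}x_{t t^\lambda}$ in the Murphy basis. For a left $RS_n$-module $M$, $M^{\circledast}:=\operatorname{Hom}_R(M,R)$ with $(\sigma f)(x)=f(\sigma^{-1}x)$; it is known that $C(\lambda)^{\circledast}\cong RS_ny_{\lambda'}s_{\lambda'}x_\lambda$. $D(\lambda):=\overline{C(\lambda)}/\operatorname{rad}$, where $\operatorname{rad}$ is the radical of the reduction of $(\cdot,\cdot)_\lambda$ (either simple or zero). $\operatorname{GZ}_n$ is the $R$-subalgebra generated by the $L_i$; $1_\lambda:=\operatorname{GZ}_n/(L_i-r_\lambda(i))_i$; $\operatorname{Ind}(\lambda):=\operatorname{Fr}(RS_n\otimes_{\operatorname{GZ}_n}1_\lambda)$ with $\operatorname{Fr}(M)=M^{**}$; it is known that $\operatorname{Ind}(\lambda)\cong C(\lambda)$. *)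

(* Defs.v *)
From mathcomp Require Import all_boot all_order all_algebra all_fingroup.
Set Implicit Arguments. Unset Strict Implicit. Unset Printing Implicit Defensive.
Import GRing.Theory Num.Theory.
Local Open Scope ring_scope.

(* Conventions: the entries of tableaux are 0,...,n-1 (instead of 1..n),    *)
(* rows and columns are indexed from 0.  Contents j-i are unaffected.       *)
(* A permutation s : 'S_n acts on entries on the right: k^s = s k; the      *)
(* MathComp product (s * t)%g is "first s then t", i.e. left-to-right        *)
(* multiplication as in the paper.                                           *)

Definition GA (K : nzRingType) (n : nat) := {ffun 'S_n -> K}.

Definition gperm (K : nzRingType) n (s : 'S_n) : GA K n :=
  [ffun t => (t == s)%:R].
Definition gone (K : nzRingType) n : GA K n := gperm K 1%g.
Definition gmul (K : nzRingType) n (f g : GA K n) : GA K n :=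
  [ffun s => \sum_(t : 'S_n) f t * g (t^-1 * s)%g].
Definition gscale (K : nzRingType) n (c : K) (f : GA K n) : GA K n :=
  [ffun s => c * f s].
Definition gstar (K : nzRingType) n (f : GA K n) : GA K n :=
  [ffun s => f (s^-1)%g].

Definition inR (p : nat) (q : rat) : bool := coprime p `|denq q|%N.
Definition inRS (p : nat) n (f : GA rat n) : Prop := forall s, inR p (f s).

Definition redq (p : nat) (q : rat) : 'F_p := (numq q)%:~R / (denq q)%:~R.
Definition redGA (p : nat) n (f : GA rat n) : GA 'F_p n :=
  [ffun s => redq p (f s)].

Definition is_partition (n : nat) (lam : seq nat) : bool :=
  [&& sorted geq lam, all (fun x => 0 < x)%N lam & sumn lam == n].

Definition rowstart (lam : seq nat) (i : nat) : nat := \sum_(k < i) nth 0 lam k.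
(* row / column of the node containing entry k in t^lam *)
Definition row_of (lam : seq nat) (k : nat) : nat :=
  count (fun i => rowstart lam i.+1 <= k)%N (iota 0 (size lam)).
Definition col_of (lam : seq nat) (k : nat) : nat := k - rowstart lam (row_of lam k).
Definition content (lam : seq nat) (k : nat) : int :=
  (col_of lam k)%:Z - (row_of lam k)%:Z.

Definition conj_part (lam : seq nat) : seq nat :=
  mkseq (fun j => count (fun x => j < x)%N lam) (head 0%N lam).

Definition dominates (mu lam : seq nat) : Prop :=
  forall k, (\sum_(i < k) nth 0 lam i <= \sum_(i < k) nth 0 mu i)%N.

(* the lam-tableau t^lam d is standard *)
Definition standard (lam : seq nat) n (d : 'S_n) : bool :=
  [forall a : 'I_n, forall b : 'I_n,
     (((row_of lam a == row_of lam b) && (col_of lam a < col_of lam b)%N) ||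
      ((col_of lam a == col_of lam b) && (row_of lam a < row_of lam b)%N))
     ==> (d a < d b)%N].

Definition rowstab (lam : seq nat) n (s : 'S_n) : bool :=
  [forall k : 'I_n, row_of lam (s k) == row_of lam k].

Definition xl (K : nzRingType) n (lam : seq nat) : GA K n :=
  \sum_(s : 'S_n | rowstab lam s) gperm K s.
Definition yl (K : nzRingType) n (lam : seq nat) : GA K n :=
  \sum_(s : 'S_n | rowstab lam s) gscale ((-1) ^+ odd_perm s) (gperm K s).

(* s_{lam'} = d(t_{lam'}); t_{lam'} has entries 0..n-1 down the columns *)
Definition s_conj n (lam : seq nat) : 'S_n :=
  odflt 1%g [pick s : 'S_n | [forall k : 'I_n,
     val (s k) == (rowstart lam (col_of (conj_part lam) k)
                   + row_of (conj_part lam) k)%N]].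

Definition murphy (K : nzRingType) n (lam : seq nat) (s t : 'S_n) : GA K n :=
  gmul (gmul (gperm K (s^-1)%g) (xl K n lam)) (gperm K t).

(* z lies in the inS-span of the x^mu_{uv}, mu ▷ lam, u v standard:
   inS = R gives RS_n^{▷lam}; inS = predT over F_p gives its reduction. *)
Definition span_higher (K : nzRingType) (inS : K -> Prop) n (lam : seq nat)
    (z : GA K n) : Prop :=
  exists l : seq (seq nat * 'S_n * 'S_n * K),
    (forall e, e \in l ->
       [/\ inS e.2, is_partition n e.1.1.1, dominates e.1.1.1 lam,
           e.1.1.1 <> lam & standard e.1.1.1 e.1.1.2 && standard e.1.1.1 e.1.2])
    /\ z = \sum_(e <- l) gscale e.2 (murphy K e.1.1.1 e.1.1.2 e.1.2).

(* Representatives of C(lam): z in S x_lam + S^{▷lam} (S = RS_n or F_pS_n);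
   two representatives define the same element iff they differ by an
   element of span_higher. *)
Definition Cmem (K : nzRingType) (inS : K -> Prop) n (lam : seq nat)
    (z : GA K n) : Prop :=
  exists h : GA K n, (forall s, inS (h s)) /\
    exists j, span_higher inS lam j /\ z = gmul h (xl K n lam) + j.

(* (a, b)_lam = r  :  a^* b = r x_lam  mod S^{▷lam} *)
Definition formrel (K : nzRingType) (inS : K -> Prop) n (lam : seq nat)
    (a b : GA K n) (r : K) : Prop :=
  exists j, span_higher inS lam j /\
    gmul (gstar a) b = gscale r (xl K n lam) + j.

Definition inRP (p : nat) : rat -> Prop := fun q => inR p q.
Definition anyP (K : Type) : K -> Prop := fun _ => True.

(* f (defined on representatives) is an element of C(lam)^⊛ = Hom_R(C(lam),R) *)
Definition isDual (p n : nat) (lam : seq nat) (f : GA rat n -> rat) : Prop :=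
  [/\ forall z, Cmem (inRP p) lam z -> inR p (f z),
      forall z, span_higher (inRP p) lam z -> f z = 0,
      forall z1 z2, Cmem (inRP p) lam z1 -> Cmem (inRP p) lam z2 ->
                    f (z1 + z2) = f z1 + f z2 &
      forall r z, inR p r -> Cmem (inRP p) lam z -> f (gscale r z) = r * f z].

Definition Lmem (p n : nat) (lam : seq nat) (z : GA rat n) : Prop :=
  exists h, inRS p h /\
    z = gmul (gmul (gmul h (yl rat n (conj_part lam)))
                   (gperm rat (s_conj n lam))) (xl rat n lam).

Definition JM n (k : nat) : GA rat n :=
  \sum_(j : 'I_n | (j < k)%N)
     (if insub k is Some k' then gperm rat (tperm j k') else 0).

Definition Elam n (lam : seq nat) : GA rat n :=
  \big[@gmul rat n / gone rat n]_(c < (2 * n).-1)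
   \big[@gmul rat n / gone rat n]_(i < n | content lam i != (c%:Z - n.-1%:Z))
     gscale ((content lam i - (c%:Z - n.-1%:Z))%:~R)^-1
            (JM n i - gscale ((c%:Z - n.-1%:Z)%:~R) (gone rat n)).

(* Main.v *)
(* Write x = x_lam, kappa for the signed sum of the column stabilizer of t^lam (so that
   y s = s kappa for y = y_{lam'}, s = s_{lam'}), and J for the higher span RS_n^{|> lam}.
   The Garnir relations show that J is an ideal and that C(lam) is spanned modulo J by the
   d^-1 x with d standard; kappa kills J, and the polytabloids d^-1 kappa x pair with the
   d^-1 x unitriangularly. Hence RS_n kappa x is the dual of C(lam) under the dot product of
   group elements, and x g x = z0(g) x modulo J for integers z0(g). The resulting element z0
   is the vector representing c_lam(x), and it lies in the integral span of the polytabloids.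

   It is a multiple of E = E_lam: the Jucys-Murphy elements have integral spectrum (by
   intertwiners) and are self-adjoint, so E is the projection onto their eigenvectors of
   content vector t^lam. Comparing content sums shows E J = 0, and the row symmetry
   E x = c E then follows row by row. Multiplying x g x = z0(g) x + j by E on the left gives
   c E(g) = z0(g) E(1). Modulo p, writing z0 = x kappa q, the map w x |-> w z0 is right
   multiplication by kappa q. *)
Require Import Defs.
From HB Require Import structures.
From mathcomp Require Import all_boot all_order all_algebra all_fingroup.
From mathcomp Require Import zify ring.
Set Implicit Arguments. Unset Strict Implicit. Unset Printing Implicit Defensive.
Import GRing.Theory Num.Theory.

(** * Partitions and positions *)

(** Straightening is done once, over the integers, and [gmap] carries it to $R$, $\mathbb Q$ and
    $\mathbb F_p$. This is why the representing vector has integer coefficients and can be reduced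
    modulo $p$, although $E$ itself may have denominators divisible by $p$. The obstacle is to
    recognise that vector as a multiple of $E$ without seminormal forms or simple modules.
    Positivity of the dot product over $\mathbb Q$ replaces semisimplicity: a self-adjoint element
    has no repeated roots, so a crude list of candidate eigenvalues already suffices. The vanishing
    on $J$ is tested by one element, the sum of all transpositions of the first $m$ letters. It acts
    on $E$ by the total content of the first $m$ nodes, and on a tabloid, up to more dominant ones,
    by the content sum of its shape; the two scalars differ because content sums increase strictly
    with dominance. *)

Section Partitions.
Variables (n : nat) (lam : seq nat).
Hypothesis lamP : is_partition n lam.

Lemma part_gt0 i : i < size lam -> 0 < nth 0 lam i.
Proof. by case/and3P: lamP => _ /allP h _ hi; apply/h/mem_nth. Qed.

Lemma part_noninc i j : i <= j -> nth 0 lam j <= nth 0 lam i.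
Proof.
move=> hij; case: (ltnP j (size lam)) => hj; last by rewrite nth_default.
case/and3P: lamP => hs _ _.
by apply: (sorted_leq_nth _ _ 0 hs) => //;
  [move=> a b c; rewrite /geq /= => h1 h2; apply: leq_trans h2 h1 | move=> a; rewrite /geq /= |
   rewrite inE; apply: leq_ltn_trans hj].
Qed.

Lemma rowstart0 : rowstart lam 0 = 0.
Proof. by rewrite /rowstart big_ord0. Qed.

Lemma rowstartS i : rowstart lam i.+1 = rowstart lam i + nth 0 lam i.
Proof. by rewrite /rowstart big_ord_recr. Qed.

Lemma rowstart_mono i j : i <= j -> rowstart lam i <= rowstart lam j.
Proof.
elim: j => [|j IH]; first by rewrite leqn0 => /eqP->.
rewrite leq_eqVlt => /orP[/eqP->//|]; rewrite ltnS => /IH h.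
by rewrite rowstartS; apply: leq_trans h (leq_addr _ _).
Qed.

Lemma rowstart_size : rowstart lam (size lam) = n.
Proof.
case/and3P: lamP => _ _ /eqP <-.
by rewrite /rowstart sumnE (big_nth 0) big_mkord.
Qed.

Lemma rowstart_big i : size lam <= i -> rowstart lam i = n.
Proof.
elim: i => [|i IH]; first by rewrite leqn0 => /eqP h; rewrite -{1}h rowstart_size.
rewrite leq_eqVlt => /orP[/eqP <-|]; first exact: rowstart_size.
by rewrite ltnS => h; rewrite rowstartS IH // nth_default ?addn0.
Qed.

Lemma rowstart_le i : rowstart lam i <= n.
Proof.
case: (leqP (size lam) i) => h; first by rewrite rowstart_big.
by rewrite -rowstart_size rowstart_mono // ltnW.
Qed.

Lemma row_ofE i k : i < size lam -> rowstart lam i <= k < rowstart lam i.+1 ->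
  row_of lam k = i.
Proof.
move=> hi /andP[h1 h2].
rewrite /row_of -(subnKC (ltnW hi)) iotaD count_cat add0n.
have -> : count (fun i => rowstart lam i.+1 <= k) (iota 0 i) = i.
  rewrite -[RHS](size_iota 0) -[RHS]count_predT; apply: eq_in_count => j.
  rewrite mem_iota add0n /= => hj; apply: leq_trans h1; exact: rowstart_mono.
rewrite (@eq_in_count _ _ pred0) ?count_pred0 ?addn0 // => j.
rewrite mem_iota => /andP[hj _]; apply/negbTE; rewrite -ltnNge.
by apply: leq_trans h2 _; apply: rowstart_mono.
Qed.

Lemma row_exists k : k < n ->
  exists2 i, i < size lam & rowstart lam i <= k < rowstart lam i.+1.
Proof.
rewrite -rowstart_size; elim: (size lam) => [|m IH]; first by rewrite rowstart0.
case: (ltnP k (rowstart lam m)) => h hk.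
  by case: (IH h) => i hi hh; exists i => //; apply: leqW.
by exists m => //; rewrite h.
Qed.

Lemma row_bounds k : k < n ->
  rowstart lam (row_of lam k) <= k < rowstart lam (row_of lam k).+1.
Proof. by case/row_exists=> i hi h; rewrite (row_ofE hi h). Qed.

Lemma row_lt_size k : k < n -> row_of lam k < size lam.
Proof. by case/row_exists=> i hi h; rewrite (row_ofE hi h). Qed.

Lemma row_lt k c : k < n -> (row_of lam k < c) = (k < rowstart lam c).
Proof.
move=> /row_bounds /andP[h1 h2]; apply/idP/idP => h.
  by apply: leq_trans h2 _; apply: rowstart_mono.
rewrite ltnNge; apply: contraL h => h; rewrite -leqNgt.
by apply: leq_trans h1; apply: rowstart_mono.
Qed.

Lemma size_part : size lam <= n.
Proof.
have -> : n = rowstart lam (size lam) by rewrite rowstart_size.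
have: forall i, i <= size lam -> i <= rowstart lam i.
  elim=> // i IH h; rewrite rowstartS -addn1 leq_add ?IH ?part_gt0 //; exact: ltnW.
by apply.
Qed.

Lemma row_ltn k : k < n -> row_of lam k < n.
Proof. by move=> /row_lt_size h; apply: leq_trans h size_part. Qed.

Lemma row_mono j k : j <= k -> k < n -> row_of lam j <= row_of lam k.
Proof.
move=> h hk; rewrite -ltnS row_lt; last exact: leq_ltn_trans hk.
by apply: leq_ltn_trans h _; case/andP: (row_bounds hk).
Qed.

Lemma pos_row_col k : k < n -> rowstart lam (row_of lam k) + col_of lam k = k.
Proof. by move=> /row_bounds /andP[h _]; rewrite /col_of subnKC. Qed.

Lemma col_lt k : k < n -> col_of lam k < nth 0 lam (row_of lam k).
Proof.
move=> hk; have /andP[h1 h2] := row_bounds hk.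
by rewrite /col_of ltn_subLR // -rowstartS.
Qed.

Lemma row_col_inj j k : j < n -> k < n -> row_of lam j = row_of lam k ->
  col_of lam j = col_of lam k -> j = k.
Proof. by move=> hj hk h1 h2; rewrite -(pos_row_col hj) h1 h2 pos_row_col. Qed.

Lemma col_ltn k : k < n -> col_of lam k < n.
Proof.
move=> hk; apply: leq_ltn_trans (leq_subr _ _) hk.
Qed.

Section Position.
Variables i j : nat.
Hypothesis hij : j < nth 0 lam i.

Lemma pos_size : i < size lam.
Proof. by rewrite ltnNge; apply/negP => h; move: hij; rewrite nth_default. Qed.

Lemma pos_lt : rowstart lam i + j < n.
Proof.
apply: leq_trans (rowstart_le i.+1); rewrite rowstartS ltn_add2l; exact: hij.
Qed.

Lemma row_pos : row_of lam (rowstart lam i + j) = i.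
Proof. by apply: row_ofE pos_size _; rewrite leq_addr rowstartS ltn_add2l hij. Qed.

Lemma col_pos : col_of lam (rowstart lam i + j) = j.
Proof. by rewrite /col_of row_pos addKn. Qed.
End Position.

Lemma card_ltn_ord m (r : nat) : r <= m -> #|[pred k : 'I_m | k < r]| = r.
Proof.
move=> h; rewrite -[RHS]card_ord -(card_image (f := widen_ord h)).
  apply: eq_card => k; rewrite inE; apply/idP/imageP => [hk|[x _ ->] //=].
  by exists (Ordinal hk) => //; apply: val_inj.
by move=> a b [] /val_inj.
Qed.

Lemma card_row_lt c : #|[pred k : 'I_n | row_of lam k < c]| = rowstart lam c.
Proof.
rewrite -(card_ltn_ord (rowstart_le c)); apply: eq_card => k.
by rewrite !inE row_lt.
Qed.

(** Source of the positive part of the content: these entries give the transpositions of the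
    Jucys-Murphy element of [b] that preserve its row. *)
Lemma card_row_before (b : 'I_n) :
  #|[pred a : 'I_n | (a < b) && (row_of lam a == row_of lam b)]| = col_of lam b.
Proof.
have hb := ltn_ord b; have /andP[h1 h2] := row_bounds hb.
have e1 := card_ltn_ord (ltnW hb); have e2 := card_ltn_ord (rowstart_le (row_of lam b)).
rewrite -(cardID [pred a : 'I_n | a < rowstart lam (row_of lam b)]) in e1.
rewrite /col_of -[X in X - _]e1 -[X in _ - X]e2.
rewrite [X in (X + _) - _](_ : _ = #|[pred k : 'I_n | k < rowstart lam (row_of lam b)]|).
  rewrite addKn; apply: eq_card => a; rewrite !inE -row_lt // -leqNgt.
  case: (ltnP a b) => hab; rewrite ?andbF //=.
  by rewrite andbT eqn_leq (row_mono (ltnW hab)).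
apply: eq_card => a; rewrite 3!inE /=.
case: (ltnP a (rowstart lam (row_of lam b))) => ha; last by rewrite andbF.
by rewrite andbT; apply: leq_trans ha h1.
Qed.
End Partitions.

Lemma part_eq n lam mu : is_partition n lam -> is_partition n mu ->
  (forall c, rowstart lam c = rowstart mu c) -> lam = mu.
Proof.
move=> hl hm h.
have hn i : nth 0 lam i = nth 0 mu i.
  by apply/eqP; rewrite -(eqn_add2l (rowstart lam i)) -rowstartS h rowstartS h.
have hs (a b : seq nat) : is_partition n a -> (forall i, nth 0 a i = nth 0 b i) ->
    size a <= size b.
  move=> ha hab; rewrite leqNgt; apply/negP => hlt.
  by move: (part_gt0 ha hlt); rewrite hab (nth_default _ (leqnn _)).
apply: (@eq_from_nth _ 0); last by move=> i _; exact: hn.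
by apply/eqP; rewrite eqn_leq !hs.
Qed.

(** * The group algebra *)

Local Open Scope ring_scope.

(* An alias of [GA K n] carrying the convolution product [gmul] as its ring structure. *)
Definition galg (K : nzRingType) (n : nat) : Type := GA K n.

HB.instance Definition _ (K : nzRingType) n := GRing.Zmodule.copy (galg K n) {ffun 'S_n -> K}.

Section GroupRing.
Variables (K : nzRingType) (n : nat).
Implicit Types (f g h : galg K n).

Lemma gmulA f g h : gmul f (gmul g h) = gmul (gmul f g) h :> galg K n.
Proof.
apply/ffunP=> s; rewrite !ffunE.
under eq_bigr => t _ do rewrite ffunE big_distrr /=.
under [RHS]eq_bigr => t _ do rewrite ffunE big_distrl /=.
rewrite [RHS]exchange_big /=; apply: eq_bigr => t _.
rewrite [RHS](reindex_inj (mulgI t)) /=; apply: eq_bigr => u _.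
by rewrite mulKg invMg !mulrA mulgA.
Qed.

Lemma gmul_gpermL s f (t : 'S_n) : gmul (gperm K s) f t = f (s^-1 * t)%g.
Proof.
rewrite ffunE (bigD1 s) //= !ffunE eqxx mul1r big1 ?addr0 // => u hu.
by rewrite ffunE (negbTE hu) mul0r.
Qed.

Lemma gmul_gpermR s f (t : 'S_n) : gmul f (gperm K s) t = f (t * s^-1)%g.
Proof.
rewrite ffunE (bigD1 (t * s^-1)%g) //= !ffunE invMg invgK mulgKV eqxx mulr1.
rewrite big1 ?addr0 // => u hu; rewrite ffunE; case: eqP => [e|]; rewrite ?mulr0 //.
by case/eqP: hu; rewrite -e invMg invgK mulKVg.
Qed.

Lemma gmul1l f : gmul (gone K n) f = f :> galg K n.
Proof. by apply/ffunP=> s; rewrite gmul_gpermL invg1 mul1g. Qed.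

Lemma gmul1r f : gmul f (gone K n) = f :> galg K n.
Proof. by apply/ffunP=> s; rewrite gmul_gpermR invg1 mulg1. Qed.

Lemma gmulDl f g h : gmul (f + g) h = gmul f h + gmul g h :> galg K n.
Proof.
apply/ffunP=> s; rewrite !ffunE -big_split /=; apply: eq_bigr => t _.
by rewrite ffunE mulrDl.
Qed.

Lemma gmulDr f g h : gmul h (f + g) = gmul h f + gmul h g :> galg K n.
Proof.
apply/ffunP=> s; rewrite !ffunE -big_split /=; apply: eq_bigr => t _.
by rewrite ffunE mulrDr.
Qed.

Lemma gone_neq0 : (gone K n : galg K n) != 0.
Proof.
by apply/eqP => /ffunP/(_ 1%g)/eqP; rewrite !ffunE eqxx oner_eq0.
Qed.

Lemma gscaleA (a b : K) f : gscale a (gscale b f) = gscale (a * b) f :> galg K n.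
Proof. by apply/ffunP=> s; rewrite !ffunE mulrA. Qed.
Lemma gscale1 f : gscale 1 f = f :> galg K n.
Proof. by apply/ffunP=> s; rewrite !ffunE mul1r. Qed.
Lemma gscaleDr (a : K) f g : gscale a (f + g) = gscale a f + gscale a g :> galg K n.
Proof. by apply/ffunP=> s; rewrite !ffunE mulrDr. Qed.
Lemma gscaleDl f (a b : K) : gscale (a + b) f = gscale a f + gscale b f :> galg K n.
Proof. by apply/ffunP=> s; rewrite !ffunE mulrDl. Qed.
Lemma gscaleAl (a : K) f g : gscale a (gmul f g) = gmul (gscale a f) g :> galg K n.
Proof.
apply/ffunP=> s; rewrite !ffunE big_distrr /=; apply: eq_bigr => t _.
by rewrite ffunE mulrA.
Qed.
End GroupRing.

HB.instance Definition _ (K : nzRingType) n := GRing.Zmodule_isNzRing.Build (galg K n)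
  (@gmulA K n) (@gmul1l K n) (@gmul1r K n) (@gmulDl K n)
  (fun h f g => @gmulDr K n f g h) (@gone_neq0 K n).
HB.instance Definition _ (K : nzRingType) n := GRing.Zmodule_isLmodule.Build K (galg K n)
  (@gscaleA K n) (@gscale1 K n) (@gscaleDr K n) (@gscaleDl K n).
HB.instance Definition _ (K : nzRingType) n := GRing.Lmodule_isLalgebra.Build K (galg K n) (@gscaleAl K n).

Section Galg.
Variables (K : comNzRingType) (n : nat).
Implicit Types (f g h : galg K n) (s t : 'S_n).

Lemma gscaleAr (a : K) f g : a *: (f * g) = f * (a *: g).
Proof.
apply/ffunP=> s; rewrite !ffunE big_distrr /=; apply: eq_bigr => t _.
by rewrite ffunE mulrCA.
Qed.
End Galg.
HB.instance Definition _ (K : comNzRingType) n :=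
  GRing.Lalgebra_isAlgebra.Build K (galg K n) (@gscaleAr K n).

Definition gp (K : nzRingType) n (s : 'S_n) : galg K n := gperm K s.
Definition star (K : nzRingType) n (f : galg K n) : galg K n := gstar f.
Definition dot (K : nzRingType) n (f g : galg K n) : K := \sum_s f s * g s.
Definition gmap (K : nzRingType) n (f : galg int n) : galg K n := [ffun s => (f s)%:~R].

Section Galg.
Variables (K : comNzRingType) (n : nat).
Implicit Types (f g h : galg K n) (s t : 'S_n).

Lemma gpE s t : gp K s t = (t == s)%:R. Proof. by rewrite ffunE. Qed.
Lemma gp1 : gp K (1%g : 'S_n) = 1. Proof. by []. Qed.
Lemma gpML s f t : (gp K s * f) t = f (s^-1 * t)%g. Proof. exact: gmul_gpermL. Qed.
Lemma gpMR s f t : (f * gp K s) t = f (t * s^-1)%g. Proof. exact: gmul_gpermR. Qed.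
Lemma gpM s t : gp K (s * t)%g = gp K s * gp K t.
Proof.
apply/ffunP=> u; rewrite gpML !gpE; congr (nat_of_bool _)%:R.
by apply/eqP/eqP => [->|<-]; rewrite ?mulKg ?mulKVg.
Qed.

Lemma galgD f g s : (f + g) s = f s + g s. Proof. by rewrite ffunE. Qed.
Lemma galgN f s : (- f) s = - f s. Proof. by rewrite ffunE. Qed.
Lemma galgZ a f s : (a *: f) s = a * f s. Proof. by rewrite ffunE. Qed.
Lemma galg0 s : (0 : galg K n) s = 0. Proof. by rewrite ffunE. Qed.
Lemma galg_sumE I (r : seq I) P (F : I -> galg K n) s :
  (\sum_(i <- r | P i) F i) s = \sum_(i <- r | P i) F i s.
Proof. by elim/big_rec2: _ => [|i y1 y2 _ <-]; rewrite ?galg0 ?galgD. Qed.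

Lemma galg_basis f : f = \sum_s f s *: gp K s.
Proof.
apply/ffunP=> t; rewrite galg_sumE (bigD1 t) //= galgZ gpE eqxx mulr1 big1 ?addr0 //.
by move=> s hs; rewrite galgZ gpE eq_sym (negbTE hs) mulr0.
Qed.

Lemma starE f s : star f s = f (s^-1)%g. Proof. by rewrite ffunE. Qed.
Lemma starK : involutive (@star K n).
Proof. by move=> f; apply/ffunP=> s; rewrite !starE invgK. Qed.
Lemma star_zmod : zmod_morphism (@star K n).
Proof. by move=> f g; apply/ffunP=> s; rewrite !(starE, galgD, galgN). Qed.
HB.instance Definition _ := GRing.isZmodMorphism.Build (galg K n) (galg K n) (@star K n) star_zmod.
Lemma starZ a f : star (a *: f) = a *: star f.
Proof. by apply/ffunP=> s; rewrite !(starE, galgZ). Qed.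
Lemma star_gp s : star (gp K s) = gp K (s^-1)%g.
Proof.
apply/ffunP=> t; rewrite starE !gpE; congr (nat_of_bool _)%:R.
by apply/eqP/eqP => [<-|->]; rewrite invgK.
Qed.
Lemma starM f g : star (f * g) = star g * star f.
Proof.
apply/ffunP=> s; rewrite starE !ffunE (reindex_inj (mulgI (s^-1)%g)) /=.
by apply: eq_bigr => t _; rewrite !starE invMg !invgK mulgK mulrC invMg invgK.
Qed.

Lemma dotE f g : dot f g = (star f * g) 1%g.
Proof.
rewrite ffunE (reindex_inj invg_inj) /=; apply: eq_bigr => s _.
by rewrite starE invgK mulg1.
Qed.
Lemma dotC f g : dot f g = dot g f.
Proof. by apply: eq_bigr => s _; rewrite mulrC. Qed.
Lemma dot_starM f g : dot f g = (g * star f) 1%g.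
Proof. by rewrite ffunE; apply: eq_bigr => s _; rewrite starE mulg1 invgK mulrC. Qed.
Lemma dotDr f g h : dot f (g + h) = dot f g + dot f h.
Proof. by rewrite -big_split; apply: eq_bigr => s _; rewrite galgD mulrDr. Qed.
Lemma dotDl f g h : dot (g + h) f = dot g f + dot h f.
Proof. by rewrite dotC dotDr !(dotC f). Qed.
Lemma dotZr a f g : dot f (a *: g) = a * dot f g.
Proof. by rewrite big_distrr; apply: eq_bigr => s _; rewrite galgZ mulrCA. Qed.
Lemma dotZl a f g : dot (a *: f) g = a * dot f g.
Proof. by rewrite dotC dotZr dotC. Qed.
Lemma dot0r f : dot f 0 = 0. Proof. by rewrite -(scale0r 0) dotZr mul0r. Qed.
Lemma dotMl f g h : dot (h * f) g = dot f (star h * g).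
Proof. by rewrite !dotE starM mulrA. Qed.
Lemma dotMr f g h : dot (f * h) g = dot f (g * star h).
Proof. by rewrite !dot_starM starM mulrA. Qed.
Lemma dot_gp f s : dot f (gp K s) = f s.
Proof.
rewrite /dot (bigD1 s) //= gpE eqxx mulr1 big1 ?addr0 // => t hs.
by rewrite gpE (negbTE hs) mulr0.
Qed.

End Galg.

Section IntegralElements.
Variables (K : comNzRingType) (n : nat).
Implicit Types (f g h : galg int n) (s t : 'S_n).

Lemma gmapE f s : gmap K f s = (f s)%:~R. Proof. by rewrite ffunE. Qed.
Lemma gmap_zmod : zmod_morphism (@gmap K n).
Proof. by move=> f g; apply/ffunP=> s; rewrite !(gmapE, ffunE) rmorphB. Qed.
Lemma gmap_monoid : monoid_morphism (@gmap K n).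
Proof.
split=> [|f g]; apply/ffunP=> s; first by rewrite gmapE !ffunE; case: eqP.
rewrite gmapE !ffunE rmorph_sum; apply: eq_bigr => t _.
by rewrite !gmapE rmorphM.
Qed.
HB.instance Definition _ := GRing.isZmodMorphism.Build (galg int n) (galg K n) (@gmap K n) gmap_zmod.
HB.instance Definition _ := GRing.isMonoidMorphism.Build (galg int n) (galg K n) (@gmap K n) gmap_monoid.
Lemma gmap_gp s : gmap K (gp int s) = gp K s.
Proof. by apply/ffunP=> t; rewrite gmapE !gpE; case: (t == s). Qed.
Lemma gmapZ (a : int) f : gmap K (a *: f) = a%:~R *: gmap K f.
Proof. by apply/ffunP=> t; rewrite gmapE !galgZ gmapE rmorphM. Qed.
Lemma gmap_star f : gmap K (star f) = star (gmap K f).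
Proof. by apply/ffunP=> t; rewrite gmapE !starE gmapE. Qed.
End IntegralElements.

(** Positivity over the rationals. It makes self-adjoint elements semisimple and the pairing with
    the dual nondegenerate. *)
Lemma dot_self_eq0 n (f : galg rat n) : dot f f = 0 -> f = 0.
Proof.
rewrite /dot => h; apply/ffunP=> s; rewrite ffunE.
have : f s * f s = 0.
  have hp (t : 'S_n) : true -> 0 <= f t * f t by move=> _; rewrite -expr2 sqr_ge0.
  by have := psumr_eq0P hp h; apply. 
by move/eqP; rewrite mulf_eq0 orbb => /eqP.
Qed.

(** * Tabloid sums *)

(* For colourings [F], [f] of the entries, the sum of all permutations [g] with [F \o g = f];
   [tab (row_of lam) f] is the tabloid in which entry [k] lies in row [f k]. *)
Definition tab (K : nzRingType) n (F f : 'I_n -> nat) : galg K n :=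
  [ffun g : 'S_n => [forall k, F (g k) == f k]%:R].

(** Partial sums of the colour sizes, which dominance compares with [rowstart]. *)
Definition cumul n (F : 'I_n -> nat) (c : nat) : nat := #|[pred k | F k < c]%N|.

Section Tabloids.
Variables (K : comNzRingType) (n : nat).
Implicit Types (F f : 'I_n -> nat) (g h s : 'S_n).

Lemma tabP F f g : tab K F f g = [forall k, F (g k) == f k]%:R.
Proof. by rewrite ffunE. Qed.

Lemma tab_neq0 F f g : tab K F f g != 0 -> forall k, F (g k) = f k.
Proof. by rewrite tabP; case: forallP => [h _ k|]; [apply/eqP | rewrite eqxx]. Qed.

Lemma eq_tab F F' f f' : F =1 F' -> f =1 f' -> tab K F f = tab K F' f'.
Proof.
move=> hF hf; apply/ffunP=> g; rewrite !tabP; congr (nat_of_bool _)%:R.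
by apply: eq_forallb => k; rewrite hF hf.
Qed.

Lemma gp_tab h F f : gp K h * tab K F f = tab K F (fun k => f (h k)).
Proof.
apply/ffunP=> g; rewrite gpML !tabP; congr (nat_of_bool _)%:R.
apply/forallP/forallP => H k; last by have := H (h^-1 k)%g; rewrite permM permKV.
by have := H (h k); rewrite permM permK.
Qed.

Lemma tab_gp h F f : tab K F f * gp K h = tab K (fun k => F (h^-1 k)%g) f.
Proof.
by apply/ffunP=> g; rewrite gpMR !tabP; congr (nat_of_bool _)%:R;
  apply: eq_forallb => k; rewrite permM.
Qed.

Lemma star_tab F f : star (tab K F f) = tab K f F.
Proof.
apply/ffunP=> g; rewrite starE !tabP; congr (nat_of_bool _)%:R.
by apply/forallP/forallP => H k; [have := H (g k) | have := H (g^-1 k)%g];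
  rewrite ?permK ?permKV eq_sym.
Qed.

Lemma tab_relabel (c : nat -> nat) F f : injective c ->
  tab K (fun k => c (F k)) (fun k => c (f k)) = tab K F f.
Proof.
move=> hc; apply/ffunP=> g; rewrite !tabP; congr (nat_of_bool _)%:R.
by apply: eq_forallb => k; rewrite (inj_eq hc).
Qed.

Lemma xl_tab lam : xl K n lam = tab K (row_of lam) (row_of lam).
Proof.
rewrite /xl; apply/ffunP=> g; rewrite (galg_sumE (K := K)) tabP -/(rowstab lam g).
rewrite big_mkcond (bigD1 g) //= big1 ?addr0.
  by rewrite gpE eqxx; case: (rowstab _ _).
by move=> s hs; case: (rowstab _ _) => //; rewrite gpE eq_sym (negbTE hs).
Qed.
End Tabloids.

Lemma gmap_tab (K : comNzRingType) n (F f : 'I_n -> nat) :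
  gmap K (tab int F f) = tab K F f.
Proof. by apply/ffunP=> g; rewrite gmapE !tabP; case: [forall _, _]. Qed.

(** * Colour classes and dominance of compositions *)

Section Colourings.
Variable n : nat.
Implicit Types F G : 'I_n -> nat.

Lemma cumulS F c : cumul F c.+1 = (cumul F c + #|[pred k | F k == c]|)%N.
Proof.
rewrite /cumul -(cardID [pred k | F k < c]%N); congr (_ + _)%N; apply: eq_card => k.
  by rewrite !inE; lia.
by rewrite !inE; lia.
Qed.

Lemma cumul_all F c : (forall k, F k < c)%N -> cumul F c = n.
Proof.
by move=> h; rewrite /cumul (eq_card (B := 'I_n)) ?card_ord // => k; rewrite !inE h.
Qed.

Lemma cumul_le F c : (cumul F c <= n)%N.
Proof. by rewrite -[X in (_ <= X)%N]card_ord max_card. Qed.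

Lemma eq_cumul F G c : F =1 G -> cumul F c = cumul G c.
Proof. by move=> h; apply: eq_card => k; rewrite !inE h. Qed.

Lemma cumul_perm F (g : 'S_n) c : cumul (fun k => F (g k)) c = cumul F c.
Proof.
rewrite /cumul -!sum1_card [RHS](reindex_inj (@perm_inj _ g)) /=.
by apply: eq_bigl => k; rewrite !inE.
Qed.

Lemma same_fibers F G : (forall c, cumul F c = cumul G c) ->
  exists s : 'S_n, forall k, F k = G (s k).
Proof.
move=> h.
have hc c : #|[pred k | F k == c]| = #|[pred k | G k == c]|.
  by apply/eqP; rewrite -(eqn_add2l (cumul F c)) -cumulS h cumulS h.
have /tuple_permP[s hs] : perm_eq [tuple F i | i < n] [tuple G i | i < n].
  apply/allP => c _ /=; apply/eqP; rewrite !count_map.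
  by have := hc c; rewrite !cardE /enum_mem !size_filter.
by exists s => k; have /val_inj/(congr1 (fun t => tnth t k)) := hs; rewrite !tnth_mktuple.
Qed.

End Colourings.

Definition higher (lam mu : seq nat) : Prop := dominates mu lam /\ mu <> lam.

Definition colour_swap (i c : nat) : nat :=
  if c == i then i.+1 else if c == i.+1 then i else c.

Lemma colour_swapK i : involutive (colour_swap i).
Proof. by move=> c; rewrite /colour_swap; case: (c =P i) => ?; case: (c =P i.+1) => ?; do 2?(case: eqP => ?); lia. Qed.

Lemma cumul_colour_swap n (F : 'I_n -> nat) i c : c != i.+1 ->
  cumul (fun k => colour_swap i (F k)) c = cumul F c.
Proof.
by move=> h; apply: eq_card => k; rewrite !inE /colour_swap; case: (F k =P i) => ?; case: (F k =P i.+1) => ?; try (case: eqP => ?); lia.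
Qed.

Lemma cumul_colour_swapS n (F : 'I_n -> nat) i :
  cumul (fun k => colour_swap i (F k)) i.+1 = (cumul F i + #|[pred k | F k == i.+1]|)%N.
Proof.
rewrite cumulS cumul_colour_swap; last by lia.
congr (_ + _)%N; apply: eq_card => k; rewrite !inE /colour_swap; case: (F k =P i) => ?; case: (F k =P i.+1) => ?; try (case: eqP => ?); lia.
Qed.

Section Sorting.
Variables (n : nat) (lam : seq nat).

(** Strict dominance for compositions: the sizes of the colour classes need not decrease. *)
Definition above (F : 'I_n -> nat) : Prop :=
  (forall c, (rowstart lam c <= cumul F c)%N) /\ (exists c, (rowstart lam c < cumul F c)%N).

Lemma sorted_colouring (F : 'I_n -> nat) :
  (forall c, #|[pred k | F k == c.+1]| <= #|[pred k | F k == c]|)%N ->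
  exists mu, is_partition n mu /\ forall c, rowstart mu c = cumul F c.
Proof.
set sz := fun c => #|[pred k | F k == c]| => hs.
have szmono i j : (i <= j)%N -> (sz j <= sz i)%N.
  elim: j => [|j IH]; first by rewrite leqn0 => /eqP->.
  rewrite leq_eqVlt => /orP[/eqP->//|]; rewrite ltnS => /IH; apply: leq_trans; exact: hs.
have ex0 : exists c, sz c == 0%N.
  exists (\max_k F k).+1; apply/eqP/eq_card0 => k; rewrite !inE; apply/negbTE.
  by rewrite neq_ltn ltnS (leq_bigmax k).
(* [M] is the first empty colour; as the sizes decrease, all later colours are empty too, so [M] is
   the number of parts. *)
case: (ex_minnP ex0) => M /eqP hM0 hM.
have szM c : (M <= c)%N -> sz c = 0%N.
  by move=> /szmono; rewrite hM0 leqn0 => /eqP.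
have hlt c : (c < M)%N -> (0 < sz c)%N.
  by rewrite lt0n; apply: contraTN => /hM; rewrite -leqNgt.
have nthE c : nth 0%N (mkseq sz M) c = sz c.
  case: (ltnP c M) => h; first by rewrite nth_mkseq.
  by rewrite nth_default ?size_mkseq // szM.
have rsE c : rowstart (mkseq sz M) c = cumul F c.
  elim: c => [|c IH]; first by rewrite rowstart0; apply/esym/eq_card0 => k; rewrite !inE.
  by rewrite rowstartS IH nthE cumulS.
exists (mkseq sz M); split=> //; apply/and3P; split.
- rewrite /mkseq sorted_map; apply: (sub_sorted (e := leq)) (iota_sorted 0 M).
  by move=> i j /szmono.
- by apply/allP => y /mapP[c]; rewrite mem_iota => /hlt h ->.
- rewrite sumnE (big_nth 0%N) big_mkord -/(rowstart _ _) rsE size_mkseq cumul_all // => k.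
  rewrite ltnNge; apply/negP => /szM /eqP; rewrite -leqn0 leqNgt => /negP; apply.
  by apply/card_gt0P; exists k; rewrite !inE.
Qed.

(* Exchanging two neighbouring colours of increasing sizes keeps [F] above [lam] and raises
   [cumul], so the colour sizes can be sorted. *)
Lemma above_partition F : above F ->
  exists mu (s : 'S_n), [/\ is_partition n mu, higher lam mu &
    forall (K : comNzRingType) f,
      exists f', tab K F f = tab K (fun k : 'I_n => row_of mu k) f' * gp K s].
Proof.
have [N hN] : exists N, forall k, (F k < N)%N.
  by exists (\max_k F k).+1 => k; rewrite ltnS (leq_bigmax k).
have [m] := ubnP (N * n - \sum_(c < N) cumul F c)%N.
elim: m F hN => // m IH F hN; rewrite ltnS => hm [hdom [c0 hc0]].
case: (boolP [exists i : 'I_N, #|[pred k | F k == i]| < #|[pred k | F k == i.+1]|]%N).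
  case/existsP=> i hi; set G := fun k => colour_swap i (F k).
  have hiN : (i.+1 < N)%N.
    have /card_gt0P[k] : (0 < #|[pred k | F k == i.+1]|)%N by apply: leq_trans hi.
    by rewrite inE => /eqP <-.
  have hcG c : (cumul F c <= cumul G c)%N.
    case: (c =P i.+1) => [->|/eqP h]; last by rewrite cumul_colour_swap.
    by rewrite cumul_colour_swapS cumulS leq_add2l ltnW.
  case: (IH G).
  - by move=> k; rewrite /G /colour_swap; do 2?case: ifP => // _; apply: leq_trans hiN.
  - apply: leq_trans hm; rewrite ltn_sub2l //.
      apply: (@leq_trans (\sum_(c < N) cumul G c)%N).
        rewrite (bigD1 (Ordinal hiN)) //= [X in (_ < X)%N](bigD1 (Ordinal hiN)) //=.
        rewrite cumul_colour_swapS cumulS -addSn leq_add ?ltn_add2l //.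
        by apply: leq_sum => c _; apply: hcG.
      by rewrite -[X in (X * _)%N]card_ord -sum_nat_const leq_sum // => c _; exact: cumul_le.
    rewrite (bigD1 (Ordinal hiN)) //= [X in (_ < X)%N](bigD1 (Ordinal hiN)) //=.
    rewrite cumul_colour_swapS cumulS -addSn leq_add ?ltn_add2l //.
    by apply: leq_sum => c _; apply: hcG.
  - split=> [c|]; first by apply: leq_trans (hdom c) (hcG c).
    by exists c0; apply: leq_trans hc0 (hcG c0).
  move=> mu [s [hmu hh hs]]; exists mu, s; split=> // K f.
  have [f' hf'] := hs K (fun k => colour_swap i (f k)); exists f'; rewrite -hf'.
  by rewrite tab_relabel //; apply: (can_inj (@colour_swapK i)).
move=> hnex; case: (@sorted_colouring F).
  move=> c; case: (ltnP c N) => hcN.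
    by move/existsPn/(_ (Ordinal hcN)): hnex; rewrite -leqNgt.
  rewrite [X in (X <= _)%N]eq_card0 // => k; rewrite !inE; apply/negbTE.
  by rewrite neq_ltn (leq_trans (hN k)) // ltnW.
(* Equal class sizes make [F] a rearrangement of the row colouring of [mu], which is a right
   multiplication by a permutation. *)
move=> mu [hmu hrs]; case: (@same_fibers n F (fun k => row_of mu k)).
  by move=> c; rewrite -hrs /cumul card_row_lt.
move=> s hs; exists mu, s^-1%g; split=> //.
  split=> [c|e]; first by have := hdom c; rewrite -hrs.
  by move: hc0; rewrite -hrs e ltnn.
move=> K f; exists f; rewrite tab_gp; apply: eq_tab => // k.
by rewrite invgK hs.
Qed.
End Sorting.

(** * Spans and weights *)

Inductive zspan (V : zmodType) (G : V -> Prop) : V -> Prop :=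
| zspan_gen x : G x -> zspan G x
| zspan0 : zspan G 0
| zspanB x y : zspan G x -> zspan G y -> zspan G (x - y).

Section Spans.
Variables (V W : zmodType).
Implicit Types (G : V -> Prop) (H : W -> Prop).

Lemma zspanN G x : zspan G x -> zspan G (- x).
Proof. by move=> h; rewrite -(sub0r x); apply: zspanB h; apply: zspan0. Qed.

Lemma zspanD G x y : zspan G x -> zspan G y -> zspan G (x + y).
Proof. by move=> hx /zspanN hy; rewrite -(opprK y); apply: zspanB. Qed.

Lemma zspan_sum G I (r : seq I) (P : pred I) (F : I -> V) :
  (forall i, P i -> zspan G (F i)) -> zspan G (\sum_(i <- r | P i) F i).
Proof. by move=> h; elim/big_rec: _ => [|i x hi]; [apply: zspan0 | apply: zspanD; apply: h]. Qed.

Lemma zspan_map G H (u : V -> W) x : zmod_morphism u ->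
  (forall g, G g -> zspan H (u g)) -> zspan G x -> zspan H (u x).
Proof.
move=> hu h; elim=> [g /h //||y z _ hy _ hz]; last by rewrite hu; apply: zspanB.
by rewrite -(subrr 0) hu subrr; apply: zspan0.
Qed.
End Spans.

Lemma zspan_trans (V : zmodType) (G H : V -> Prop) x :
  (forall g, G g -> zspan H g) -> zspan G x -> zspan H x.
Proof. by move=> h; elim=> [g /h //||y z _ hy _ hz]; [apply: zspan0 | apply: zspanB]. Qed.

Lemma zspan_int (V : lmodType int) (G : V -> Prop) (a : int) x :
  zspan G x -> zspan G (a *: x).
Proof.
move=> h; have hn m : zspan G (m%:Z *: x).
  elim: m => [|m IH]; first by rewrite scale0r; apply: zspan0.
  by rewrite -addn1 PoszD scalerDl scale1r; apply: zspanD.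
by case: a => m //; rewrite NegzE scaleNr; apply: zspanN.
Qed.

Definition murphy_gen n (Q : seq nat -> Prop) (z : galg int n) : Prop :=
  exists mu s t, [/\ is_partition n mu, Q mu, standard mu s, standard mu t &
                     z = murphy int mu s t].

(** Integral form of the higher span; [gspan] also admits [lam] itself and is the target of the
    straightening. *)
Definition hspan n lam : galg int n -> Prop := zspan (murphy_gen (higher lam)).
Definition gspan n lam : galg int n -> Prop := zspan (murphy_gen (fun mu => dominates mu lam)).

Notation rowc lam := (fun k => row_of lam (nat_of_ord k)).

Lemma dominates_trans a b c : dominates a b -> dominates b c -> dominates a c.
Proof. by move=> h1 h2 k; apply: leq_trans (h2 k) (h1 k). Qed.

Lemma dominates_antisym n a b : is_partition n a -> is_partition n b ->
  dominates a b -> dominates b a -> a = b.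
Proof.
move=> ha hb h1 h2; apply: (part_eq ha hb) => c.
by apply/eqP; rewrite eqn_leq; apply/andP; split; [apply: h2 | apply: h1].
Qed.

Lemma gspan_hspan n lam mu (z : galg int n) : is_partition n lam -> is_partition n mu ->
  higher lam mu -> gspan mu z -> hspan lam z.
Proof.
move=> hl hm [hd hne]; apply: zspan_trans => _ [nu [s [t [hnu hnd hs ht ->]]]].
apply: zspan_gen; exists nu, s, t; split=> //; split; first exact: dominates_trans hd.
move=> e; rewrite e in hnd; apply: hne; exact: dominates_antisym hm hl hd hnd.
Qed.

Lemma hspan_gspan n lam (z : galg int n) : hspan lam z -> gspan lam z.
Proof.
apply: zspan_trans => _ [nu [s [t [hnu [hd _] hs ht ->]]]].
by apply: zspan_gen; exists nu, s, t.
Qed.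

Lemma murphyE (K : comNzRingType) n lam (s t : 'S_n) :
  murphy K lam s t = gp K s^-1%g * tab K (rowc lam) (rowc lam) * gp K t.
Proof. rewrite -xl_tab; reflexivity. Qed.

(** * A lexicographic weight on colourings *)

Section Weight.
Variable n : nat.
Implicit Types f g : 'I_n -> nat.

Fixpoint horner_weight (f : nat -> nat) (m : nat) : nat :=
  if m is m'.+1 then (n.+1 * horner_weight f m' + f m')%N else 0%N.

Definition extend f (k : nat) : nat := oapp f 0%N (insub k).

Lemma extendE f (k : 'I_n) : extend f k = f k.
Proof. by rewrite /extend valK. Qed.

(* The colourings with values at most [n], in lexicographic order. *)
Definition weight f : nat := horner_weight (extend f) n.

Lemma eq_weight f g : f =1 g -> weight f = weight g.
Proof.
move=> h; rewrite /weight.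
have e m : horner_weight (extend f) m = horner_weight (extend g) m; last exact: e.
elim: m => //= m ->; congr (_ + _)%N; rewrite /extend; by case: (insub m) => /= [i|]; rewrite ?h.
Qed.

(** A surplus of one in digit [k] outweighs all later digits of [f], which are at most [n] in base
    [n.+1]; hence only the smaller colouring has to be bounded. *)
Lemma weight_lt f g (k : 'I_n) : (forall j, f j <= n)%N ->
  (forall j : 'I_n, j < k -> f j = g j)%N -> (f k < g k)%N -> (weight f < weight g)%N.
Proof.
move=> hf hj hk; rewrite /weight.
have hj' j : (j < k)%N -> extend f j = extend g j.
  by move=> h; have := hj (Ordinal (ltn_trans h (ltn_ord k))) h; rewrite -(extendE f) -(extendE g).
have heq m : (m <= k)%N -> horner_weight (extend f) m = horner_weight (extend g) m.
  by elim: m => //= m IH hm; rewrite IH ?hj' // ltnW.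
suff hgen m : (m <= n)%N -> (k < m)%N ->
    (horner_weight (extend f) m < horner_weight (extend g) m)%N by apply: hgen.
elim: m => // m IH hmn; rewrite ltnS leq_eqVlt => /orP[/eqP e|hkm] /=.
  by rewrite heq ?e // ltn_add2l -e (extendE f) (extendE g).
have h1 := IH (ltnW hmn) hkm; have h2 := hf (Ordinal hmn); rewrite -(extendE f) /= in h2.
by apply: leq_trans (leq_addr _ _); nia.
Qed.

Lemma first_difference f g (k0 : 'I_n) : f k0 != g k0 ->
  exists k, f k != g k /\ forall j : 'I_n, (j < k)%N -> f j = g j.
Proof.
move=> h; case: (@arg_minnP _ k0 (fun k => f k != g k) val h) => k hk hmin.
exists k; split=> // j hj; apply/eqP; apply: contraTT hj => /hmin.
by rewrite -leqNgt.
Qed.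

Lemma weight_inj f g : (forall j, f j <= n)%N -> (forall j, g j <= n)%N ->
  weight f = weight g -> f =1 g.
Proof.
move=> hf hg e k; apply/eqP; apply/negPn/negP => /first_difference[j [hj hlt]].
case/orP: (leq_total (f j) (g j)); rewrite leq_eqVlt => /orP[].
- by rewrite (negbTE hj).
- by move/(weight_lt hf hlt); rewrite e ltnn.
- by rewrite eq_sym (negbTE hj).
- by move/(weight_lt hg (fun i h => esym (hlt i h))); rewrite e ltnn.
Qed.
End Weight.

(** * Garnir relations and straightening *)

(** For sums over subsets in which each permutation selects at most one subset, such as the two
    expansions of a Garnir element. *)
Lemma big_unique (R : nzRingType) (T : finType) (P : pred T) (b : bool) (t0 : T) :
  (forall t, P t = b && (t == t0)) -> \sum_t (P t)%:R = b%:R :> R.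
Proof.
move=> h; rewrite (bigD1 t0) //= h eqxx andbT big1 ?addr0 // => t /negbTE ht.
by rewrite h ht andbF.
Qed.

Lemma card_interval n lo hi : (lo <= hi)%N -> (hi <= n)%N ->
  #|[pred k : 'I_n | lo <= k < hi]%N| = (hi - lo)%N.
Proof.
move=> h1 h2; have e := card_ltn_ord h2.
rewrite -(cardID [pred k : 'I_n | k < lo]%N) in e.
rewrite -[X in (X - _)%N]e -[X in (_ - X)%N](@card_ltn_ord n lo) ?(leq_trans h1) //.
rewrite [X in ((X + _) - _)%N](_ : _ = #|[pred k : 'I_n | k < lo]%N|).
  by rewrite addKn; apply: eq_card => k; rewrite !inE; lia.
by apply: eq_card => k; rewrite !inE; lia.
Qed.

Section Straightening.
Variables (n : nat) (lam : seq nat).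
Hypothesis lamP : is_partition n lam.

Lemma above_lower (F : 'I_n -> nat) : (forall k, F k <= row_of lam k)%N ->
  (exists k, F k < row_of lam k)%N -> above lam F.
Proof.
move=> h [k0 hk0]; split=> [c|]; first rewrite -(card_row_lt lamP).
  by apply/subset_leq_card/subsetP => k; rewrite !inE; apply: leq_ltn_trans.
exists (F k0).+1; rewrite -(card_row_lt lamP).
apply/proper_card/properP; split.
  by apply/subsetP => k; rewrite !inE; apply: leq_ltn_trans.
by exists k0; rewrite !inE ltnS // -ltnNge.
Qed.

(** Induction hypothesis of [murphy_span]. It already makes the higher span of [lam] a two-sided
    ideal, before anything is known about shape [lam]. *)
Hypothesis IH : forall mu, is_partition n mu -> higher lam mu ->
  forall f (s : 'S_n), gspan mu (tab int (rowc mu) f * gp int s).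

Lemma above_hspan_IH F f (s : 'S_n) : above lam F -> hspan lam (tab int F f * gp int s).
Proof.
move=> /above_partition[mu [s' [hmu hh h]]]; have [f' ->] := h int f.
rewrite -mulrA -gpM; apply: (gspan_hspan lamP hmu hh); exact: IH.
Qed.

Lemma hspan_mull_IH (s : 'S_n) z : hspan lam z -> hspan lam (gp int s * z).
Proof.
apply: (zspan_map (mulrBr (gp int s))) => _ [mu [u [t [hmu hh hu ht ->]]]] /=.
rewrite murphyE !mulrA -gpM gp_tab.
by apply: (gspan_hspan lamP hmu hh); apply: IH.
Qed.

Lemma hspan_mulr_IH (s : 'S_n) z : hspan lam z -> hspan lam (z * gp int s).
Proof.
apply: (zspan_map (u := *%R^~ (gp int s)) (fun x y => mulrBl (gp int s) x y)) => _ [mu [u [t [hmu hh hu ht ->]]]] /=.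
rewrite murphyE gp_tab -mulrA -gpM.
by apply: (gspan_hspan lamP hmu hh); apply: IH.
Qed.

(* The sum of all tabloids whose entries outside [U] lie in the rows prescribed by [f],
   those in [U] being distributed over the rows [i] and [i']. *)
Definition garnir i i' (U : {set 'I_n}) (f : 'I_n -> nat) : galg int n :=
  [ffun g : 'S_n => [forall k, if k \in U then row_of lam (g k) \in [:: i; i']
                               else row_of lam (g k) == f k]%:R].

Definition recolour (f : 'I_n -> nat) (a : 'I_n) (c : nat) : 'I_n -> nat :=
  fun k => if k == a then c else f k.

Lemma garnir_split (i i' : nat) (U : {set 'I_n}) (f : 'I_n -> nat) (a : 'I_n) : i != i' -> a \notin U -> f a = i ->
  garnir i i' U f = garnir i i' (a |: U) f - garnir i i' U (recolour f a i').
Proof.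
move=> hii ha hfa; apply/eqP; rewrite eq_sym subr_eq; apply/eqP/ffunP=> g.
rewrite !ffunE -natrD; congr _%:R.
set A := [forall k, _]; set B := [forall k, _]; set C := [forall k, _].
pose D := [forall k, (k != a) ==> (if k \in U then row_of lam (g k) \in [:: i; i']
                               else row_of lam (g k) == f k)].
have -> : A = D && (row_of lam (g a) \in [:: i; i']).
  apply/forallP/andP => [h|[/forallP h1 h2] k].
    split; last by have := h a; rewrite setU11.
    by apply/forallP => k; apply/implyP => hk; have := h k; rewrite in_setU1 (negbTE hk).
  rewrite in_setU1; case: eqVneq => [-> //|hk] /=.
  by have := h1 k; rewrite hk.
have -> : B = D && (row_of lam (g a) == i).
  apply/forallP/andP => [h|[/forallP h1 h2] k].
    split; last by have := h a; rewrite (negbTE ha) hfa.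
    by apply/forallP => k; apply/implyP => hk; exact: h.
  by case: (eqVneq k a) => [->|hk]; [rewrite (negbTE ha) hfa | have := h1 k; rewrite hk].
have -> : C = D && (row_of lam (g a) == i').
  apply/forallP/andP => [h|[/forallP h1 h2] k].
    split; last by have := h a; rewrite (negbTE ha) /recolour eqxx.
    by apply/forallP => k; apply/implyP => hk; have := h k; rewrite /recolour (negbTE hk).
  rewrite /recolour; case: (eqVneq k a) => [->|hk]; first by rewrite (negbTE ha).
  by have := h1 k; rewrite hk.
rewrite !inE; case: D => //=; case: (row_of lam (g a) =P i) => [->|_] //=.
by rewrite (negbTE hii).
Qed.

(** Entries outside [U] prescribed to row [i] are first absorbed into [U] or moved to row [i']. Then
    row [i] can contain only entries of [U], and since they do not all fit there, some position of
    row [i'] merges with row [i], which gives a more dominant shape. *)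
Lemma garnir_span (i i' : nat) (U : {set 'I_n}) f : (i < i')%N -> (nth 0%N lam i < #|U|)%N ->
  hspan lam (garnir i i' U f).
Proof.
move=> hii; have [m] := ubnP #|[pred k | (k \notin U) && (f k == i)]|.
elim: m U f => // m IHm U f; rewrite ltnS => hm hU.
case: (pickP [pred k | (k \notin U) && (f k == i)]) => [a /andP[haU /eqP hfa]|hno].
  have hlt V f' : (forall k, (k \notin V) && (f' k == i) ->
      (k != a) && ((k \notin U) && (f k == i))) ->
      (#|[pred k | (k \notin V) && (f' k == i)]| < m)%N.
    move=> h; apply: leq_trans hm; apply/proper_card/properP; split.
      by apply/subsetP => k; rewrite !inE => /h /andP[].
    by exists a; rewrite !inE ?haU ?hfa ?eqxx //; apply/negP => /h; rewrite eqxx.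
  rewrite (@garnir_split _ _ _ _ a) //; last by rewrite neq_ltn hii.
  apply: zspanB; apply: IHm.
  - apply: hlt => k; rewrite in_setU1 negb_or -andbA => /and3P[-> -> ->] //.
  - by apply: leq_trans hU _; rewrite cardsU1 haU leq_addl.
  - apply: hlt => k; rewrite /recolour; case: (eqVneq k a) => //= _.
    by rewrite (gtn_eqF hii) andbF.
  - exact: hU.
(* [P] is the set of positions of row [i'] occupied by entries of [U]. Recolouring them by [i] turns
   each part of the sum into a single tabloid sum, which is empty for empty [P] because [U] is
   larger than row [i]. *)
pose FP (P : {set 'I_n}) := fun k => if k \in P then i else row_of lam k.
pose fU := fun k => if k \in U then i else f k.
pose Q := [set k : 'I_n | row_of lam k == i'].
have hne : (i' == i) = false by apply/negbTE; rewrite neq_ltn hii orbT.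
have hfne k : k \notin U -> (f k == i) = false.
  by move=> hk; have := hno k; rewrite /= hk.
have -> : garnir i i' U f = \sum_(P : {set 'I_n} | P \subset Q) tab int (FP P) fU.
  apply/ffunP=> g; rewrite galg_sumE ffunE big_mkcond /=.
  rewrite (eq_bigr (fun P : {set 'I_n} =>
     ((P \subset Q) && [forall k, FP P (g k) == fU k])%:R)); last first.
    by move=> P _; case: (_ \subset _); rewrite ?tabP.
  apply/esym; apply: (@big_unique _ _ _ _ [set k in Q | (g^-1)%g k \in U]) => P.
  apply/andP/andP => [[hPQ /forallP hP]|[/forallP hg /eqP ->]].
    split.
      apply/forallP => k; have := hP k; rewrite /FP /fU !inE; case: ifP => hkP.
        have := subsetP hPQ _ hkP; rewrite inE => /eqP ->; rewrite eqxx orbT.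
        by case: ifP => // /negbT/hfne hk; rewrite eq_sym hk.
      by case: ifP => // _ /eqP ->; rewrite eqxx.
    apply/eqP/setP => k; rewrite !inE; apply/idP/andP => [hk|[hkQ hkU]].
      have := subsetP hPQ _ hk; rewrite inE => ->; split=> //.
      have := hP (g^-1 k)%g; rewrite permKV /FP hk /fU; case: ifP => // /negbT/hfne h.
      by rewrite eq_sym h.
    have := hP (g^-1 k)%g; rewrite permKV /FP /fU hkU; case: ifP => // _.
    by rewrite (eqP hkQ) hne.
  split; first by apply/subsetP => k; rewrite !inE => /andP[].
  apply/forallP => k; have := hg k; rewrite /FP /fU !inE permK.
  case: (k \in U); last by rewrite andbF.
  by rewrite andbT => /orP[/eqP ->|->]; rewrite ?if_same ?eqxx.
apply: zspan_sum => P hPQ; case: (set_0Vmem P) => [P0|[k hk]].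
  rewrite (_ : tab _ _ _ = 0); first exact: zspan0.
  apply/ffunP => g; rewrite galg0; apply/eqP/negPn/negP => /tab_neq0 h.
  have h1 k : (row_of lam (g k) == i) = (k \in U).
    have := h k; rewrite /FP P0 inE /fU => ->; case: ifP => [_|/negbT/hfne //].
    by rewrite eqxx.
  suff e : #|U| = nth 0%N lam i by rewrite e ltnn in hU.
  rewrite -[RHS](addKn (rowstart lam i)) -rowstartS.
  rewrite -(card_interval (rowstart_mono lam (leqnSn i)) (rowstart_le lamP i.+1)).
  rewrite -(card_imset U (@perm_inj _ g)); apply: eq_card => k.
  rewrite -[X in X \in _](permKV g) mem_imset; last exact: perm_inj.
  rewrite -h1 permKV !inE leqNgt -(row_lt lamP i (ltn_ord k)).
  by rewrite -(row_lt lamP i.+1 (ltn_ord k)); lia.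
rewrite -[tab _ _ _]mulr1 -gp1; apply: above_hspan_IH; apply: above_lower.
  move=> j; rewrite /FP; case: ifP => // hj.
  by have := subsetP hPQ _ hj; rewrite inE => /eqP ->; apply: ltnW.
exists k; rewrite /FP hk; by have := subsetP hPQ _ hk; rewrite inE => /eqP ->.
Qed.
End Straightening.

(* A permutation maximizing [\sum_k k * d k] in its right coset has increasing rows. *)
Lemma row_increasing_rep n (F f : 'I_n -> nat) (g : 'S_n) : (forall k, F (g k) = f k) ->
  exists d : 'S_n, (forall k, f (d k) = F k) /\
    (forall a b : 'I_n, F a = F b -> (a < b)%N -> (d a < d b)%N).
Proof.
move=> hg.
have h0 : [forall k, f (g^-1%g k) == F k].
  by apply/forallP => k; rewrite -hg permKV.
case: (@arg_maxnP _ g^-1%g (fun d : 'S_n => [forall k, f (d k) == F k])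
  (fun d : 'S_n => \sum_(k < n) k * d k)%N h0) => d /forallP hd hmax.
exists d; split=> [k|a b hab ltab]; first exact/eqP.
rewrite ltnNge; apply/negP => hba.
have neab : a != b by rewrite neq_ltn ltab.
have {hba} hba : (d b < d a)%N.
  by rewrite ltn_neqAle hba andbT (inj_eq val_inj) (inj_eq perm_inj) eq_sym.
have /hmax h : [forall k, f ((tperm a b * d)%g k) == F k].
  apply/forallP => k; rewrite permM; case: tpermP => [->|->|_ _]; last exact: hd.
  - by rewrite hab.
  - by rewrite -hab.
suff: (\sum_(k < n) k * d k < \sum_(k < n) k * (tperm a b * d)%g k)%N.
  by rewrite ltnNge => /negP; apply; exact: h.
rewrite (bigD1 a) //= (bigD1 b) /=; last by rewrite eq_sym.
rewrite [X in (_ < X)%N](bigD1 a) //= [X in (_ < _ + X)%N](bigD1 b) /=; last by rewrite eq_sym.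
rewrite !permM tpermL tpermR !addnA.
rewrite (eq_bigr (fun k : 'I_n => k * (tperm a b * d)%g k)%N).
  rewrite ltn_add2r; move: ltab hba.
  move: (nat_of_ord a) (nat_of_ord b) (nat_of_ord (d a)) (nat_of_ord (d b)) => x y u v h1 h2.
  by rewrite -(subnKC (ltnW h1)) -(subnKC (ltnW h2)); nia.
by move=> k /andP[ha hb]; rewrite permM tpermD // eq_sym.
Qed.

Section Straightening.
Variables (n : nat) (lam : seq nat).
Hypothesis lamP : is_partition n lam.

Lemma row_of_le (k : 'I_n) : (row_of lam k <= n)%N.
Proof. by apply: ltnW; apply: row_ltn. Qed.

Definition std_tabloid (d : 'S_n) : 'I_n -> nat := fun k => row_of lam (d^-1%g k).

Definition std_or_higher (z : galg int n) : Prop :=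
  hspan lam z \/ exists2 d : 'S_n, standard lam d & z = tab int (rowc lam) (std_tabloid d).

Lemma same_row_col (a b : 'I_n) : row_of lam a = row_of lam b ->
  (col_of lam a < col_of lam b)%N = (a < b)%N.
Proof.
move=> h; rewrite -{2}(pos_row_col lamP (ltn_ord a)) -{2}(pos_row_col lamP (ltn_ord b)).
by rewrite h ltn_add2l.
Qed.

Lemma standardP (d : 'S_n) : reflect
  ((forall a b : 'I_n, row_of lam a = row_of lam b -> (a < b)%N -> (d a < d b)%N) /\
   (forall a b : 'I_n, col_of lam a = col_of lam b -> (row_of lam a < row_of lam b)%N ->
      (d a < d b)%N)) (standard lam d).
Proof.
apply: (iffP forallP) => [h|[h1 h2] a].
  split=> a b e hab; have /forallP/(_ b)/implyP := h a; apply; apply/orP.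
    by left; rewrite e eqxx same_row_col.
  by right; rewrite e eqxx.
apply/forallP => b; apply/implyP => /orP[]/andP[/eqP e hab]; last exact: h2.
by apply: h1 => //; rewrite -same_row_col.
Qed.

Hypothesis IH : forall mu, is_partition n mu -> higher lam mu ->
  forall f (s : 'S_n), gspan mu (tab int (rowc mu) f * gp int s).

Definition spread i i' (U V : {set 'I_n}) (f : 'I_n -> nat) : 'I_n -> nat :=
  fun k => if k \in U then (if k \in V then i else i') else f k.

(** A second expansion of the Garnir element, by the entries [V] of [U] that lie in row [i] instead
    of by positions; all its terms have shape [lam]. *)
Lemma garnir_sum (i i' : nat) (U : {set 'I_n}) f : i != i' ->
  garnir lam i i' U f =
  \sum_(V : {set 'I_n} | V \subset U) tab int (rowc lam) (spread i i' U V f).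
Proof.
move=> hii; apply/ffunP=> g; rewrite galg_sumE ffunE big_mkcond /=.
rewrite (eq_bigr (fun V : {set 'I_n} =>
     ((V \subset U) && [forall k, row_of lam (g k) == spread i i' U V f k])%:R)); last first.
  by move=> V _; case: (_ \subset _); rewrite ?tabP.
apply/esym; apply: (@big_unique _ _ _ _ [set k in U | row_of lam (g k) == i]) => V.
apply/andP/andP => [[hVU /forallP hV]|[/forallP hg /eqP ->]].
  split.
    apply/forallP => k; have := hV k; rewrite /spread; case: ifP => // _.
    by rewrite !inE; case: ifP => // _ ->; rewrite ?orbT.
  apply/eqP/setP => k; rewrite !inE; apply/idP/andP => [hk|[hkU hki]].
    have hkU := subsetP hVU _ hk.
    by have := hV k; rewrite /spread hkU hk.
  have := hV k; rewrite /spread hkU; case: ifP => // _.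
  by rewrite (eqP hki) (negbTE hii).
split; first by apply/subsetP => k; rewrite !inE => /andP[].
apply/forallP => k; have := hg k; rewrite /spread !inE; case: (k \in U) => //=.
by case: ifP => // _ /=.
Qed.

(** A column descent of the row-increasing representative yields a Garnir element in the higher
    span. It expresses the tabloid by others in which the first changed entry moves to an upper row,
    so the weight drops. *)
Lemma straighten f : zspan std_or_higher (tab int (rowc lam) f).
Proof.
have [m] := ubnP (weight f); elim: m f => // m IHm f; rewrite ltnS => hm.
case: (pickP [pred g : 'S_n | [forall k, row_of lam (g k) == f k]]) => [g /forallP hg|h0].
  2: { rewrite (_ : tab _ _ _ = 0); first exact: zspan0.
       by apply/ffunP => g; rewrite tabP galg0; have /= -> := h0 g. }
have hg' k : row_of lam (g k) = f k by apply/eqP.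
have [d [hdf hdr]] := @row_increasing_rep n (rowc lam) f g hg'.
have fE : f =1 std_tabloid d by move=> k; rewrite /std_tabloid -hdf permKV.
case: (boolP (standard lam d)) => hstd.
  by apply: zspan_gen; right; exists d => //; apply: eq_tab.
have [a [b [hcol hrow hba]]] : exists a b : 'I_n, [/\ col_of lam a = col_of lam b,
    (row_of lam a < row_of lam b)%N & (d b < d a)%N].
  case/forallPn: hstd => a /forallPn[b]; rewrite negb_imply => /andP[/orP[]/andP[/eqP e hab]].
    by rewrite hdr // -same_row_col.
  rewrite -leqNgt leq_eqVlt (inj_eq val_inj) (inj_eq perm_inj) => /orP[/eqP e'|hba].
    by rewrite e' ltnn in hab.
  by exists a, b.
set i := row_of lam a; set i' := row_of lam b.
have hii : (i == i') = false by rewrite ltn_eqF.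
(* [A] runs from [a] to the end of its row, [B] from the start of the lower row to [b]. As [a] and
   [b] share a column, together they have one position more than row [i]; the descent puts every
   entry in [B] below every entry in [A]. *)
pose A := [pred p : 'I_n | a <= p < rowstart lam i.+1]%N.
pose B := [pred p : 'I_n | rowstart lam i' <= p < b.+1]%N.
have rA p : A p -> row_of lam p = i.
  move=> /andP[h1 h2]; apply/eqP; rewrite eqn_leq (row_mono lamP h1) // andbT.
  by rewrite -ltnS (row_lt lamP).
have rB p : B p -> row_of lam p = i'.
  move=> /andP[h1 h2]; apply/eqP; rewrite eqn_leq (row_mono lamP) //= leqNgt (row_lt lamP) //.
  by rewrite -leqNgt.
pose U := [set k | A (d^-1 k)%g || B (d^-1 k)%g].
have hU : (nth 0%N lam i < #|U|)%N.
  have -> : #|U| = #|[predU A & B]|.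
    rewrite -(card_imset [predU A & B] (@perm_inj _ d)); apply: eq_card => k.
    by rewrite -[X in _ = (X \in _)](permKV d) mem_imset ?inE //; apply: perm_inj.
  have hAB : #|[predI A & B]| = 0%N.
    apply: eq_card0 => p; rewrite !inE; apply/negbTE/negP => /andP[/rA e1 /rB e2].
    by rewrite -e1 -e2 eqxx in hii.
  have := cardUI A B; rewrite hAB addn0 => ->.
  have /andP[ha1 ha2] := row_bounds lamP (ltn_ord a).
  have /andP[hb1 hb2] := row_bounds lamP (ltn_ord b).
  rewrite /A /B !card_interval //; try exact: rowstart_le; try exact: ltnW.
  have := hcol; rewrite /col_of -/i -/i' rowstartS; rewrite -/i -/i' in ha1 hb1 *; lia.
have hBA p q : B p -> A q -> (d p < d q)%N.
  move=> hp hq; have hp' : (d p <= d b)%N.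
    case/andP: (hp) => _; rewrite ltnS leq_eqVlt => /orP[/eqP/val_inj -> //|h].
    by apply/ltnW/hdr => //; rewrite (rB p hp).
  have hq' : (d a <= d q)%N.
    case/andP: (hq) => + _; rewrite leq_eqVlt => /orP[/eqP/val_inj -> //|h].
    by apply/ltnW/hdr => //; rewrite (rA q hq).
  exact: leq_ltn_trans hp' (leq_trans hba hq').
have fA k : A (d^-1 k)%g -> f k = i by move=> /rA; rewrite -hdf permKV.
have fB k : B (d^-1 k)%g -> f k = i' by move=> /rB; rewrite -hdf permKV.
pose V0 := [set k | A (d^-1 k)%g].
have hV0 : V0 \subset U by apply/subsetP => k; rewrite !inE => ->.
have fV0 : spread i i' U V0 f =1 f.
  move=> k; rewrite /spread !inE; case: ifP => // /orP[hA|hB].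
    by rewrite hA fA.
  case: ifP => [hA|_]; last by rewrite fB.
  by rewrite -(fA _ hA).
have := garnir_sum U f (negbT hii); rewrite (bigD1 V0) //= => eg.
have -> : tab int (rowc lam) f = garnir lam i i' U f -
   \sum_(V : {set 'I_n} | (V \subset U) && (V != V0)) tab int (rowc lam) (spread i i' U V f).
  by rewrite eg addrK; apply: eq_tab.
apply: zspanB; first by apply: zspan_gen; left; apply: (garnir_span lamP IH).
apply: zspan_sum => V /andP[hVU hVne]; set f' := spread i i' U V f.
case: (pickP [pred g : 'S_n | [forall k, row_of lam (g k) == f' k]]) => [g2 /forallP hg2|h0].
  2: { rewrite (_ : tab _ _ _ = 0); first exact: zspan0.
       by apply/ffunP => g2; rewrite tabP galg0; have /= -> := h0 g2. }
apply: IHm; apply: leq_trans hm.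
have hg2' k : row_of lam (g2 k) = f' k by apply/eqP.
(* Both colourings are realised by tableaux of shape [lam], so their colour classes have the same
   sizes. *)
have cnt : #|[pred k | f' k == i']| = #|[pred k | f k == i']|.
  apply/eqP; rewrite -(eqn_add2l (cumul f' i')) -cumulS.
  have e c : cumul f' c = cumul f c.
    have e1 := eq_cumul c hg2'; have e2 := eq_cumul c hg'.
    by rewrite -e1 -e2 !(cumul_perm (rowc lam)).
  by rewrite (e i') -cumulS e.
have [k0 hk0] : exists k, f' k != f k.
  apply/existsP; apply: contraR hVne => /existsPn h; apply/eqP/setP => k; rewrite inE.
  have := h k; rewrite negbK /f' /spread; case: ifP => [hkU|hkU].
    move: hkU; rewrite inE => /orP[hA|hB].
      by rewrite hA fA //; case: ifP => //; rewrite eq_sym hii.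
    rewrite fB //; case: ifP; rewrite ?hii // => _ _; apply/esym/negbTE/negP => hA.
    by rewrite -(fA _ hA) (fB _ hB) eqxx in hii.
  move=> _; move/negbT: hkU (hkU) => hkU; rewrite inE => /norP[/negbTE -> _].
  by apply/negbTE; apply: contra hkU; apply: (subsetP hVU).
have [k [hk hlt]] := first_difference hk0.
have hkU : k \in U.
  by move: hk; rewrite /f' /spread; case: ifP => //; rewrite eqxx.
apply: (weight_lt _ hlt); first by move=> j; rewrite -hg2' row_of_le.
move: (hkU); rewrite inE => /orP[hA|hB]; last first.
  by move: hk; rewrite /f' /spread hkU fB //; case: ifP; rewrite ?eqxx.
(* If the first changed entry lay in [A], the smaller entries of [B] would all keep colour [i'] and
   [k] would be a new entry of that colour. *)
suff: (#|[pred k | f k == i']| < #|[pred k | f' k == i']|)%N by rewrite cnt ltnn.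
apply/proper_card/properP; split.
  apply/subsetP => j; rewrite !inE => /eqP hj; case hjU: (j \in U); last first.
    by rewrite /f' /spread hjU hj.
  move: hjU; rewrite inE => /orP[/fA e|hjB]; first by rewrite -e hj eqxx in hii.
  by rewrite hlt ?hj //; have := hBA _ _ hjB hA; rewrite !permKV.
exists k; rewrite !inE; last by rewrite fA // hii.
by move: hk; rewrite /f' /spread hkU fA //; case: ifP; rewrite eqxx.
Qed.

End Straightening.

(** * Murphy's spanning theorem *)

Lemma hspan_star n lam (z : galg int n) : hspan lam z -> hspan lam (star z).
Proof.
apply: (zspan_map (@star_zmod _ n)) => _ [mu [s [t [hmu hh hs ht ->]]]].
apply: zspan_gen; exists mu, t, s; split=> //.
by rewrite !murphyE !starM !star_gp star_tab invgK mulrA.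
Qed.

Lemma higher_lt n lam mu : is_partition n lam -> is_partition n mu -> higher lam mu ->
  exists2 c, (c <= n)%N & (rowstart lam c < rowstart mu c)%N.
Proof.
move=> hl hm [hd hne].
have [c hc] : exists c : 'I_n.+1, (rowstart lam c < rowstart mu c)%N.
  apply/existsP; apply: contra_notT hne => /existsPn h; apply: (part_eq hm hl) => c.
  case: (ltnP c n.+1) => hc.
    apply/eqP; rewrite eqn_leq (hd c) andbT leqNgt; exact: h (Ordinal hc).
  by rewrite !(@rowstart_big n) //; apply: leq_trans (ltnW hc); apply: size_part.
by exists c => //; rewrite -ltnS.
Qed.

(** A bounded integer measure of dominance, on which the descending induction of [murphy_span]
    runs. *)
Lemma dominates_sum_lt n lam mu : is_partition n lam -> is_partition n mu -> higher lam mu ->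
  (\sum_(c < n.+1) rowstart lam c < \sum_(c < n.+1) rowstart mu c)%N.
Proof.
move=> hl hm hh; have [c0 hc0 hc] := higher_lt hl hm hh; have [hd _] := hh.
pose c := Ordinal (hc0 : (c0 < n.+1)%N).
rewrite (bigD1 c) //= [X in (_ < X)%N](bigD1 c) //= -addSn leq_add //.
by apply: leq_sum => i _; apply: hd.
Qed.

Lemma tab_std_tabloid (K : comNzRingType) n lam (d : 'S_n) :
  tab K (rowc lam) (std_tabloid lam d) = gp K d^-1%g * tab K (rowc lam) (rowc lam).
Proof. by rewrite gp_tab. Qed.

(** Straightening is used twice: on the left it produces $d^{-1}x$ with [d] standard, and after
    [star] it treats the remaining right factor $xs$. *)
Theorem murphy_span n lam : is_partition n lam ->
  forall f (s : 'S_n), gspan lam (tab int (rowc lam) f * gp int s).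
Proof.
have [m] := ubnP (n.+1 * n - \sum_(c < n.+1) rowstart lam c)%N.
elim: m lam => // m IHm lam; rewrite ltnS => hm hl.
have IH mu : is_partition n mu -> higher lam mu ->
    forall f (s : 'S_n), gspan mu (tab int (rowc mu) f * gp int s).
  move=> hmu hh; apply: IHm => //; apply: leq_trans hm.
  have lt := dominates_sum_lt hl hmu hh.
  apply: ltn_sub2l => //; apply: leq_trans lt _.
  rewrite -[X in (X * _)%N]card_ord -sum_nat_const leq_sum // => c _; exact: rowstart_le.
move=> f s; move: (straighten hl IH f).
apply: (zspan_map (u := *%R^~ (gp int s)) (fun x y => mulrBl (gp int s) x y)).
move=> z [hz|[d hd ->{z}]]; first by apply/hspan_gspan/(hspan_mulr_IH hl IH).
have -> : tab int (rowc lam) (std_tabloid lam d) * gp int s =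
    gp int d^-1%g * star (tab int (rowc lam) (fun k => row_of lam (s^-1%g k))).
  by rewrite star_tab tab_std_tabloid -mulrA tab_gp.
move: (straighten hl IH (fun k => row_of lam (s^-1%g k))).
apply: (zspan_map (u := fun z => gp int d^-1%g * star z)).
  by move=> x y; rewrite star_zmod mulrBr.
move=> z [hz|[d' hd' ->{z}]].
  by apply/hspan_gspan/(hspan_mull_IH hl IH)/hspan_star.
apply: zspan_gen; exists lam, d, d'; split=> //.
by rewrite tab_std_tabloid starM star_gp invgK star_tab mulrA murphyE.
Qed.

Section Ideal.
Variables (n : nat) (lam : seq nat).
Hypothesis lamP : is_partition n lam.

Let IH mu (hmu : is_partition n mu) (_ : higher lam mu) := murphy_span hmu.

Lemma above_hspan F f : above lam F -> hspan lam (tab int F f : galg int n).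
Proof. by move=> h; rewrite -[tab _ _ _]mulr1 -gp1; apply: (above_hspan_IH lamP IH). Qed.

Lemma hspan_mull h z : hspan lam z -> hspan lam (h * z : galg int n).
Proof.
move=> hz; rewrite (galg_basis h) mulr_suml; apply: zspan_sum => s _.
by rewrite -scalerAl; apply: zspan_int; apply: (hspan_mull_IH lamP IH).
Qed.

Lemma hspan_mulr h z : hspan lam z -> hspan lam (z * h : galg int n).
Proof.
by move=> hz; rewrite -[_ * _]starK; apply/hspan_star; rewrite starM; apply/hspan_mull/hspan_star.
Qed.

Lemma straightening f : zspan (std_or_higher (n := n) lam) (tab int (rowc lam) f).
Proof. exact: straighten. Qed.
End Ideal.

(** * Transfer of the integral relations to other coefficients *)

Section Coefficients.
Variables (K : comNzRingType) (inS : K -> Prop) (n : nat) (lam : seq nat).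
Hypotheses (inS_int : forall m : int, inS m%:~R)
           (inSM : forall a b, inS a -> inS b -> inS (a * b)).
Implicit Types z : galg K n.

Lemma span_higher0 : span_higher inS lam (0 : galg K n).
Proof. by exists [::]; rewrite big_nil. Qed.

Lemma span_higherD z1 z2 : span_higher inS lam z1 -> span_higher inS lam z2 ->
  span_higher inS lam (z1 + z2).
Proof.
move=> [l1 [h1 ->]] [l2 [h2 ->]]; exists (l1 ++ l2); rewrite big_cat; split=> // e.
by rewrite mem_cat => /orP[/h1|/h2].
Qed.

Lemma span_higherZ a z : inS a -> span_higher inS lam z -> span_higher inS lam (a *: z).
Proof.
move=> ha [l [h ->]]; exists [seq (e.1, a * e.2) | e <- l]; split.
  by move=> _ /mapP[e /h [h1 h2 h3 h4 h5] ->]; split=> //; apply: inSM.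
rewrite big_map; apply/ffunP => s; rewrite galgZ !(galg_sumE (K := K)) big_distrr /=.
by apply: eq_bigr => e _; rewrite !ffunE mulrA.
Qed.

Lemma span_higherN z : span_higher inS lam z -> span_higher inS lam (- z).
Proof.
by move=> h; rewrite -scaleN1r; apply: span_higherZ h; have := inS_int (-1); rewrite rmorphN1.
Qed.

Lemma span_higher_sum I (r : seq I) (P : pred I) (F : I -> galg K n) :
  (forall i, P i -> span_higher inS lam (F i)) ->
  span_higher inS lam (\sum_(i <- r | P i) F i : galg K n).
Proof.
by move=> h; elim/big_rec: _ => [|i x hi]; [apply: span_higher0 | apply: span_higherD; apply: h].
Qed.

Lemma gmap_murphy mu (s t : 'S_n) : gmap K (murphy int mu s t) = murphy K mu s t.
Proof. by rewrite !murphyE !rmorphM /= !gmap_gp gmap_tab. Qed.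

Lemma hspan_span_higher (z : galg int n) : hspan lam z -> span_higher inS lam (gmap K z).
Proof.
elim=> {z} [_ [mu [s [t [hmu [hd hne] hs ht ->]]]]||x y _ hx _ hy].
- exists [:: (mu, s, t, 1)]; rewrite big_seq1; split.
    move=> e; rewrite inE => /eqP -> /=; split=> //; last by rewrite hs ht.
    by have := inS_int 1; rewrite rmorph1.
  by rewrite gmap_murphy; apply/ffunP => g; rewrite [RHS]ffunE mul1r.
- by rewrite rmorph0; apply: span_higher0.
- by rewrite rmorphB; apply: span_higherD => //; apply: span_higherN.
Qed.

Lemma span_higher_gens z : span_higher inS lam z ->
  exists l : seq (K * galg int n), (forall e, e \in l -> inS e.1 /\ hspan lam e.2) /\
    z = \sum_(e <- l) e.1 *: gmap K e.2.
Proof.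
move=> [l [h ->]]; exists [seq (e.2, murphy int e.1.1.1 e.1.1.2 e.1.2 : galg int n) | e <- l].
split; last first.
  rewrite big_map; apply: eq_bigr => e _ /=; by rewrite gmap_murphy.
move=> _ /mapP[e /h [h1 h2 h3 h4 /andP[h5 h6]] ->]; split=> //=.
by apply: zspan_gen; exists e.1.1.1, e.1.1.2, e.1.2.
Qed.

Hypothesis lamP : is_partition n lam.

Lemma span_higher_mull (h : galg K n) z : (forall s, inS (h s)) -> span_higher inS lam z ->
  span_higher inS lam (h * z).
Proof.
move=> hh /span_higher_gens[l [hl ->]]; rewrite (galg_basis h) mulr_suml.
apply: span_higher_sum => s _; rewrite -scalerAl; apply: span_higherZ => //.
rewrite mulr_sumr big_seq; apply: span_higher_sum => e /hl [h1 h2].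
rewrite -scalerAr; apply: span_higherZ => //; rewrite -gmap_gp -rmorphM.
by apply: hspan_span_higher; apply: hspan_mull.
Qed.

Lemma span_higher_mulr (h : galg K n) z : (forall s, inS (h s)) -> span_higher inS lam z ->
  span_higher inS lam (z * h).
Proof.
move=> hh /span_higher_gens[l [hl ->]]; rewrite (galg_basis h) mulr_sumr.
apply: span_higher_sum => s _; rewrite -scalerAr; apply: span_higherZ => //.
rewrite mulr_suml big_seq; apply: span_higher_sum => e /hl [h1 h2].
rewrite -scalerAl; apply: span_higherZ => //; rewrite -gmap_gp -rmorphM.
by apply: hspan_span_higher; apply: hspan_mulr.
Qed.

Lemma span_higher_star z : span_higher inS lam z -> span_higher inS lam (star z).
Proof.
move=> /span_higher_gens[l [hl ->]]; rewrite raddf_sum /= big_seq.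
apply: span_higher_sum => e /hl [h1 h2]; rewrite starZ; apply: span_higherZ => //.
by rewrite -gmap_star; apply: hspan_span_higher; apply: hspan_star.
Qed.
End Coefficients.

(** * Column antisymmetrizers and polytabloids *)

Definition colstab (lam : seq nat) n (c : 'S_n) : bool :=
  [forall k, col_of lam (c k) == col_of lam k].

Definition kappa (K : nzRingType) n (lam : seq nat) : galg K n :=
  [ffun c : 'S_n => if colstab lam c then (-1) ^+ odd_perm c else 0].
Arguments kappa K {n} lam.

Notation xrow K lam := (tab K (rowc lam) (rowc lam)).

Section Kappa.
Variables (K : comNzRingType) (n : nat) (lam : seq nat).

Lemma kappaE (c : 'S_n) : kappa K lam c = (if colstab lam c then (-1) ^+ odd_perm c else 0) :> K.
Proof. by rewrite ffunE. Qed.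

Lemma colstabV (c : 'S_n) : colstab lam c^-1%g = colstab lam c.
Proof.
by apply/forallP/forallP => h k; [have := h (c k) | have := h (c^-1 k)%g];
  rewrite ?permK ?permKV eq_sym.
Qed.

Lemma star_kappa : star (kappa K lam) = kappa K lam :> galg K n.
Proof. by apply/ffunP => c; rewrite starE !kappaE colstabV odd_permV. Qed.

Lemma kappa_tperm (a b : 'I_n) : a != b -> col_of lam a = col_of lam b ->
  kappa K lam * gp K (tperm a b) = - kappa K lam.
Proof.
move=> neab hab; apply/ffunP => c; rewrite gpMR galgN !kappaE tpermV.
have ht k : col_of lam (tperm a b k) = col_of lam k.
  by case: tpermP => [->|->|].
have -> : colstab lam (c * tperm a b)%g = colstab lam c.
  by apply: eq_forallb => k; rewrite permM ht.
rewrite odd_permM odd_tperm neab; case: (colstab _ _); last by rewrite oppr0.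
by case: (odd_perm c); rewrite /= ?expr1 ?expr0 ?opprK.
Qed.
End Kappa.

Lemma gmap_kappa (K : comNzRingType) n lam : gmap K (kappa int lam) = kappa K lam :> galg K n.
Proof.
apply/ffunP => c; rewrite gmapE !kappaE; case: ifP => _; last by rewrite rmorph0.
by rewrite rmorphXn rmorphN1.
Qed.

(** The transposition gives $z=-z$, which forces $z=0$ only in the absence of 2-torsion. The
    vanishing is therefore proved over the integers and then mapped to [K], which covers
    characteristic 2. *)
Lemma kappa_tab_int n lam (F f : 'I_n -> nat) (a b : 'I_n) : a != b ->
  col_of lam a = col_of lam b -> f a = f b -> kappa int lam * tab int F f = 0.
Proof.
move=> neab hab hf.
have e : kappa int lam * tab int F f = - (kappa int lam * tab int F f).
  rewrite -mulNr -(kappa_tperm int neab hab) -mulrA gp_tab; congr (_ * _).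
  by apply: eq_tab => // k; case: tpermP => [->|->|].
apply/ffunP => g; rewrite galg0; have /= := congr1 (fun z : galg int n => z g) e.
by rewrite galgN; move: ((kappa int lam * tab int F f) g) => v; lia.
Qed.

Lemma kappa_tab (K : comNzRingType) n lam (F f : 'I_n -> nat) (a b : 'I_n) : a != b ->
  col_of lam a = col_of lam b -> f a = f b -> kappa K lam * tab K F f = 0.
Proof.
move=> neab hab hf; rewrite -gmap_kappa -gmap_tab -rmorphM.
by rewrite (@kappa_tab_int n lam F f a b) ?rmorph0.
Qed.

Section Pigeonhole.
Variables (n : nat) (lam : seq nat).
Hypothesis lamP : is_partition n lam.

(** If column [j] reaches row [c], its first [c] rows give [c] positions, and distinct colours below
    [c] number at most [c]; a shorter column lies entirely in these rows. *)
Lemma column_count (f : 'I_n -> nat) (c j : nat) :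
  (forall a b : 'I_n, col_of lam a = col_of lam b -> f a = f b -> a = b) ->
  (#|[pred k : 'I_n | (f k < c) && (col_of lam k == j)]| <=
   #|[pred k : 'I_n | (row_of lam k < c) && (col_of lam k == j)]|)%N.
Proof.
move=> hinj; case: (pickP [pred k : 'I_n | (c <= row_of lam k)%N && (col_of lam k == j)]).
  move=> k0 /andP[hc /eqP hj]; apply: (@leq_trans c).
    set A := [pred k | _]; rewrite cardE -(size_map f) -[X in (_ <= X)%N](size_iota 0).
    apply: uniq_leq_size; last first.
      by move=> _ /mapP[k + ->]; rewrite mem_enum inE mem_iota => /andP[].
    rewrite map_inj_in_uniq ?enum_uniq // => a b; rewrite !mem_enum !inE.
    by move=> /andP[_ /eqP ha] /andP[_ /eqP hb]; apply: hinj; rewrite ha hb.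
  have hp (i : 'I_c) : (j < nth 0%N lam i)%N.
    rewrite -hj; apply: leq_trans (col_lt lamP (ltn_ord k0)) _.
    by apply: (part_noninc lamP); apply: leq_trans hc; apply: ltnW.
  pose p (i : 'I_c) := Ordinal (pos_lt lamP (hp i)).
  have pinj : injective p.
    move=> i i' /(congr1 (fun q : 'I_n => row_of lam q)) /=.
    by rewrite !(row_pos (hp _)); apply: val_inj.
  rewrite -[X in (X <= _)%N]card_ord -(card_codom pinj).
  apply/subset_leq_card/subsetP => _ /codomP[i ->].
  by rewrite !inE /= (row_pos (hp i)) (col_pos (hp i)) eqxx ltn_ord.
move=> h0; apply/subset_leq_card/subsetP => k; rewrite !inE => /andP[_ hk].
by have := h0 k; rewrite /= hk !andbT leqNgt => /negbFE.
Qed.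

Lemma cumul_columns (f : 'I_n -> nat) c : cumul f c =
  (\sum_(j < n) #|[pred k : 'I_n | (f k < c) && (col_of lam k == j)]|)%N.
Proof.
rewrite /cumul -sum1_card.
rewrite (partition_big (fun k : 'I_n => Ordinal (col_ltn lam (ltn_ord k))) predT) //=.
by apply: eq_bigr => j _; rewrite sum1_card; apply: eq_card => k; rewrite !inE.
Qed.

Lemma column_collision mu (f : 'I_n -> nat) : is_partition n mu -> higher lam mu ->
  (forall c, cumul f c = rowstart mu c) ->
  exists a b : 'I_n, [/\ a != b, col_of lam a = col_of lam b & f a = f b].
Proof.
move=> hmu [hd hne] hf.
case: (boolP [exists a : 'I_n, exists b : 'I_n,
    [&& a != b, col_of lam a == col_of lam b & f a == f b]]).
  by move=> /existsP[a /existsP[b /and3P[h1 /eqP h2 /eqP h3]]]; exists a, b.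
move=> hno; case: hne; apply: (part_eq hmu lamP) => c.
apply/eqP; rewrite eqn_leq hd andbT -hf -(card_row_lt lamP c).
rewrite -/(cumul (rowc lam) c) !cumul_columns.
apply: leq_sum => j _; apply: column_count => a b hab hfab.
apply/eqP/negPn/negP => hne; case/negP: hno; apply/existsP; exists a.
by apply/existsP; exists b; rewrite hne hab hfab !eqxx.
Qed.

Lemma kappa_hspan (z : galg int n) : hspan lam z -> kappa int lam * z = 0.
Proof.
elim=> {z} [_ [mu [s [t [hmu hh hs ht ->]]]]||x y _ hx _ hy].
- rewrite murphyE gp_tab mulrA.
  have [a [b [h1 h2 h3]]] : exists a b : 'I_n, [/\ a != b, col_of lam a = col_of lam b &
      row_of mu (s^-1%g a) = row_of mu (s^-1%g b)].
    apply: (column_collision (f := fun k => row_of mu (s^-1%g k)) hmu hh) => c.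
    by rewrite (cumul_perm (rowc mu)) -(card_row_lt hmu).
  by rewrite (kappa_tab _ _ h1 h2) ?mul0r.
- by rewrite mulr0.
- by rewrite mulrBr hx hy subr0.
Qed.

Variables (K : comNzRingType).

Lemma kappa_span_higher inS (z : galg K n) : span_higher inS lam z -> kappa K lam * z = 0.
Proof.
move=> /span_higher_gens[l [hl ->]]; rewrite mulr_sumr big_seq big1 // => e /hl [_ h].
by rewrite -scalerAr -gmap_kappa -rmorphM kappa_hspan // rmorph0 scaler0.
Qed.

Lemma span_higher_kappa inS (z : galg K n) : span_higher inS lam z -> z * kappa K lam = 0.
Proof.
move=> /span_higher_gens[l [hl ->]]; rewrite mulr_suml big_seq big1 // => e /hl [_ h].
rewrite -scalerAl -gmap_kappa -rmorphM (_ : e.2 * _ = star (kappa int lam * star e.2)).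
  by rewrite kappa_hspan ?raddf0 ?scaler0 //; apply: hspan_star.
by rewrite starM starK star_kappa.
Qed.

(* In [t^lam d] the first entry not in its place of [t^lam] stands below an entry of its row. *)
Lemma standard_collision (d : 'S_n) : standard lam d -> d != 1%g ->
  exists a b : 'I_n, [/\ a != b, col_of lam a = col_of lam b & row_of lam (d a) = row_of lam (d b)].
Proof.
move=> /(standardP lamP)[hr hc] hd1.
have [k0 hk0] : exists k, val (d k) != val k.
  apply/existsP; apply: contraR hd1 => /existsPn h; apply/eqP/permP => k.
  by rewrite perm1; apply: val_inj; apply/eqP/negPn/h.
have [k [hk hlt]] := first_difference (f := fun k => val (d k)) (g := val) hk0.
have fix_lt (j : 'I_n) : (j < k)%N -> d j = j by move=> /hlt /val_inj.
have fixd (q : 'I_n) : (d q < k)%N -> q = d q.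
  by move=> h; apply: (@perm_inj _ d); rewrite (fix_lt (d q) h).
set p := (d^-1 k)%g; have dp : d p = k by rewrite permKV.
have neq : p != k.
  by apply/eqP => e; case/eqP: hk; rewrite -[X in d X]e dp.
have ltkp : (k < p)%N.
  rewrite ltn_neqAle eq_sym (inj_eq val_inj) neq leqNgt; apply/negP => h.
  by move: (fix_lt _ h); rewrite dp => e; rewrite e eqxx in neq.
have := row_mono lamP (ltnW ltkp) (ltn_ord p); rewrite leq_eqVlt => /orP[/eqP e|hrow].
  have := hr _ _ e ltkp; rewrite dp => h; have e2 := fixd _ h.
  by rewrite -e2 ltnn in h.
have hq : (col_of lam p < nth 0%N lam (row_of lam k))%N.
  by apply: leq_trans (col_lt lamP (ltn_ord p)) (part_noninc lamP (ltnW hrow)).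
(* [q] stands in the row of [k] and above [p] in its column, so its entry is smaller than [k] and
   hence still in its own place. *)
pose q := Ordinal (pos_lt lamP hq).
have rq : row_of lam q = row_of lam k by rewrite /= (row_pos hq).
have cq : col_of lam q = col_of lam p by rewrite /= (col_pos hq).
have := hc q p cq; rewrite rq dp => /(_ hrow) hqk.
exists q, p; split=> //; first by apply: contraTneq hrow => <-; rewrite rq ltnn.
by rewrite -(fixd _ hqk) rq dp.
Qed.

Lemma kappa_standard (d : 'S_n) : standard lam d -> d != 1%g ->
  kappa K lam * (gp K d * xrow K lam) = 0.
Proof.
move=> hd hd1; have [a [b [h1 h2 h3]]] := standard_collision hd hd1.
by rewrite gp_tab; apply: kappa_tab h1 h2 h3.
Qed.

Lemma row_col_perm_id (c : 'S_n) : colstab lam c -> (forall k, row_of lam (c k) = row_of lam k) ->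
  c = 1%g.
Proof.
move=> /forallP hc hr; apply/permP => k; rewrite perm1; apply: val_inj.
exact: (row_col_inj lamP (ltn_ord _) (ltn_ord _) (hr k) (eqP (hc k))).
Qed.

Lemma kappa_xE (h : 'S_n) : (kappa K lam * xrow K lam) h =
  \sum_(c : 'S_n) kappa K lam c * [forall k, row_of lam (h k) == row_of lam (c k)]%:R.
Proof.
rewrite ffunE; apply: eq_bigr => c _; rewrite tabP; congr (_ * (nat_of_bool _)%:R).
apply/forallP/forallP => H k; first by have := H (c k); rewrite permM permK.
by have := H (c^-1 k)%g; rewrite permKV permM.
Qed.

Lemma kappa_x_row (h : 'S_n) : (forall k, row_of lam (h k) = row_of lam k) ->
  (kappa K lam * xrow K lam) h = 1.
Proof.
move=> hh; rewrite kappa_xE (bigD1 1%g) //= big1 => [|c hc1].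
  rewrite addr0 kappaE odd_perm1 (_ : colstab lam 1%g).
    by rewrite mul1r; case: forallP => // -[] k; rewrite perm1 hh.
  by apply/forallP => k; rewrite perm1.
rewrite kappaE; case: ifP => hc; rewrite ?mul0r //.
case: forallP => [H|]; rewrite ?mulr0 //; case/negP: hc1; apply/eqP.
by apply: row_col_perm_id hc _ => k; rewrite -(eqP (H k)).
Qed.

(** A nonzero coefficient means that [g] arises from the tabloid of [d] by a column permutation [c].
    The first entry that [c] displaces cannot go up, since by standardness a smaller entry stands
    there and stays fixed; so it goes down and the weight grows. *)
Lemma kappa_x_triangular (d g : 'S_n) : standard lam d ->
  (kappa K lam * xrow K lam) (d * g)%g != 0 ->
  (forall k, row_of lam (g k) = std_tabloid lam d k) \/
  (weight (std_tabloid lam d) < weight (fun k => row_of lam (g k)))%N.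
Proof.
move=> /(standardP lamP)[hr hc]; rewrite kappa_xE => hne.
have [c [hcs hcr]] : exists c : 'S_n, colstab lam c /\ forall k, row_of lam (g (d k)) = row_of lam (c k).
  case: (pickP [pred c : 'S_n | colstab lam c &&
      [forall k, row_of lam ((d * g)%g k) == row_of lam (c k)]]) => [c /andP[h1 /forallP h2]|h0].
    by exists c; split=> // k; have := h2 k; rewrite permM => /eqP.
  case/eqP: hne; apply: big1 => c _; rewrite kappaE.
  by have /= := h0 c; case: ifP => _ /=; rewrite ?mul0r // => ->; rewrite mulr0.
case: (boolP [forall k, c (d^-1%g k) == d^-1%g k]) => [/forallP h|/forallPn[k1 hk1]].
  by left=> k; rewrite /std_tabloid -[in LHS](permKV d k) hcr (eqP (h k)).
right; have hk1' : (c (d^-1%g k1) : nat) != d^-1%g k1 by [].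
have [k [hk hlt]] := first_difference (f := fun k => c (d^-1%g k)) (g := fun k => d^-1%g k) hk1'.
have gE j : row_of lam (g j) = row_of lam (c (d^-1%g j)) by rewrite -hcr permKV.
apply: (weight_lt (k := k)) => [j|j /hlt /val_inj e|]; first exact: row_of_le.
  by rewrite gE e.
rewrite gE /std_tabloid; set u := (d^-1 k)%g; rewrite -/u in hk.
have hcu : col_of lam (c u) = col_of lam u by apply/eqP; apply: (forallP hcs).
rewrite ltn_neqAle; apply/andP; split.
  apply: contraNneq hk => e; apply/eqP.
  exact: (row_col_inj lamP (ltn_ord _) (ltn_ord _) (esym e) hcu).
rewrite leqNgt; apply/negP => h; have := hc _ _ hcu h; rewrite permKV => hlt2.
have := hlt _ hlt2; rewrite permK => /val_inj/perm_inj e.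
by rewrite e eqxx in hk.
Qed.

Lemma std_tabloid_inj (s s' : 'S_n) : standard lam s -> standard lam s' ->
  std_tabloid lam s =1 std_tabloid lam s' -> s = s'.
Proof.
move=> /(standardP lamP)[hs _] /(standardP lamP)[hs' _] e.
pose r := (s * s'^-1)%g.
have hsr k : s k = s' (r k) by rewrite permM permKV.
have rrow k : row_of lam (r k) = row_of lam k.
  by have := e (s k); rewrite /std_tabloid permK -permM.
have rinc (a b : 'I_n) : row_of lam a = row_of lam b -> (a < b)%N -> (r a < r b)%N.
  move=> hab ltab; have := hs _ _ hab ltab; rewrite !hsr => h.
  rewrite ltnNge leq_eqVlt; apply/negP => /orP[/eqP/val_inj e2|h2].
    by rewrite e2 ltnn in h.
  have := hs' (r b) (r a); rewrite !rrow => /(_ (esym hab) h2) h3.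
  by have := ltn_trans h h3; rewrite ltnn.
suff r1 : r = 1%g by apply/permP => k; rewrite hsr r1 perm1.
apply/permP => k1; rewrite perm1; apply: val_inj; apply/eqP/negPn/negP => hk1.
have [k [hk hlt]] := first_difference (f := fun k => r k) (g := val) hk1.
have fixr (q : 'I_n) : (r q < k)%N -> q = r q.
  by move=> h; apply: (@perm_inj _ r); apply/esym/val_inj/hlt.
pose q := (r^-1 k)%g; have rq : r q = k by rewrite permKV.
have ltk : (k < r k)%N.
  rewrite ltn_neqAle eq_sym hk leqNgt; apply/negP => h.
  by move: (h); rewrite -(fixr _ h) ltnn.
have ltq : (k < q)%N.
  rewrite ltnNge leq_eqVlt; apply/negP => /orP[/eqP/val_inj eq|h].
    by move: ltk; rewrite -{2}eq rq ltnn.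
  have := hlt _ h; rewrite rq => /val_inj eq; by rewrite -eq ltnn in h.
have := rinc k q; rewrite rq => h; have := h _ ltq; rewrite ltnNge (ltnW ltk).
by move=> h'; suff: false by []; apply: h'; rewrite -{1}rq rrow.
Qed.
End Pigeonhole.

(** * The form and the dual of the cell module *)

Section Cellular.
Variables (n : nat) (lam : seq nat).
Hypothesis lamP : is_partition n lam.

Lemma standard_expansion (z : galg int n) : zspan (std_or_higher (n := n) lam) z ->
  exists c : 'S_n -> int,
    hspan lam (z - \sum_(d | standard lam d) c d *: (gp int d^-1%g * xrow int lam)).
Proof.
elim=> {z} [z [hz|[d hd ->]]||x y _ [c hc] _ [c' hc']].
- by exists (fun _ => 0); rewrite big1 ?subr0 // => d _; rewrite scale0r.
- exists (fun s => (s == d)%:R); rewrite (bigD1 d) //= eqxx scale1r big1.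
    by rewrite addr0 tab_std_tabloid subrr; apply: zspan0.
  by move=> s /andP[_ /negbTE ->]; rewrite scale0r.
- by exists (fun _ => 0); rewrite big1 ?subr0; [apply: zspan0 | move=> d _; rewrite scale0r].
- exists (fun s => c s - c' s).
  rewrite (eq_bigr (fun d => c d *: (gp int d^-1%g * xrow int lam) -
                             c' d *: (gp int d^-1%g * xrow int lam))).
    rewrite sumrB opprB addrACA [- y + _]addrC -addrACA -[X in _ + X]opprB.
    exact: zspanB hc hc'.
  by move=> d _; rewrite scalerBl.
Qed.

Lemma xrow_gp (K : comNzRingType) (r : 'S_n) : rowstab lam r ->
  xrow K lam * gp K r = xrow K lam.
Proof.
move=> /forallP hr; rewrite tab_gp; apply: eq_tab => // k.
by have := hr (r^-1 k)%g; rewrite permKV => /eqP ->.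
Qed.

Lemma mul_xrow_row (K : comNzRingType) (z : galg K n) (g g' : 'S_n) :
  (forall k, row_of lam (g k) = row_of lam (g' k)) ->
  (z * xrow K lam) g = (z * xrow K lam) g'.
Proof.
move=> h; rewrite -[in LHS](@xrow_gp K (g'^-1 * g)%g).
  by rewrite mulrA gpMR invMg invgK mulKVg.
by apply/forallP => k; rewrite permM h permKV.
Qed.

Lemma xrow_star (K : comNzRingType) : star (xrow K lam) = xrow K lam :> galg K n.
Proof. exact: star_tab. Qed.

(* The functionals [z |-> (kappa * d * z) 1], [d] standard and different from [1], vanish on
   [x g x] and on the higher span; being unitriangular they kill every coefficient of [x g x]
   with respect to the standard tabloids, except the one of [x]. *)
Lemma cellular_coefficient (g : 'S_n) :
  exists r : int, hspan lam (xrow int lam * gp int g * xrow int lam - r *: xrow int lam).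
Proof.
have [c hc] : exists c : 'S_n -> int, hspan lam (xrow int lam * gp int g * xrow int lam -
    \sum_(d | standard lam d) c d *: (gp int d^-1%g * xrow int lam)).
  apply: standard_expansion; rewrite -mulrA gp_tab (galg_basis (xrow int lam)) mulr_suml.
  apply: zspan_sum => s _; rewrite -scalerAl; apply: zspan_int; rewrite gp_tab.
  exact: straightening.
pose P h := (kappa int lam * xrow int lam : galg int n) h.
have P1 h : (kappa int lam * (gp int h * xrow int lam)) 1%g = P h.
  rewrite /P !ffunE (reindex_inj invg_inj) /=; apply: eq_bigr => t _.
  rewrite -[in LHS](starE (kappa int lam)) star_kappa invgK mulg1 gpML.
  by rewrite -[in LHS](invgK (h^-1 * t)%g) -starE xrow_star invMg invgK.
have hP d : standard lam d -> d != 1%g ->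
    \sum_(s | standard lam s) c s * P (d * s^-1)%g = 0.
  move=> hd hd1; have := kappa_hspan lamP (hspan_mull lamP (gp int d) hc).
  rewrite 2!mulrBr -!mulrA [gp int d * _]mulrA [_ * (_ * (gp int g * _))]mulrA.
  rewrite kappa_standard // mul0r sub0r => /eqP; rewrite oppr_eq0 => /eqP.
  move/(congr1 (fun z : galg int n => z 1%g)); rewrite galg0 => e0; rewrite -[RHS]e0.
  rewrite !mulr_sumr galg_sumE; apply: eq_bigr => s _.
  by rewrite -!scalerAr galgZ [gp int d * _]mulrA -gpM P1.
have hc0 s : standard lam s -> s != 1%g -> c s = 0.
  move=> hs hs1; apply/eqP/negPn/negP => hcs.
  (* For [d] of maximal weight among the surviving coefficients, unitriangularity reduces the
     equation [hP] to the single term [c d]. *)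
  have h0 : [&& standard lam s, s != 1%g & c s != 0] by rewrite hs hs1.
  case: (@arg_maxnP _ s (fun d => [&& standard lam d, d != 1%g & c d != 0])
    (fun d => weight (std_tabloid lam d)) h0) => d /and3P[hd hd1 hcd] hmax.
  have := hP d hd hd1; rewrite (bigD1 d) //= mulgV /P kappa_x_row //; last first.
    by move=> k; rewrite perm1.
  rewrite mulr1 big1 ?addr0; first by apply/eqP.
  move=> s' /andP[hs' hne]; case: (eqVneq (c s') 0) => [->|hcs']; first by rewrite mul0r.
  apply/eqP; rewrite mulf_eq0 (negbTE hcs') /=; apply/negPn/negP => hPne.
  case: (eqVneq s' 1%g) => [e|hs'1].
    move: hPne; rewrite e invg1 mulg1 -/(P d) -P1 kappa_standard // galg0 eqxx //.
  case: (kappa_x_triangular lamP hd hPne) => [e|].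
    by case/eqP: hne; apply: (std_tabloid_inj lamP) => // k; rewrite -e.
  by rewrite ltnNge; have /= -> := hmax s'; rewrite ?hs' ?hs'1.
(* The case split spares the verification that $t^\lambda$ is standard. *)
case: (boolP (standard lam (1%g : 'S_n))) => h1.
  exists (c 1%g); move: hc; rewrite (bigD1 1%g) //= invg1 gp1 mul1r big1 ?addr0 //.
  by move=> d /andP[hd hd1]; rewrite hc0 // scale0r.
exists 0; move: hc; rewrite scale0r big1 // => d hd; rewrite hc0 ?scale0r //.
by apply: contraNneq h1 => <-.
Qed.

Section PolytabloidBasis.
Variables (K : comNzRingType) (S : K -> Prop).
Hypotheses (S_int : forall m : int, S m%:~R) (S_add : forall a b, S a -> S b -> S (a + b))
           (S_mul : forall a b, S a -> S b -> S (a * b)).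
Implicit Types f g h u z : galg K n.

Lemma closed_sum I (r : seq I) (P : pred I) (F : I -> K) :
  (forall i, P i -> S (F i)) -> S (\sum_(i <- r | P i) F i).
Proof.
move=> h; elim/big_rec: _ => [|i x hi]; last by apply: S_add; apply: h.
by have := S_int 0; rewrite rmorph0.
Qed.

Lemma closed_opp a : S a -> S (- a).
Proof. by move=> h; rewrite -mulN1r; apply: S_mul h; have := S_int (-1); rewrite rmorphN1. Qed.

Lemma closed_mul f g : (forall s, S (f s)) -> (forall s, S (g s)) -> forall s, S ((f * g) s).
Proof. by move=> hf hg s; rewrite ffunE; apply: closed_sum => t _; apply: S_mul. Qed.

Lemma closed_gmap (f : galg int n) s : S (gmap K f s).
Proof. by rewrite gmapE. Qed.

Lemma closed_gp (s t : 'S_n) : S (gp K s t).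
Proof. by rewrite -gmap_gp; apply: closed_gmap. Qed.

Definition row_constant u : Prop := forall g g' : 'S_n,
  (forall k, row_of lam (g k) = row_of lam (g' k)) -> u g = u g'.

(** The condition for $wx\mapsto\langle w,u\rangle$ to be well defined on the cell module; integral
    [w] suffice, as they generate the relations. *)
Definition kills_higher u : Prop := forall w : galg int n,
  hspan lam (w * xrow int lam) -> dot (gmap K w) u = 0.

Lemma kills_higherP h : kills_higher (h * kappa K lam * xrow K lam).
Proof.
move=> w hw; rewrite dotC dotMr xrow_star dotMr star_kappa.
rewrite -gmap_tab -rmorphM /= (span_higher_kappa (inS := S) lamP) ?dot0r //.
by apply: hspan_span_higher.
Qed.

(** A functional on the cell module is determined by its values on the standard tabloids, which
    span. *)
Lemma standard_vanish u : row_constant u -> kills_higher u ->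
  (forall d, standard lam d -> u d^-1%g = 0) -> u = 0.
Proof.
move=> hr hk hd; apply/ffunP => g; rewrite galg0.
have [c hc] := standard_expansion (straightening lamP (fun k => row_of lam (g k))).
have := hk (gp int g - \sum_(d | standard lam d) c d *: gp int d^-1%g).
rewrite mulrBl gp_tab mulr_suml.
under eq_bigr => d _ do rewrite -scalerAl.
move=> /(_ hc); rewrite rmorphB /= gmap_gp rmorph_sum /= -scaleN1r dotDl dotZl.
rewrite (dotC (gp K g)) dot_gp => <-; rewrite -[LHS]addr0; congr (_ + _).
rewrite dotC /dot (eq_bigr (fun s => \sum_(d | standard lam d) u s * (gmap K (c d *: gp int d^-1%g)) s)).
  rewrite exchange_big /= big1 ?mulr0 // => d hdst; rewrite gmapZ gmap_gp.
  by rewrite -/(dot u _) dotZr dot_gp hd // mulr0.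
by move=> s _; rewrite galg_sumE mulr_sumr.
Qed.

(* The polytabloids of the standard tableaux are dual, up to a unitriangular matrix, to the
   basis of standard tabloids of the cell module. *)
Lemma polytabloid_span u : (forall s, S (u s)) -> row_constant u -> kills_higher u ->
  exists h, (forall s, S (h s)) /\ u = h * kappa K lam * xrow K lam.
Proof.
move=> Su hr hk.
pose e := kappa K lam * xrow K lam : galg K n.
have Se s : S (e s).
  by rewrite /e -gmap_kappa -gmap_tab -rmorphM; apply: closed_gmap.
have hr' h : row_constant (u - h * e).
  move=> g g' hg; rewrite !galgD !galgN (hr _ _ hg) /e mulrA.
  by rewrite (mul_xrow_row _ hg).
have S' h : (forall s, S (h s)) -> forall s, S ((u - h * e) s).
  by move=> hS s; rewrite galgD galgN; apply: S_add => //; apply/closed_opp/closed_mul.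
have [h [hS hh]] : exists h, (forall s, S (h s)) /\ forall d, standard lam d ->
    (weight (std_tabloid lam d) < (\max_(d : 'S_n) weight (std_tabloid lam d)).+1)%N ->
    (u - h * e) d^-1%g = 0.
  (* Values are corrected in order of increasing weight. At most one standard tabloid has weight
     [m]; its polytabloid has coefficient 1 there and vanishes at all standard tabloids of smaller
     weight. *)
  elim: {1}(_.+1) => [|m [h [hS IH]]].
    by exists 0; split=> // s; rewrite galg0; have := S_int 0; rewrite rmorph0.
  case: (pickP [pred d : 'S_n | standard lam d && (weight (std_tabloid lam d) == m)]) =>
    [d0 /andP[hd0 /eqP hm]|hno]; last first.
    exists h; split=> // d hd; rewrite ltnS leq_eqVlt => /orP[hdm|]; last exact: IH.
    by have := hno d; rewrite /= hd hdm.
  set a := (u - h * e) d0^-1%g.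
  exists (h + a *: gp K d0^-1%g); split.
    move=> s; rewrite galgD galgZ; apply: S_add => //; apply: S_mul; first exact: S'.
    exact: closed_gp.
  move=> d hd; rewrite mulrDl opprD addrA galgD galgN -scalerAl galgZ gpML invgK.
  rewrite ltnS leq_eqVlt => /orP[/eqP hdm|hlt].
    have ed : std_tabloid lam d =1 std_tabloid lam d0.
      by apply: weight_inj; rewrite ?hdm // => j; apply: row_of_le.
    rewrite (hr' h _ d0^-1%g) ?kappa_x_row ?mulr1 ?subrr //.
    by move=> k; rewrite permM; have := ed (d0 k); rewrite /std_tabloid permK.
  rewrite IH // sub0r; apply/eqP; rewrite oppr_eq0; apply/eqP.
  suff -> : e (d0 * d^-1)%g = 0 by rewrite mulr0.
  apply/eqP/negPn/negP => /(kappa_x_triangular lamP hd0) [ed|].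
    have : weight (std_tabloid lam d) = weight (std_tabloid lam d0).
      exact: eq_weight.
    by rewrite hm => e2; rewrite e2 ltnn in hlt.
  by rewrite hm ltnNge -/(std_tabloid lam d) ltnW.
exists h; split=> //; rewrite -mulrA -/e; apply/eqP; rewrite -subr_eq0; apply/eqP.
apply: standard_vanish => // [|d hd]; last by apply: hh => //; rewrite ltnS leq_bigmax.
move=> w hw; rewrite -scaleN1r dotC dotDl dotZl dotC hk // dotC /e mulrA.
by rewrite kills_higherP // mulr0 addr0.
Qed.
End PolytabloidBasis.
End Cellular.

(** * Jucys-Murphy elements *)

Definition root_poly (l : seq int) : {poly rat} := \prod_(c <- l) ('X - (c%:~R)%:P).
(** The spectrum of [z] is recorded by an annihilating product over a list of integer roots, with
    repetitions. *)
Definition root_eval (A : algType rat) (z : A) (l : seq int) : A := horner_alg z (root_poly l).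

Section RootEval.
Variable A : algType rat.
Implicit Types (a b s x y z : A) (c : int) (l : seq int).

Definition shift z c : A := z - (c%:~R)%:A.

Lemma root_eval_cons z c l : root_eval z (c :: l) = shift z c * root_eval z l.
Proof.
rewrite /root_eval /root_poly big_cons rmorphM rmorphB /= horner_algX; congr (_ * _).
by rewrite horner_algC.
Qed.

Lemma root_eval_nil z : root_eval z [::] = 1.
Proof. by rewrite /root_eval /root_poly big_nil rmorph1. Qed.

Lemma root_eval_cat z l1 l2 : root_eval z (l1 ++ l2) = root_eval z l1 * root_eval z l2.
Proof. by rewrite /root_eval /root_poly big_cat rmorphM. Qed.

Lemma root_eval_perm z l1 l2 : perm_eq l1 l2 -> root_eval z l1 = root_eval z l2.
Proof. by move=> h; rewrite /root_eval /root_poly (perm_big _ h). Qed.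

Lemma comm_shift x z c : GRing.comm x z -> GRing.comm x (shift z c).
Proof.
move=> h; apply: commrB => //.
by rewrite /GRing.comm -scalerAr -scalerAl mulr1 mul1r.
Qed.

Lemma comm_root_eval x z l : GRing.comm x z -> GRing.comm x (root_eval z l).
Proof.
move=> h; elim: l => [|c l IH]; first by rewrite root_eval_nil; apply: commr1.
by rewrite root_eval_cons; apply: commrM => //; apply: comm_shift.
Qed.

Lemma root_eval_intertwine x a b l : x * a = b * x -> x * root_eval a l = root_eval b l * x.
Proof.
move=> h; elim: l => [|c l IH]; first by rewrite !root_eval_nil mulr1 mul1r.
rewrite !root_eval_cons mulrA /shift mulrBr h -scalerAr mulr1.
have -> : b * x - c%:~R *: x = shift b c * x by rewrite mulrBl -scalerAl mul1r.
by rewrite -mulrA IH mulrA.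
Qed.

Lemma sub_sqr_comm a b : b * a = a * b -> a * a - (a - b) * (a - b) = b * (a + a - b).
Proof.
move=> h; rewrite mulrBl (mulrBr a) (mulrBr b a) mulrBr mulrDr h opprB opprB.
by rewrite addrC -addrA subrK addrAC.
Qed.

(** Where $(b-a)^2=1$, every eigenvalue of $b$ is a neighbour of one of $a$; [y] restricts to that
    part. *)
Lemma root_eval_neighbours a b y l : GRing.comm a b ->
  y * ((b - a) * (b - a)) = y -> y * root_eval a l = 0 ->
  y * root_eval b ([seq c + 1 | c <- l] ++ [seq c - 1 | c <- l]) = 0.
Proof.
move=> hab; elim: l y => [|c l IH] y hy; first by rewrite /= root_eval_nil root_eval_nil.
rewrite root_eval_cons => h0 /=.
set y' := y * (shift b (c + 1) * shift b (c - 1)).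
have -> : y * root_eval b (c + 1 :: [seq c + 1 | c <- l] ++ c - 1 :: [seq c - 1 | c <- l]) =
    y' * root_eval b ([seq c + 1 | c <- l] ++ [seq c - 1 | c <- l]).
  rewrite (@root_eval_perm _ _ ([:: c + 1; c - 1] ++ [seq c + 1 | c <- l] ++ [seq c - 1 | c <- l])).
    by rewrite root_eval_cat !root_eval_cons root_eval_nil mulr1 mulrA.
  by rewrite /= perm_cons -cat1s perm_catCA.
have hbb : GRing.comm ((b - a) * (b - a)) b.
  by apply: commr_sym; apply: commrM; apply: commrB => //; apply: commr_sym.
apply: IH.
  rewrite /y' -mulrA -[X in y * X](_ : (b - a) * (b - a) * (shift b (c + 1) * shift b (c - 1)) = _).
    by rewrite mulrA hy.
  by apply: commrM; apply: comm_shift.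
set u := shift b c; set v := shift a c.
have huv : v * u = u * v.
  by apply: comm_shift; apply: commr_sym; apply: comm_shift; apply: commr_sym.
have huc : GRing.comm (u + u - v) (root_eval a l).
  apply: comm_root_eval; apply: commr_sym; apply: commrB; last exact: comm_shift.
  by apply: commrD; apply: comm_shift.
have ebu : b - a = u - v by rewrite /u /v /shift opprB addrA subrK.
have e1 : shift b (c + 1) = u - 1 by rewrite /u /shift rmorphD rmorph1 scalerDl scale1r opprD addrA.
have e2 : shift b (c - 1) = u + 1.
  by rewrite /u /shift rmorphB rmorph1 scalerBl scale1r opprB addrA addrAC.
(* After multiplication by [y], $(u-1)(u+1)$ becomes $u^2-(u-v)^2$, from which the factor $v$ splits
   off. *)
have e : y' = y * (v * (u + u - v)).
  rewrite /y' e1 e2 -[in LHS]subr_sqr_1.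
  rewrite expr2 mulrBr mulr1 -[X in _ - X]hy -mulrBr ebu; congr (y * _).
  exact: sub_sqr_comm.
rewrite -/v in h0; rewrite e -!mulrA huc.
by rewrite [v * _]mulrA mulrA h0 mul0r.
Qed.

(* [(b - a) s - 1] is an intertwiner carrying the eigenvalues of [a] to those of [b]. *)
Lemma root_eval_step a b s l : s * s = 1 -> s * a = b * s - 1 -> GRing.comm a b ->
  root_eval a l = 0 ->
  root_eval b (l ++ [seq c + 1 | c <- l] ++ [seq c - 1 | c <- l]) = 0.
Proof.
move=> hs hsa hab h0; rewrite root_eval_cat; apply: (root_eval_neighbours hab); last by rewrite h0 mulr0.
set X := root_eval b l.
have hsb : s * b = a * s + 1.
  have hbs : b * s = s * a + 1 by rewrite hsa subrK.
  have -> : s * b = s * (b * s) * s by rewrite -!mulrA hs mulr1.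
  by rewrite hbs mulrDr mulr1 mulrA hs mul1r mulrDl hs.
have hphi : ((b - a) * s - 1) * a = b * ((b - a) * s - 1).
  have hb : (b - a) * b = b * (b - a) by rewrite mulrBl mulrBr hab.
  rewrite mulrBl mul1r -mulrA hsa mulrBr mulr1 mulrA -addrA -opprD subrK hb.
  by rewrite -mulrA [RHS]mulrBr mulr1.
(* [X] annihilates the intertwiner, because the intertwiner carries [X] to the vanishing product in
   [a]. This means $X(b-a)=Xs$, and multiplying once more gives $X(b-a)^2=X$: beyond the old roots
   only neighbours occur. *)
have hX : X * ((b - a) * s) = X.
  apply/eqP; rewrite -subr_eq0 -{2}[X]mulr1 -mulrBr -(root_eval_intertwine l hphi) h0.
  by rewrite mulr0.
have hX2 : X * (b - a) = X * s by rewrite -{2}hX -!mulrA hs mulr1.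
have e : s * (b - a) = 1 + 1 - (b - a) * s.
  by rewrite mulrBr hsb hsa mulrBl !opprB [a * s + 1]addrC addrACA.
by rewrite mulrA hX2 -mulrA e mulrBr hX mulrDr mulr1 addrK.
Qed.
End RootEval.

Lemma uniq_sub_perm (T : eqType) (s1 s2 : seq T) : uniq s1 -> {subset s1 <= s2} ->
  exists r, perm_eq s2 (s1 ++ r).
Proof.
elim: s1 s2 => [|x s1 IH] s2 /=; first by exists s2.
move=> /andP[hx hu] hsub; have hx2 : x \in s2 by apply: hsub; rewrite mem_head.
have [r hr] : exists r, perm_eq (rem x s2) (s1 ++ r).
  apply: IH => // y hy; have := hsub y; rewrite inE hy orbT => /(_ isT).
  rewrite (perm_mem (perm_to_rem hx2)) inE => /orP[/eqP e|//].
  by rewrite -e hy in hx.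
by exists r; rewrite (perm_trans (perm_to_rem hx2)) //= perm_cons.
Qed.

Section SelfAdjoint.
Variable n : nat.
Implicit Types (z y : galg rat n).

Lemma star_shift z c : star z = z -> star (shift z c) = shift z c.
Proof.
move=> hz; rewrite /shift star_zmod hz starZ; congr (_ - _ *: _).
by rewrite -gp1 star_gp invg1.
Qed.

(** For self-adjoint $N$, $\langle Ny,Ny\rangle=\langle y,N^2y\rangle=0$: there are no Jordan
    blocks. *)
Lemma shift_sqr z c y : star z = z -> shift z c * (shift z c * y) = 0 -> shift z c * y = 0.
Proof.
move=> hz h; apply: dot_self_eq0.
by rewrite dotMl star_shift // h dot0r.
Qed.

Lemma root_eval_undup z l y : star z = z -> root_eval z l * y = 0 ->
  root_eval z (undup l) * y = 0.
Proof.
move=> hz; have hzz c d : shift z c * shift z d = shift z d * shift z c.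
  by apply: comm_shift; apply: commr_sym; apply: comm_shift.
elim: l y => [|c l IH] y //=; rewrite root_eval_cons => h.
have hc l' : shift z c * root_eval z l' = root_eval z l' * shift z c.
  by apply: comm_root_eval; apply: commr_sym; apply: comm_shift.
have {}h : root_eval z (undup l) * (shift z c * y) = 0 by apply: IH; rewrite mulrA -hc.
case: ifP => hcl; last by rewrite root_eval_cons hc -mulrA.
have hcu : c \in undup l by rewrite mem_undup.
move: h; rewrite (root_eval_perm z (perm_to_rem hcu)) root_eval_cons mulrA.
rewrite -[_ * _ * shift z c]mulrA -hc -!mulrA => /(shift_sqr hz); by rewrite mulrA.
Qed.

(** Multiplicities being irrelevant, the wasteful lists produced by [root_eval_step] may be replaced
    by any list containing the same integers. *)
Lemma root_eval_sub z l l' : star z = z -> root_eval z l = 0 -> {subset l <= l'} ->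
  root_eval z l' = 0.
Proof.
move=> hz h hsub; have := @root_eval_undup z l 1 hz; rewrite !mulr1 => /(_ h) hu.
have [r hr] : exists r, perm_eq l' (undup l ++ r).
  by apply: uniq_sub_perm; rewrite ?undup_uniq // => c; rewrite mem_undup; apply: hsub.
by rewrite (root_eval_perm _ hr) root_eval_cat hu mul0r.
Qed.
End SelfAdjoint.

Section JucysMurphy.
Variable n : nat.

Definition jm (K : nzRingType) (b : 'I_n) : galg K n := \sum_(a : 'I_n | (a < b)%N) gp K (tperm a b).

Lemma JM_jm (b : 'I_n) : JM n b = jm rat b.
Proof.
rewrite /JM /jm /gp; apply: eq_bigr => a _.
by rewrite valK.
Qed.

Variable K : comNzRingType.

Lemma star_jm b : star (jm K b) = jm K b.
Proof. by rewrite /jm raddf_sum; apply: eq_bigr => a _ /=; rewrite star_gp tpermV. Qed.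

Lemma gp_tperm_conj (s : 'S_n) (a b : 'I_n) :
  gp K (tperm a b) * gp K s = gp K s * gp K (tperm (s a) (s b)).
Proof. by rewrite -!gpM -tpermJ conjgE mulKVg. Qed.

Lemma jm_comm_gp (s : 'S_n) (b : 'I_n) : s b = b -> (forall k, (s k < b)%N = (k < b)%N) ->
  GRing.comm (gp K s) (jm K b).
Proof.
move=> hb hs; rewrite /GRing.comm /jm mulr_sumr mulr_suml.
rewrite (reindex_inj (@perm_inj _ s)) /=; apply: eq_big => [a|a _]; first exact: hs.
by rewrite gp_tperm_conj hb.
Qed.

Lemma jm_comm (a b : 'I_n) : GRing.comm (jm K a) (jm K b).
Proof.
wlog hab : a b / (a <= b)%N.
  by case: (leqP a b) => [h H|/ltnW h H]; [exact: H | apply: commr_sym; exact: H].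
move: hab; rewrite leq_eqVlt => /orP[/eqP/val_inj -> //|hab].
apply: commr_sym; rewrite [jm K a]/jm; apply: commr_sum => c hca; apply: commr_sym.
apply: jm_comm_gp; first by rewrite tpermD // neq_ltn ?(ltn_trans hca) ?hab.
by move=> k; case: tpermP => [->|->|]; rewrite ?hab ?(ltn_trans hca).
Qed.

Lemma jm_succ (i j : 'I_n) : j = i.+1 :> nat ->
  gp K (tperm i j) * jm K i = jm K j * gp K (tperm i j) - 1.
Proof.
move=> hij; have hlt : (i < j)%N by rewrite hij.
have neij : i != j by rewrite neq_ltn hlt.
rewrite /jm mulr_suml (bigD1 i hlt) /=.
rewrite -gpM tperm2 gp1 addrC addrK mulr_sumr.
apply: eq_big => [a|a hai].
  by rewrite hij ltnS andbC ltn_neqAle.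
rewrite [RHS]gp_tperm_conj tpermR tpermD //; first by rewrite neq_ltn hai orbT.
by rewrite neq_ltn (ltn_trans hai hlt) orbT.
Qed.
End JucysMurphy.

Lemma jm_roots n (k : 'I_n) l : (forall c : int, `|c| <= k%:Z -> c \in l) ->
  root_eval (jm rat k) l = 0.
Proof.
suff [l' [hb h0]] : exists l' : seq int, (forall c, c \in l' -> `|c| <= k%:Z) /\
    root_eval (jm rat k) l' = 0.
  by move=> hl; apply: (root_eval_sub (star_jm _ k) h0) => c /hb /hl.
case: k => m hm; elim: m hm => [|m IH] hm.
  exists [:: 0]; split; first by move=> c; rewrite inE => /eqP ->.
  by rewrite root_eval_cons root_eval_nil mulr1 /shift /jm big_pred0_eq scale0r subrr.
have hm' := ltnW hm; have [l' [hb h0]] := IH hm'.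
exists (l' ++ [seq c + 1 | c <- l'] ++ [seq c - 1 | c <- l']); split.
  have hb' c : c \in l' -> `|c| <= m%:Z := hb c.
  move=> c; rewrite !mem_cat /= => /or3P[/hb'|/mapP[d /hb' h ->]|/mapP[d /hb' h ->]]; lia.
apply: (@root_eval_step _ (jm rat (Ordinal hm')) _ (gp rat (tperm (Ordinal hm') (Ordinal hm)))) => //.
- by rewrite -gpM tperm2.
- exact: jm_succ.
- exact: jm_comm.
Qed.

Lemma comm_prod_extract (R : nzRingType) (I : eqType) (r : seq I) (P : pred I) (F : I -> R) k :
  k \in r -> P k -> (forall i, P i -> GRing.comm (F i) (F k)) ->
  exists y, \prod_(i <- r | P i) F i = F k * y.
Proof.
move=> + hk hc; elim: r => // j r IH; rewrite inE => /orP[/eqP <-|/IH [y hy]].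
  by rewrite big_cons hk; exists (\prod_(i <- r | P i) F i).
rewrite big_cons hy; case: ifP => hj; last by exists y.
by exists (F j * y); rewrite mulrA hc // -mulrA.
Qed.

Section Idempotent.
Variables (n : nat) (lam : seq nat).
Hypothesis lamP : is_partition n lam.

(** The index shift makes the contents run from $-(n-1)$ to $n-1$, which covers the spectrum bound
    of [jm_roots]. *)
Definition cval (c : 'I_(2 * n).-1) : int := c%:Z - n.-1%:Z.
Definition efactor (c : 'I_(2 * n).-1) (i : 'I_n) : galg rat n :=
  ((content lam i - cval c)%:~R)^-1 *: shift (jm rat i) (cval c).
Definition eprod (c : 'I_(2 * n).-1) : galg rat n :=
  \prod_(i < n | content lam i != cval c) efactor c i.

Definition Eidem : galg rat n := Elam n lam.

Lemma EidemE : Eidem = \prod_c eprod c.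
Proof.
rewrite /Eidem /Elam; apply: eq_bigr => c _; apply: eq_bigr => i _.
by rewrite JM_jm.
Qed.

Lemma comm_efactor (z : galg rat n) c i : GRing.comm z (jm rat i) -> GRing.comm z (efactor c i).
Proof.
by move=> h; rewrite /GRing.comm /efactor -scalerAr -scalerAl (comm_shift _ h).
Qed.

Lemma comm_Eidem (k : 'I_n) : GRing.comm (jm rat k) Eidem.
Proof.
rewrite EidemE; apply: commr_prod => c _; apply: commr_prod => i _.
by apply: comm_efactor; apply: jm_comm.
Qed.

Lemma eprod_extract (k : 'I_n) c : content lam k != cval c ->
  exists y, eprod c = shift (jm rat k) (cval c) * y.
Proof.
move=> hk; have hc (i : 'I_n) : content lam i != cval c ->
    GRing.comm (efactor c i) (efactor c k).
  by move=> _; apply: comm_efactor; apply: commr_sym; apply: comm_efactor; exact: jm_comm.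
have [y e] := @comm_prod_extract _ _ _ (fun i : 'I_n => content lam i != cval c)
    (efactor c) k (mem_index_enum k) hk hc.
exists (((content lam k - cval c)%:~R)^-1 *: y).
by rewrite /eprod e /efactor -scalerAl scalerAr.
Qed.

(** The factors of $E$ belonging to [k] contain every admissible root except the content of [k];
    multiplying by that missing factor completes an annihilating product. *)
Lemma jm_Eidem (k : 'I_n) : jm rat k * Eidem = (content lam k)%:~R *: Eidem.
Proof.
have ex (r : seq 'I_(2 * n).-1) : exists y, \prod_(c <- r) eprod c =
    root_eval (jm rat k) [seq cval c | c <- r & content lam k != cval c] * y.
  elim: r => [|c r [y hy]]; first by exists 1; rewrite big_nil root_eval_nil mulr1.
  have hcomm : GRing.comm (eprod c) (root_eval (jm rat k) [seq cval c | c <- r & content lam k != cval c]).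
    apply: comm_root_eval; apply: commr_sym; apply: commr_prod => i _.
    by apply: comm_efactor; apply: jm_comm.
  rewrite big_cons hy /= mulrA hcomm; case: ifP => hc; last by exists (eprod c * y); rewrite mulrA.
  have [y' hy'] := eprod_extract hc; exists (y' * y).
  rewrite root_eval_cons hy' !mulrA; congr (_ * _ * _).
  by apply/esym/comm_root_eval/commr_sym/comm_shift.
apply/eqP; rewrite -subr_eq0.
have -> : jm rat k * Eidem - (content lam k)%:~R *: Eidem =
    shift (jm rat k) (content lam k) * Eidem.
  by rewrite /shift mulrBl -scalerAl mul1r.
rewrite EidemE; have [y ->] := ex (index_enum _); rewrite mulrA -root_eval_cons.
rewrite (@jm_roots _ k) ?mul0r // => c hc; rewrite inE.
case: (c =P content lam k) => //= hck.
have hn : (n.-1 < n)%N by have := ltn_ord k; lia.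
have hcn : (absz (c + n.-1%:Z)%R < (2 * n).-1)%N by have := ltn_ord k; lia.
apply/mapP; exists (Ordinal hcn); last by rewrite /cval /=; have := ltn_ord k; lia.
rewrite mem_filter mem_index_enum andbT; apply/eqP => e; apply: hck.
by rewrite e /cval /=; have := ltn_ord k; lia.
Qed.

Lemma Eidem_jm (k : 'I_n) : Eidem * jm rat k = (content lam k)%:~R *: Eidem.
Proof. by rewrite -comm_Eidem jm_Eidem. Qed.

(** Each normalised factor of $E$ fixes a joint eigenvector with these contents, modulo a left ideal
    [Q]. It is applied with [Q] zero and with [Q] the higher span. *)
Lemma Eidem_acts (Q : galg rat n -> Prop) y : Q 0 -> (forall a b, Q a -> Q b -> Q (a + b)) ->
  (forall h a, Q a -> Q (h * a)) ->
  (forall k : 'I_n, Q (jm rat k * y - (content lam k)%:~R *: y)) -> Q (Eidem * y - y).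
Proof.
move=> Q0 QD QM hk.
have step z w : Q (z * y - y) -> Q (w * y - y) -> Q (z * w * y - y).
  move=> hz hw; have -> : z * w * y - y = z * (w * y - y) + (z * y - y).
    by rewrite mulrBr mulrA addrA subrK.
  by apply: QD => //; apply: QM.
have one : Q (1 * y - y) by rewrite mul1r subrr.
rewrite EidemE; elim/big_rec: _ => // c z _ hz; apply: (step _ _ _ hz).
rewrite /eprod; elim/big_rec: _ => // i z' hi hz'; apply: (step _ _ _ hz').
have -> : efactor c i * y - y = (((content lam i - cval c)%:~R)^-1)%:A *
    (jm rat i * y - (content lam i)%:~R *: y); last exact: QM.
rewrite -[RHS]scalerAl mul1r.
have hne : ((content lam i - cval c)%:~R : rat) != 0.
  by rewrite intr_eq0 subr_eq0.
rewrite -[X in _ - X](scalerK hne) /efactor -scalerAl -scalerBr; congr (_ *: _).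
rewrite /shift mulrBl -scalerAl mul1r; move: (cval c) => v.
by rewrite rmorphB scalerBl opprB addrA subrK.
Qed.

(** [star Eidem] is a joint eigenvector, hence equal to [Eidem * star Eidem], which is visibly
    self-adjoint. *)
Lemma star_Eidem : star Eidem = Eidem.
Proof.
have h : Eidem * star Eidem = star Eidem.
  apply/eqP; rewrite -subr_eq0; apply/eqP.
  apply: (@Eidem_acts (fun z => z = 0)) => [//|a b -> ->|h a ->|k]; rewrite ?addr0 ?mulr0 //.
  by rewrite -{1}star_jm -starM Eidem_jm starZ subrr.
by rewrite -[LHS]h -{1}[Eidem]starK -starM h starK.
Qed.
End Idempotent.

(** * Action of the Jucys-Murphy elements on tabloids *)

(* Pointwise at [g] the terms on the two sides correspond under [k = g a]. *)
Lemma tab_move (K : comNzRingType) n (F f : 'I_n -> nat) (b : 'I_n) i : i != f b ->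
  tab K F f + \sum_(a | f a == i) gp K (tperm a b) * tab K F f =
  \sum_(k | F k == f b) tab K (recolour F k i) (recolour f b i).
Proof.
move=> hib.
have -> : tab K F f + \sum_(a | f a == i) gp K (tperm a b) * tab K F f =
    \sum_(a | (f a == i) || (a == b)) tab K F (fun k => f (tperm a b k)).
  rewrite [RHS](bigD1 b) ?eqxx ?orbT //=; congr (_ + _).
    by apply: eq_tab => // k; rewrite tperm1 perm1.
  apply: eq_big => [a|a _]; last by rewrite gp_tab.
  by case: (eqVneq a b) => [->|]; rewrite ?andbT ?orbF // eq_sym (negbTE hib).
apply/ffunP => g; rewrite !galg_sumE big_mkcond [RHS]big_mkcond /=.
rewrite [RHS](reindex_inj (@perm_inj _ g)) /=; apply: eq_bigr => a _.
have h : ((f a == i) || (a == b)) && [forall k, F (g k) == f (tperm a b k)] =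
    (F (g a) == f b) && [forall k, recolour F (g a) i (g k) == recolour f b i k].
  apply/andP/andP => [[hab /forallP hF]|[/eqP ha /forallP hF]]; split.
  - by have := hF a; rewrite tpermL.
  - apply/forallP => k; rewrite /recolour (inj_eq perm_inj).
    case: (eqVneq k a) => [->|hka].
      by case: (eqVneq a b) hab => // _; rewrite orbF eq_sym.
    case: (eqVneq k b) => [ekb|hkb]; last by have := hF k; rewrite tpermD // eq_sym.
    have fa : f a = i by case/orP: hab => /eqP // e; rewrite e ekb eqxx in hka.
    by have := hF k; rewrite ekb tpermR fa.
  - have := hF a; rewrite /recolour eqxx; case: (eqVneq a b) => //= _; first by rewrite orbT.
    by rewrite orbF eq_sym.
  - apply/forallP => k; have := hF k; rewrite /recolour (inj_eq perm_inj).
    case: tpermP => [->|->|/eqP hka /eqP hkb]; first by rewrite ha.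
      case: (eqVneq b a) => [e _|hba]; first by rewrite e ha e.
      move=> h; have := hF a; rewrite /recolour eqxx (eq_sym a) (negbTE hba) => /eqP <-.
      by move: h; rewrite eqxx.
    by rewrite (negbTE hka) (negbTE hkb).
rewrite !tabP; transitivity (((F (g a) == f b) &&
    [forall k, recolour F (g a) i (g k) == recolour f b i k])%:R : K).
  by rewrite -h; case: (_ || _).
by case: (_ == f b).
Qed.

Section JucysMurphyAction.
Variables (n : nat) (lam : seq nat).
Hypothesis lamP : is_partition n lam.

Lemma jm_split (K : comNzRingType) (b : 'I_n) (z : galg K n) : jm K b * z =
  \sum_(a : 'I_n | (a < b)%N && (row_of lam a == row_of lam b)) gp K (tperm a b) * z +
  \sum_(i < row_of lam b) \sum_(a : 'I_n | row_of lam a == i) gp K (tperm a b) * z.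
Proof.
rewrite /jm mulr_suml (bigID (fun a : 'I_n => row_of lam a == row_of lam b)) /=; congr (_ + _).
rewrite (eq_bigl (fun a : 'I_n => (row_of lam a < row_of lam b)%N)); last first.
  move=> a; case: (ltnP a b) => hab /=.
    by rewrite ltn_neqAle (row_mono lamP (ltnW hab)) ?andbT.
  by apply/esym/negbTE; rewrite -leqNgt (row_mono lamP hab).
rewrite [RHS](exchange_big_dep (fun a : 'I_n => (row_of lam a < row_of lam b)%N)) /=; last first.
  by move=> i a _ /eqP ->.
apply: eq_bigr => a ha; rewrite (big_pred1 (Ordinal ha)) // => i; rewrite eq_sym.
Qed.

Lemma recolour_above (k : 'I_n) i : (i < row_of lam k)%N -> above lam (recolour (rowc lam) k i).
Proof.
move=> hi; apply: (above_lower lamP) => [j|].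
  by rewrite /recolour; case: eqP => // ->; apply: ltnW.
by exists k; rewrite /recolour eqxx.
Qed.

(** Transpositions inside the row fix $x$ and contribute the column index. By [tab_move], each row
    above contributes $-x$ plus terms in which an entry has moved up, so the scalar is column minus
    row. *)
Lemma jm_xrow_int (b : 'I_n) :
  hspan lam (jm int b * xrow int lam - content lam b *: xrow int lam).
Proof.
rewrite jm_split (eq_bigr (fun _ => xrow int lam)); last first.
  move=> a /andP[_ /eqP hab]; rewrite gp_tab; apply: eq_tab => // k.
  by case: tpermP => [->|->|].
rewrite sumr_const (card_row_before lamP) /content scalerBl.
have hz (m : nat) (z : galg int n) : m%:Z *: z = z *+ m by rewrite -natz scaler_nat.
rewrite !hz opprB addrAC [_ *+ row_of lam b - _]addrC addrA subrr add0r.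
rewrite -[X in _ *+ X]card_ord -sumr_const -big_split /=; apply: zspan_sum => i _.
have hne : (i : nat) != row_of lam b by rewrite neq_ltn ltn_ord.
rewrite (tab_move int (rowc lam) (f := rowc lam) hne); apply: zspan_sum => k /eqP hk.
by apply: (above_hspan lamP); apply: recolour_above; rewrite hk.
Qed.

Definition Q_higher (z : galg rat n) : Prop := span_higher (fun _ : rat => True) lam z.

Lemma Eidem_xrow : Q_higher (Eidem n lam * xrow rat lam - xrow rat lam).
Proof.
apply: Eidem_acts.
- exact: span_higher0.
- exact: span_higherD.
- by move=> h a; apply: span_higher_mull.
move=> k; have := hspan_span_higher (K := rat) (inS := fun _ => True) (fun _ => I)
    (fun _ _ _ _ => I) (jm_xrow_int k).
rewrite rmorphB rmorphM /= gmapZ gmap_tab.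
by rewrite (_ : gmap rat (jm int k) = jm rat k) // /jm rmorph_sum; apply: eq_bigr => a _; rewrite /= gmap_gp.
Qed.

(** $Ex\equiv x$ modulo the higher span, and [kappa] kills that span but not $x$. *)
Lemma Eidem_neq0 : Eidem n lam <> 0.
Proof.
move=> h; have := kappa_span_higher lamP Eidem_xrow.
rewrite h mul0r sub0r mulrN => /eqP; rewrite oppr_eq0 => /eqP.
move/(congr1 (fun z : galg rat n => z 1%g)); rewrite galg0 kappa_x_row //.
  by move=> k; rewrite perm1.
Qed.
End JucysMurphyAction.

(** * Strict monotonicity of content sums *)

Import Order.TTheory.

Lemma abel_sum (w D : nat -> int) N :
  \sum_(i < N) w i * (D i.+1 - D i) =
  w N * D N - w 0%N * D 0%N + \sum_(i < N) (w i - w i.+1) * D i.+1.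
Proof.
elim: N => [|N IH]; first by rewrite !big_ord0 subrr addr0.
by rewrite !big_ord_recr /= IH; ring.
Qed.

(** Convexity of $q(q-2i)$ bounds the difference of the two sums below by a linear form, and
    summation by parts makes that form positive. Only [Q] has decreasing increments; [P] may come
    from a composition. *)
Lemma content_sum_lt (P Q : nat -> int) N :
  P 0%N = Q 0%N -> P N = Q N ->
  (forall c, (c <= N)%N -> Q c <= P c) -> (exists2 c, (c <= N)%N & Q c < P c) ->
  (forall i, (i.+1 < N)%N -> Q i.+2 - Q i.+1 <= Q i.+1 - Q i) ->
  \sum_(i < N) (Q i.+1 - Q i) * ((Q i.+1 - Q i) - (i * 2)%N%:Z) <
  \sum_(i < N) (P i.+1 - P i) * ((P i.+1 - P i) - (i * 2)%N%:Z).
Proof.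
move=> h0 hN hle [c hc hlt] hdec.
case: N h0 hN hle hc hdec => [|N] h0 hN hle hc hdec.
  by move: hc hlt; rewrite leqn0 => /eqP ->; rewrite h0 ltxx.
(* The derivative of $q(q-2i)$ at the row length $q$ of [Q]; the error of the linear bound is the
   square of the difference of the row lengths. *)
pose w (i : nat) : int := ((Q i.+1 - Q i) - i%:Z) * 2.
pose D i := P i - Q i.
have step (i : nat) : (Q i.+1 - Q i) * ((Q i.+1 - Q i) - (i * 2)%N%:Z) + w i * (D i.+1 - D i) <=
    (P i.+1 - P i) * ((P i.+1 - P i) - (i * 2)%N%:Z).
  rewrite -subr_ge0 (_ : _ - _ = ((P i.+1 - P i) - (Q i.+1 - Q i)) ^+ 2) ?sqr_ge0 //.
  by rewrite /w /D PoszM; ring.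
apply: (@lt_le_trans _ _ (\sum_(i < N.+1) ((Q i.+1 - Q i) * ((Q i.+1 - Q i) - (i * 2)%N%:Z) +
    w i * (D i.+1 - D i)))); last by apply: ler_sum => i _; apply: step.
rewrite big_split /= ltrDl abel_sum {1 2}/D h0 hN !subrr !mulr0 subrr add0r.
have term (i : 'I_N.+1) : 0 <= (w i - w i.+1) * D i.+1.
  case: (ltnP i N) => hi; last first.
    have -> : i.+1 = N.+1 by have := ltn_ord i; lia.
    by rewrite /D hN subrr mulr0.
  apply: mulr_ge0; first by have := hdec i hi; rewrite /w; lia.
  by rewrite subr_ge0 hle // ltnW.
case: c hc hlt => [|c] hc hlt; first by rewrite h0 ltxx in hlt.
have hcN : (c < N)%N.
  by rewrite ltn_neqAle -ltnS hc andbT; apply: contraTneq hlt => ->; rewrite hN ltxx.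
rewrite (bigD1 (Ordinal hc)) //=; apply: ltr_wpDr; first by apply: sumr_ge0 => i _; apply: term.
apply: mulr_gt0; first by have := hdec c hcN; rewrite /w; lia.
by rewrite subr_gt0.
Qed.

Lemma pairs_split (V : nmodType) n (m : nat) (F : 'I_n -> 'I_n -> V) :
  \sum_(b < n | (b < m)%N) \sum_(a < n | (a < m)%N) F a b =
  \sum_(b < n | (b < m)%N) \sum_(a < n | (a < b)%N) (F a b + F b a) +
  \sum_(b < n | (b < m)%N) F b b.
Proof.
have e (b : 'I_n) : (b < m)%N -> \sum_(a < n | (a < m)%N) F a b =
    \sum_(a < n | (a < b)%N) F a b + F b b + \sum_(a < n | (b < a < m)%N) F a b.
  move=> hb; rewrite (bigID (fun a : 'I_n => (a < b)%N)) /= -addrA; congr (_ + _).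
    by apply: eq_bigl => a; case: (ltnP a b) => h; rewrite ?andbF ?andbT // (ltn_trans h hb).
  rewrite (bigD1 b) /= ?ltnn ?hb //; congr (_ + _); apply: eq_bigl => a.
  have -> : (a != b) = ((a : nat) != b) by [].
  by lia.
rewrite (eq_bigr _ e) !big_split /= addrAC; congr (_ + _).
under [RHS]eq_bigr => b _ do rewrite big_split /=.
rewrite big_split /=; congr (_ + _).
rewrite (exchange_big_dep (fun a : 'I_n => (a < m)%N)) /=; last by move=> b a _ /andP[].
by apply: eq_bigr => a ha; apply: eq_bigl => b; rewrite ha andbT;
  case: (ltnP b a) => h; rewrite ?andbF ?andbT // (ltn_trans h ha).
Qed.

(** * Vanishing of E on more dominant tabloids *)

Section Symmetrizer.
Variables (n : nat) (lam : seq nat).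
Hypothesis lamP : is_partition n lam.

(* The colours at least [n] mark the entries not yet taken into account. *)
Definition level (m : nat) (f : 'I_n -> nat) : Prop := forall k : 'I_n, (f k < n)%N = (k < m)%N.

(** Twice the total content of the shape with these row lengths, plus the number of its nodes. *)
Definition quad (f : 'I_n -> nat) : int :=
  \sum_(b | (f b < n)%N) (#|[pred a | f a == f b]|%:Z - (f b * 2)%N%:Z).

Lemma sum_below (V : nmodType) (f : 'I_n -> nat) N (F : 'I_n -> V) :
  \sum_(a | (f a < N)%N) F a = \sum_(i < N) \sum_(a | f a == i) F a.
Proof.
rewrite [RHS](exchange_big_dep (fun a : 'I_n => (f a < N)%N)) /=; last by move=> i a _ /eqP ->.
by apply: eq_bigr => a ha; rewrite (big_pred1 (Ordinal ha)) // => i; rewrite eq_sym.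
Qed.

Lemma quadE f : quad f = \sum_(i < n) ((cumul f i.+1)%:Z - (cumul f i)%:Z) *
   (((cumul f i.+1)%:Z - (cumul f i)%:Z) - (i * 2)%N%:Z).
Proof.
rewrite /quad sum_below; apply: eq_bigr => i _.
have -> : (cumul f i.+1)%:Z - (cumul f i)%:Z = #|[pred a | f a == i]|%:Z.
  by rewrite cumulS PoszD addrC addKr.
rewrite (eq_bigr (fun _ => #|[pred a | f a == i]|%:Z - (i * 2)%N%:Z)).
  by rewrite sumr_const -mulr_natl natz.
by move=> b /eqP ->.
Qed.

(** Entries from [m] on receive distinct colours [n + k], so that only the first [m] entries are
    symmetrised along rows. *)
Definition rowlevel (m : nat) : 'I_n -> nat :=
  fun k => if (k < m)%N then row_of lam k else (n + k)%N.

Lemma rowlevelP m : level m (rowlevel m).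
Proof.
by move=> k; rewrite /rowlevel; case: ifP => h; rewrite ?(row_ltn lamP) // ltnNge leq_addr.
Qed.

Lemma rowlevel_n : rowlevel n =1 rowc lam.
Proof. by move=> k; rewrite /rowlevel ltn_ord. Qed.

Lemma cumul_rowlevel m c : (m <= n)%N -> (c <= n)%N ->
  cumul (rowlevel m) c = minn (rowstart lam c) m.
Proof.
move=> hm hc; have h : (minn (rowstart lam c) m <= n)%N by rewrite geq_min hm orbT.
rewrite -(card_ltn_ord h); apply: eq_card => k; rewrite !inE /rowlevel leq_min.
case: ifP => hk; first by rewrite (row_lt lamP) ?andbT.
by rewrite andbF; apply/negbTE; rewrite -leqNgt; apply: leq_trans hc (leq_addr _ _).
Qed.

Lemma content_total m : (m <= n)%N ->
  \sum_(b < n | (b < m)%N) (content lam b * 2 + 1) = quad (rowlevel m).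
Proof.
move=> hm.
have e : \sum_(b < n | (b < m)%N) \sum_(a < n | (a < m)%N) (row_of lam a == row_of lam b)%:R =
    \sum_(b < n | (b < m)%N) ((col_of lam b)%:Z * 2 + 1) :> int.
  rewrite pairs_split -big_split; apply: eq_bigr => b hb /=.
  rewrite eqxx; congr (_ + _).
  rewrite (eq_bigr (fun a : 'I_n => (row_of lam a == row_of lam b)%:R * 2)).
    rewrite -mulr_suml -(card_row_before lamP) -sum1_card; congr (_ * _).
    rewrite -natz natr_sum [RHS](eq_bigl (fun a : 'I_n =>
      (a < b)%N && (row_of lam a == row_of lam b))) // [RHS]big_mkcondr /=.
    by apply: eq_bigr => a _; case: ifP.
  by move=> a _; rewrite [row_of lam b == _]eq_sym; case: (_ == _).
rewrite /quad [RHS](eq_bigl (fun b : 'I_n => (b < m)%N)); last exact: rowlevelP.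
transitivity (\sum_(b < n | (b < m)%N) ((col_of lam b)%:Z * 2 + 1) -
   \sum_(b < n | (b < m)%N) (row_of lam b * 2)%N%:Z).
  by rewrite -sumrB; apply: eq_bigr => b _; rewrite /content PoszM; ring.
rewrite -e -sumrB; apply: eq_bigr => b hb; rewrite /rowlevel hb; congr (_ - _).
rewrite -sum1_card -natz natr_sum big_mkcond [RHS]big_mkcond /=.
apply: eq_bigr => a _; rewrite inE; case: ifP => ha; first by case: (_ == _).
by rewrite gtn_eqF // (leq_trans (row_ltn lamP (ltn_ord b))) // leq_addr.
Qed.

Lemma quad_lt m f : (m <= n)%N -> level m f ->
  (forall c, (c <= n)%N -> (cumul (rowlevel m) c <= cumul f c)%N) ->
  (exists2 c, (c <= n)%N & (cumul (rowlevel m) c < cumul f c)%N) ->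
  quad (rowlevel m) < quad f.
Proof.
move=> hm hf hle [c hc hlt]; rewrite !quadE.
apply: (@content_sum_lt (fun c => (cumul f c)%:Z) (fun c => (cumul (rowlevel m) c)%:Z)).
- by congr Posz; rewrite /cumul !eq_card0 // => k; rewrite !inE.
- congr Posz; apply: eq_card => k; rewrite !inE; exact: (etrans (hf k) (esym (rowlevelP m k))).
- by move=> c' h; rewrite lez_nat hle.
- by exists c; rewrite ?ltz_nat.
move=> i hi; rewrite !cumul_rowlevel //; try lia.
rewrite !rowstartS; have := part_noninc lamP (leqnSn i); lia.
Qed.

Notation E := (Eidem n lam).

(** The double sum is twice the sum of the Jucys-Murphy elements of the first [m] entries plus [m]
    from the diagonal, whence the summand $2\cdot\text{content}+1$. *)
Lemma Eidem_pairs m : E * (\sum_(b < n | (b < m)%N) \sum_(a < n | (a < m)%N) gp rat (tperm a b)) =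
  (\sum_(b < n | (b < m)%N) (content lam b * 2 + 1))%:~R *: E.
Proof.
rewrite pairs_split -big_split mulr_sumr rmorph_sum scaler_suml; apply: eq_bigr => b _ /=.
rewrite tperm1 gp1 mulrDr mulr1 rmorphD scalerDl rmorph1 scale1r; congr (_ + _).
rewrite (eq_bigr (fun a : 'I_n => gp rat (tperm a b) *+ 2)).
  rewrite sumrMnl -[\sum_(i < n | _) _]/(jm rat b) (mulrnAr E) (Eidem_jm lamP) rmorphM /= -scaler_nat scalerA.
  by rewrite mulrC.
by move=> a _; rewrite tpermC mulr2n.
Qed.

(** Transpositions within a colour act trivially, and the other ordered pairs occur twice, so they
    are listed with [b] of the larger colour. *)
Lemma sum_pairs_colour (z : galg rat n) f (m : nat) : level m f ->
  (forall a b, f a = f b -> gp rat (tperm a b) * z = z) ->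
  (\sum_(b < n | (b < m)%N) \sum_(a < n | (a < m)%N) gp rat (tperm a b)) * z =
  \sum_(b | (f b < n)%N) (#|[pred a | f a == f b]|%:R *: z +
     (\sum_(a | (f a < f b)%N) gp rat (tperm a b) * z) *+ 2).
Proof.
move=> hf hz; rewrite mulr_suml big_split /= sumrMnl mulr2n.
rewrite (eq_bigl (fun b => (f b < n)%N)); last by move=> b; rewrite hf.
have e b : (f b < n)%N -> (\sum_(a < n | (a < m)%N) gp rat (tperm a b)) * z =
   #|[pred a | f a == f b]|%:R *: z + (\sum_(a | (f a < f b)%N) gp rat (tperm a b) * z +
   \sum_(a | (f b < f a < n)%N) gp rat (tperm a b) * z).
  move=> hb; rewrite mulr_suml (bigID (fun a => f a == f b)) /=; congr (_ + _).
    rewrite scaler_nat -sumr_const; apply: eq_big => [a|a /andP[_ /eqP h]]; last exact: hz.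
    by rewrite -hf inE andbC; case: eqP => // ->.
  rewrite (bigID (fun a => (f a < f b)%N)) /=; congr (_ + _); apply: eq_bigl => a.
    by rewrite -hf; lia.
  by rewrite -hf; lia.
rewrite (eq_bigr _ e) !big_split /=; congr (_ + (_ + _)).
rewrite (exchange_big_dep (fun a => (f a < n)%N)) /=; last by move=> b a _ /andP[].
by apply: eq_bigr => a ha; apply: eq_big => [b|b _]; [lia | rewrite tpermC].
Qed.

Lemma tab_tperm (K : comNzRingType) (F f : 'I_n -> nat) a b : f a = f b ->
  gp K (tperm a b) * tab K F f = tab K F f.
Proof. by move=> h; rewrite gp_tab; apply: eq_tab => // k; case: tpermP => [->|->|]. Qed.

Lemma cumul_recolour (f : 'I_n -> nat) b i c : (i <= f b)%N ->
  (cumul f c <= cumul (recolour f b i) c)%N.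
Proof.
move=> hi; apply/subset_leq_card/subsetP => k; rewrite !inE /recolour.
by case: eqP => // ->; apply: leq_ltn_trans.
Qed.

Lemma cumul_recolour_lt (f : 'I_n -> nat) b i : (i < f b)%N ->
  (cumul f i.+1 < cumul (recolour f b i) i.+1)%N.
Proof.
move=> hi; apply/proper_card/properP; split.
  apply/subsetP => k; rewrite !inE /recolour; case: eqP => // -> h; exact: leqnn.
by exists b; rewrite !inE /recolour ?eqxx // -leqNgt.
Qed.

(* Both sides of [E * (\sum_(a, b) (a, b)) * tab F f] are multiples of [E * tab F f], by
   the total content of the first [m] entries of [t^lam], resp. of [f]. *)
Lemma Eidem_kill m f F : (m <= n)%N -> level m f ->
  (forall c, (c <= n)%N -> (cumul (rowlevel m) c <= cumul f c)%N) ->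
  (exists2 c, (c <= n)%N & (cumul (rowlevel m) c < cumul f c)%N) ->
  E * tab rat F f = 0.
Proof.
have [N] := ubnP (n.+1 * n - \sum_(c < n.+1) cumul f c)%N.
elim: N f F => // N IH f F; rewrite ltnS => hN hm hf hle hlt.
(* Moving [b] up to colour [i] gives a more dominant colouring, killed by induction; so each colour
   above that of [b] contributes $-1$. *)
have hmove b i : (f b < n)%N -> (i < f b)%N ->
    E * (\sum_(a | f a == i) gp rat (tperm a b) * tab rat F f) = - (E * tab rat F f).
  move=> hb hi; have hin : (i < n)%N by apply: ltn_trans hb.
  have hne : i != f b by rewrite neq_ltn hi.
  apply/eqP; rewrite -addr_eq0 addrC -mulrDr (tab_move rat F hne) mulr_sumr big1 // => k _.
  apply: IH => //.
  - apply: leq_trans hN; have lt : (\sum_(c < n.+1) cumul f c <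
       \sum_(c < n.+1) cumul (recolour f b i) c)%N.
      have hin' : (i.+1 < n.+1)%N by [].
      rewrite (bigD1 (Ordinal hin')) //= [X in (_ < X)%N](bigD1 (Ordinal hin')) //=.
      rewrite -addSn leq_add ?cumul_recolour_lt //.
      by apply: leq_sum => c _; apply: cumul_recolour; apply: ltnW.
    apply: ltn_sub2l => //; apply: leq_trans lt _.
    by rewrite -[X in (X * _)%N]card_ord -sum_nat_const leq_sum // => c _; exact: cumul_le.
  - by move=> k'; rewrite /recolour; case: eqP => [->|_]; rewrite ?hf // hin -hf hb.
  - by move=> c hc; apply: leq_trans (hle c hc) (cumul_recolour _ (ltnW hi)).
  - by exists i.+1 => //; apply: leq_ltn_trans (hle _ hin) (cumul_recolour_lt hi).
have := congr1 (fun z => z * tab rat F f) (Eidem_pairs m).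
rewrite -mulrA (sum_pairs_colour hf (@tab_tperm _ F f)) mulr_sumr content_total //.
rewrite (eq_bigr (fun b => (#|[pred a | f a == f b]|%:Z - (f b * 2)%N%:Z)%:~R *: (E * tab rat F f))).
  rewrite -scaler_suml -rmorph_sum -/(quad f) -scalerAl => /eqP.
  rewrite -subr_eq0 -scalerBl scaler_eq0 -rmorphB intr_eq0 subr_eq0.
  by rewrite gt_eqF ?quad_lt //= => /eqP.
move=> b hb; rewrite mulrDr -scalerAr mulrnAr (sum_below f) mulr_sumr.
rewrite (eq_bigr (fun _ => - (E * tab rat F f))); last by move=> i _; apply: hmove.
rewrite sumr_const card_ord rmorphB scalerBl /=; congr (_ + _).
by rewrite !mulNrn -mulrnA -scaler_nat.
Qed.
End Symmetrizer.

(** * Row symmetry of E *)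

Section RowSymmetry.
Variables (n : nat) (lam : seq nat).
Hypothesis lamP : is_partition n lam.
Notation E := (Eidem n lam).
Notation G := (@rowlevel n lam).

(** Multiplying the Jucys-Murphy element of entry [m] by the previous symmetrizer, each row above
    contributes $-1$ and the own row gives the next symmetrizer minus the previous one. Comparison
    with the content shows that [c] grows by the factor column plus one. *)
Lemma Eidem_rowlevel m : (m <= n)%N ->
  exists2 c : rat, c != 0 & E * tab rat (G m) (G m) = c *: E.
Proof.
elim: m => [_|m IH hm].
  (* At level 0 all colours are distinct, and the symmetrizer is the identity. *)
  exists 1; rewrite ?oner_eq0 // scale1r -[RHS]mulr1; congr (_ * _).
  apply/ffunP => g; rewrite tabP -gp1 gpE; congr (nat_of_bool _)%:R.
  apply/forallP/eqP => [h|-> k]; last by rewrite perm1.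
  by apply/permP => k; rewrite perm1; apply: val_inj; apply/eqP; have := h k; rewrite eqn_add2l.
have [c hc hE] := IH (ltnW hm); set X := tab rat (G m) (G m) in hE.
pose b := Ordinal hm.
have Gb : G m b = (n + m)%N by rewrite /rowlevel ltnn.
have neb (k : 'I_n) : k <> b -> ((k : nat) == m) = false.
  by move=> h; apply/negbTE/eqP => e; apply: h; apply: val_inj.
have hrow : (row_of lam b < n)%N by apply: (row_ltn lamP).
have move i : (i < n)%N -> X + \sum_(a | G m a == i) gp rat (tperm a b) * X =
    tab rat (recolour (G m) b i) (recolour (G m) b i).
  move=> hi; rewrite (tab_move rat (G m) (f := G m)); last by rewrite Gb; lia.
  rewrite Gb (big_pred1 b) // => k; rewrite /rowlevel /= -(inj_eq val_inj) /=.
  by case: ifP => hk; have := row_ltn lamP (ltn_ord k); lia.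
have kill i : (i < row_of lam b)%N ->
    E * (\sum_(a | G m a == i) gp rat (tperm a b) * X) = - (E * X).
  move=> hi; have hin : (i < n)%N by apply: ltn_trans hrow.
  have hle k : (recolour (G m) b i k <= G m.+1 k)%N.
    rewrite /recolour /rowlevel; case: eqP => [->|/neb h]; first by rewrite /= ltnSn ltnW.
    by rewrite ltnS (leq_eqVlt k) h.
  apply/eqP; rewrite -addr_eq0 addrC -mulrDr move //; apply/eqP.
  apply: (Eidem_kill lamP _ hm).
  - move=> k; rewrite /recolour; case: (k =P b) => [->|/neb hk]; first by rewrite hin ltnSn.
    by rewrite (rowlevelP lamP) ltnS (leq_eqVlt k) hk.
  - by move=> c' _; apply/subset_leq_card/subsetP => k; rewrite !inE; apply: leq_ltn_trans.
  - exists i.+1 => //; apply/proper_card/properP; split.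
      by apply/subsetP => k; rewrite !inE; apply: leq_ltn_trans.
    exists b; rewrite !inE /recolour ?eqxx // /rowlevel /= ltnSn -leqNgt //.
have full : E * (\sum_(a | G m a == row_of lam b) gp rat (tperm a b) * X) =
    E * tab rat (G m.+1) (G m.+1) - E * X.
  apply/eqP; rewrite -subr_eq opprK addrC -mulrDr move //; apply/eqP; congr (_ * _).
  apply: eq_tab => k; rewrite /recolour /rowlevel; case: eqP => [->|/neb h]; rewrite /= ?ltnSn //;
    by rewrite ltnS (leq_eqVlt k) h.
have hjm : jm rat b * X = \sum_(a | (G m a < (row_of lam b).+1)%N) gp rat (tperm a b) * X.
  rewrite /jm mulr_suml; apply: eq_bigl => a; rewrite /rowlevel /=.
  case: ifP => ha; last by move: hrow => /=; lia.
  by rewrite ltnS (row_mono lamP (ltnW ha) hm).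
have := congr1 (fun z => z * X) (Eidem_jm lamP b).
rewrite -mulrA hjm sum_below big_ord_recr mulrDr full mulr_sumr /=.
rewrite (eq_bigr (fun _ => - (E * X))); last by move=> i _; apply: kill.
rewrite sumr_const card_ord -scalerAl => e.
exists (((col_of lam b).+1)%:R * c).
  by rewrite mulf_neq0 // pnatr_eq0.
rewrite -scalerA -hE; set r := row_of lam b in e *; set Y := E * X in e *.
have -> : E * tab rat (G m.+1) (G m.+1) = (content lam b)%:~R *: Y + Y *+ r + Y.
  by rewrite -e mulNrn [- _ + _]addrC !subrK.
rewrite /content rmorphB scalerBl /= -/r -(scaler_nat r Y) subrK.
by rewrite -natr1 scalerDl scale1r.
Qed.

Lemma Eidem_mul_xrow : exists2 c : rat, c != 0 & E * xrow rat lam = c *: E.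
Proof.
have [c hc h] := Eidem_rowlevel (leqnn n); exists c => //; rewrite -h.
by congr (_ * _); apply: eq_tab => k; rewrite rowlevel_n.
Qed.

Lemma Eidem_higher z : Q_higher lam z -> E * z = 0.
Proof.
move=> /span_higher_gens[l [hl ->]]; rewrite mulr_sumr big_seq big1 // => e /hl [_ h].
rewrite -scalerAr; suff -> : E * gmap rat e.2 = 0 by rewrite scaler0.
elim: h => {e} [_ [mu [s [t [hmu hh hs ht ->]]]]||x y _ hx _ hy].
- rewrite murphyE gp_tab rmorphM /= gmap_tab mulrA.
  have hcum c : cumul (fun k => row_of mu (s^-1%g k)) c = rowstart mu c.
    by rewrite (cumul_perm (rowc mu)) -(card_row_lt hmu).
  rewrite (Eidem_kill lamP _ (leqnn n)) ?mul0r //.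
  + by move=> k; rewrite (row_ltn hmu) // ltn_ord.
  + move=> c _; rewrite hcum (eq_cumul _ (@rowlevel_n n lam)) /cumul (card_row_lt lamP).
    exact: hh.1.
  + have [c hc hlt] := higher_lt lamP hmu hh; exists c => //.
    by rewrite hcum (eq_cumul _ (@rowlevel_n n lam)) /cumul (card_row_lt lamP).
- by rewrite rmorph0 mulr0.
- by rewrite rmorphB mulrBr hx hy subr0.
Qed.
End RowSymmetry.

(** * The conjugate tableau *)

Section Conjugate.
Variables (n : nat) (lam : seq nat).
Hypothesis lamP : is_partition n lam.
Notation mu := (conj_part lam).

Lemma count_above i j : (i < count (fun x => j < x) lam)%N = (j < nth 0%N lam i)%N.
Proof.
apply/idP/idP => [|h].
  apply: contraTT; rewrite -!leqNgt => h.
  rewrite -{1}(cat_take_drop i lam) count_cat -[X in (_ <= X)%N]addn0 leq_add //.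
    by apply: leq_trans (count_size _ _) _; rewrite size_take_min geq_minl.
  rewrite leqn0 -leqn0 leqNgt -has_count; apply/hasPn => x /(nthP 0%N)[k hk <-].
  rewrite nth_drop -leqNgt; apply: leq_trans (part_noninc lamP _) h; exact: leq_addr.
have hi : (i < size lam)%N by rewrite ltnNge; apply/negP => hs; rewrite nth_default in h.
rewrite -(cat_take_drop i.+1 lam) count_cat; apply: leq_trans (leq_addr _ _).
have /eqP -> : (count (fun x => j < x) (take i.+1 lam) == size (take i.+1 lam))%N.
  rewrite -all_count; apply/(all_nthP 0%N) => k; rewrite size_takel // => hk.
  by rewrite nth_take //; apply: leq_trans h (part_noninc lamP _).
by rewrite size_takel.
Qed.

Lemma nth_conj i j : (i < nth 0%N mu j)%N = (j < nth 0%N lam i)%N.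
Proof.
case: (ltnP j (head 0%N lam)) => hj; first by rewrite nth_mkseq // count_above.
rewrite nth_default ?size_mkseq //; apply/esym/negbTE; rewrite -leqNgt.
by apply: leq_trans hj; rewrite -nth0; apply: (part_noninc lamP).
Qed.

Lemma conj_partP : is_partition n mu.
Proof.
apply/and3P; split.
- rewrite /conj_part /mkseq sorted_map; apply: (sub_sorted (e := leq)) (iota_sorted 0 _).
  move=> i j hij; rewrite /relpre /geq /=; apply: sub_count => x /=; exact: leq_ltn_trans.
- apply/(all_nthP 0%N) => j; rewrite size_mkseq => hj.
  by rewrite nth_conj nth0.
case/and3P: (lamP) => _ _ /eqP <-; apply/eqP.
rewrite !sumnE big_map -[X in iota _ X]subn0 -/(index_iota 0 _).
under eq_bigr => j _ do rewrite -sum1_count big_mkcond.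
rewrite exchange_big /= big_seq [RHS]big_seq; apply: eq_bigr => x /(nthP 0%N)[i _ <-].
set v := nth 0%N lam i.
have hv : (v <= head 0%N lam)%N by rewrite -nth0; apply: (part_noninc lamP).
rewrite -big_mkcond big_mkord /=.
have := card_ltn_ord hv; by rewrite -sum1_card => e; rewrite -[RHS]e; apply: eq_bigl => k.
Qed.

Lemma s_conjE (k : 'I_n) :
  (row_of lam (s_conj n lam k) = col_of mu k) * (col_of lam (s_conj n lam k) = row_of mu k).
Proof.
have hpos (q : 'I_n) : (row_of mu q < nth 0%N lam (col_of mu q))%N.
  by rewrite -nth_conj; apply: (col_lt conj_partP).
pose f (q : 'I_n) := Ordinal (pos_lt lamP (hpos q)).
have finj : injective f.
  move=> q q' /(congr1 val) /= e.
  have e1 := row_pos (hpos q); have e2 := col_pos (hpos q).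
  rewrite e (row_pos (hpos q')) in e1; rewrite e (col_pos (hpos q')) in e2.
  exact: val_inj (row_col_inj conj_partP (ltn_ord q) (ltn_ord q') (esym e2) (esym e1)).
have hs q : val (s_conj n lam q) = (rowstart lam (col_of mu q) + row_of mu q)%N.
  rewrite /s_conj; case: pickP => [s /forallP /(_ q) /eqP //|/(_ (perm finj))] /negbT/negP [].
  by apply/forallP => q'; rewrite permE.
by rewrite !hs (row_pos (hpos k)) (col_pos (hpos k)).
Qed.

Lemma yl_kappa (K : comNzRingType) :
  (yl K n mu : galg K n) * gp K (s_conj n lam) = gp K (s_conj n lam) * kappa K lam.
Proof.
set s := s_conj n lam.
have ylE (h : 'S_n) : (yl K n mu : galg K n) h = if rowstab mu h then (-1) ^+ odd_perm h else 0.
  rewrite /yl (galg_sumE (K := K)) big_mkcond (bigD1 h) //= big1 ?addr0.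
    by rewrite !ffunE eqxx mulr1.
  by move=> r hr; case: ifP => // _; rewrite !ffunE eq_sym (negbTE hr) mulr0.
apply/ffunP => g; rewrite gpMR gpML ylE kappaE !odd_permM !odd_permV addbC.
suff -> : rowstab mu (g * s^-1)%g = colstab lam (s^-1 * g)%g by [].
have e (q : 'I_n) : row_of mu q = col_of lam (s q) by rewrite s_conjE.
apply/forallP/forallP => h k; last first.
  by have := h (s k); rewrite permM permK permM !e permKV.
by have := h (s^-1 k)%g; rewrite !permM !e !permKV.
Qed.
End Conjugate.

(** * The theorem *)

Section LocalRing.
Variable p : nat.

Lemma inR_denom (q : rat) (d m : int) : coprime p `|d|%N -> q * d%:~R = m%:~R -> inR p q.
Proof.
move=> hd e; apply: (coprime_dvdr _ hd).
have hq0 : (denq q)%:~R != 0 :> rat by rewrite intr_eq0 denq_neq0.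
have : (numq q * d)%:~R = (m * denq q)%:~R :> rat.
  by rewrite !rmorphM /= -e mulrAC numqE.
move/intr_inj/(congr1 absz); rewrite !abszM => h.
by rewrite -(@Gauss_dvdr _ `|numq q|%N) ?h ?dvdn_mull // coprime_sym coprime_num_den.
Qed.

Lemma inR_int (m : int) : inR p m%:~R.
Proof. by rewrite /inR denq_int coprimen1. Qed.

Lemma inRM a b : inR p a -> inR p b -> inR p (a * b).
Proof.
move=> ha hb; apply: (@inR_denom _ (denq a * denq b) (numq a * numq b)).
  by rewrite abszM coprimeMr; apply/andP.
by rewrite !rmorphM /= !numqE mulrACA.
Qed.

Lemma inRD a b : inR p a -> inR p b -> inR p (a + b).
Proof.
move=> ha hb; apply: (@inR_denom _ (denq a * denq b) (numq a * denq b + numq b * denq a)).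
  by rewrite abszM coprimeMr; apply/andP.
rewrite rmorphD !rmorphM /= !numqE; ring.
Qed.

Lemma redq_int (m : int) : redq p m%:~R = m%:~R.
Proof. by rewrite /redq numq_int denq_int divr1. Qed.
End LocalRing.

(** * The vector representing the form *)

Section CellForm.
Variables (n : nat) (lam : seq nat).
Hypothesis lamP : is_partition n lam.

(** [kappa] kills the higher span, and $\kappa x$ has coefficient 1 at the identity; so values of
    the form are unique over any [K]. *)
Lemma xrow_hspan_eq0 (K : comNzRingType) inS (d : K) :
  span_higher inS lam (d *: xrow K lam : galg K n) -> d = 0.
Proof.
move/(kappa_span_higher lamP); rewrite -scalerAr.
move/(congr1 (fun z : galg K n => z 1%g)); rewrite galg0 galgZ (kappa_x_row lamP) ?mulr1 //.
by move=> k; rewrite perm1.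
Qed.

(* [z0 g] is the value of the form on [x] and [g x]. *)
Lemma form_vector : exists z0 : galg int n, forall g : 'S_n,
  hspan lam (xrow int lam * gp int g * xrow int lam - z0 g *: xrow int lam).
Proof.
have [r hr] := fin_all_exists (cellular_coefficient lamP).
by exists [ffun g => r g] => g; rewrite ffunE.
Qed.

Variable z0 : galg int n.
Hypothesis z0P : forall g : 'S_n,
  hspan lam (xrow int lam * gp int g * xrow int lam - z0 g *: xrow int lam).

Lemma cell_form (K : comNzRingType) (inS : K -> Prop) (inS_int : forall m : int, inS m%:~R)
    (inSM : forall a b, inS a -> inS b -> inS (a * b)) (w : galg K n) :
  (forall s, inS (w s)) ->
  span_higher inS lam (xrow K lam * w * xrow K lam - dot (gmap K z0) w *: xrow K lam).
Proof.
move=> hw; rewrite {1}(galg_basis w) mulr_sumr mulr_suml /dot scaler_suml -sumrB.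
apply: span_higher_sum => g _; rewrite -scalerAr -scalerAl (mulrC (gmap K z0 g)) -scalerA -scalerBr.
apply: span_higherZ => //; rewrite gmapE -gmap_tab -gmap_gp -!rmorphM /= -gmapZ -rmorphB.
apply: hspan_span_higher => //; exact: z0P.
Qed.

Let int_int (m : int) : (fun _ : int => True) m%:~R := I.
Let int_mul (a b : int) (_ _ : True) : (fun _ : int => True) (a * b) := I.

Lemma gmap_int (w : galg int n) : gmap int w = w.
Proof. by apply/ffunP => s; rewrite gmapE intz. Qed.

Lemma hspan_int (z : galg int n) : hspan lam z -> span_higher (fun _ => True) lam z.
Proof. by move=> h; rewrite -(gmap_int z); apply: hspan_span_higher h. Qed.

Lemma z0_row_constant : row_constant lam z0.
Proof.
move=> g g' h; apply/eqP; rewrite -subr_eq0; apply/eqP.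
apply: (@xrow_hspan_eq0 _ (fun _ => True)); apply: hspan_int.
rewrite scalerBl; have := zspanB (z0P g') (z0P g).
have -> : xrow int lam * gp int g' * xrow int lam = xrow int lam * gp int g * xrow int lam.
  by rewrite -!mulrA !gp_tab; congr (_ * _); apply: eq_tab => // k; rewrite h.
by rewrite opprB [_ - xrow _ _ * _ * _]addrC addrACA subrr add0r addrC.
Qed.

Lemma z0_kills_higher : kills_higher lam z0.
Proof.
move=> w hw; rewrite gmap_int dotC; apply: (@xrow_hspan_eq0 _ (fun _ => True)).
have h1 := @cell_form int (fun _ => True) int_int int_mul w (fun _ => I).
have h2 := hspan_int (hspan_mull lamP (xrow int lam) hw); rewrite gmap_int in h1.
have := span_higherD h2 (span_higherN int_int int_mul h1).
by rewrite mulrA opprB addrC subrK.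
Qed.

Lemma z0_polytabloid : exists h : galg int n, z0 = h * kappa int lam * xrow int lam.
Proof.
have [h [_ e]] := polytabloid_span lamP (S := fun _ : int => True) int_int
  (fun _ _ _ _ => I) int_mul (fun _ => I) z0_row_constant z0_kills_higher.
by exists h.
Qed.

Lemma z0_Eidem : exists a : rat, gmap rat z0 = a *: Eidem n lam.
Proof.
have [c hc hE] := Eidem_mul_xrow lamP; set E := Eidem n lam in hE *.
have hE' : xrow rat lam * E = c *: E.
  by rewrite -[LHS]starK starM (star_Eidem lamP) xrow_star hE starZ (star_Eidem lamP).
have key g : c * E g = (z0 g)%:~R * E 1%g.
  have := @cell_form rat (fun _ => True) (fun _ => I) (fun _ _ _ _ => I) (gp rat g) (fun _ => I).
  rewrite dot_gp gmapE => /(Eidem_higher lamP) /eqP.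
  rewrite mulrBr subr_eq0 -scalerAr hE !mulrA hE -/E => /eqP h.
  have h2 : E * (gp rat g * xrow rat lam) = (z0 g)%:~R *: E.
    apply: (scalerI hc); rewrite scalerA mulrC -scalerA -h.
    by rewrite -!scalerAl mulrA.
  (* The coefficient of $Ex$ at $g$ is $\langle E,gx\rangle$, that is, the coefficient of $Egx$ at
     the identity. *)
  rewrite -galgZ -hE -dot_gp -[E * _]/(E * _) dotMr xrow_star dotE (star_Eidem lamP) -/E h2.
  by rewrite galgZ.
have hE1 : E 1%g != 0.
  apply/eqP => h0; apply: (Eidem_neq0 lamP); apply/ffunP => g; rewrite galg0.
  by apply/eqP; have /eqP := key g; rewrite h0 mulr0 mulf_eq0 (negbTE hc).
(* This quotient is $a_\lambda$, with $c$ determined by $Ex=cE$. *)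
exists (c / E 1%g); apply/ffunP => g; rewrite gmapE galgZ mulrAC key mulfK //.
Qed.
End CellForm.

Section Translation.
Variables (n : nat) (lam : seq nat).
Hypothesis lamP : is_partition n lam.

Lemma CmemE (K : comNzRingType) (inS : K -> Prop) (z : galg K n) :
  Cmem inS lam z <-> exists w : galg K n, (forall s, inS (w s)) /\
    exists j : galg K n, span_higher inS lam j /\ z = w * xrow K lam + j.
Proof.
by split=> -[w [hw [j [hj ->]]]]; exists w; split=> //; exists j; split=> //;
  rewrite -xl_tab.
Qed.

Lemma LmemE p (z : galg rat n) :
  Lmem p lam z <-> exists h : galg rat n, inRS p h /\ z = h * kappa rat lam * xrow rat lam.
Proof.
have hS (h : galg rat n) (s : 'S_n) : inRS p h -> inRS p (h * gp rat s).
  by move=> hh g; rewrite [X in inR p X]gpMR; apply: hh.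
split=> -[h [hh ->]].
  exists ((h : galg rat n) * gp rat (s_conj n lam)); split; first exact: hS.
  by rewrite -xl_tab -[_ * kappa rat lam]mulrA -(yl_kappa lamP) !mulrA.
exists (h * gp rat (s_conj n lam)^-1%g); split; first exact: hS.
transitivity (h * gp rat (s_conj n lam)^-1%g * (yl rat n (conj_part lam) : galg rat n) *
  gp rat (s_conj n lam) * (xl rat n lam : galg rat n)); last by [].
rewrite -[_ * _ * gp _ _]mulrA (yl_kappa lamP) xl_tab !mulrA.
by rewrite -[h * _ * gp _ (s_conj n lam)]mulrA -gpM mulVg gp1 mulr1.
Qed.
End Translation.

Section Duality.
Variables (p n : nat) (lam : seq nat).
Hypothesis lamP : is_partition n lam.
Notation x := (xrow rat lam : galg rat n).

Let inS_int := @inR_int p.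
Let inSM := @inRM p.
Let inSD := @inRD p.

Definition row_order : rat := #|[pred r : 'S_n | rowstab lam r]|%:R.

Lemma row_order_neq0 : row_order != 0.
Proof.
rewrite pnatr_eq0 -lt0n; apply/card_gt0P; exists 1%g; rewrite inE.
by apply/forallP => k; rewrite perm1.
Qed.

Lemma xrow_sqr : x * x = row_order *: x.
Proof.
rewrite -{2}xl_tab /xl mulr_sumr.
rewrite (eq_bigr (fun _ => x)); last by move=> r hr; exact: xrow_gp.
by rewrite sumr_const -scaler_nat.
Qed.

(* The pairing between [RS_n y s x] and the cell module is the dot product on group elements,
   normalised so that tabloids are orthonormal. *)
Definition pairing (z b : GA rat n) : rat := row_order^-1 * dot (z : galg rat n) b.

(** The denominator [row_order] cancels against $x^2$, so the pairing takes values in $R$ even if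
    [p] divides it. *)
Lemma pairing_row (h w : galg rat n) : pairing (h * x) (w * x) = dot (h * x) w.
Proof.
rewrite /pairing -[X in w * X]xrow_star -dotMr -mulrA xrow_sqr -scalerAr dotZl.
by rewrite mulrA mulVf ?mul1r ?row_order_neq0.
Qed.

Lemma pairing_higher (inS : rat -> Prop) (h j : galg rat n) :
  (forall m : int, inS m%:~R) -> (forall a b, inS a -> inS b -> inS (a * b)) ->
  (forall s, inS (h s)) -> span_higher inS lam j -> pairing (h * kappa rat lam * x) j = 0.
Proof.
move=> hi hm hh hj; rewrite /pairing -mulrA dotMl dotMl star_kappa.
have -> : kappa rat lam * (star h * j) = 0.
  apply: (kappa_span_higher lamP (inS := inS)); apply: span_higher_mull => // s.
  by rewrite starE.
by rewrite dot0r mulr0.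
Qed.

Lemma pairing_Cmem (h w j : galg rat n) : inRS p h -> span_higher (inRP p) lam j ->
  pairing (h * kappa rat lam * x) (w * x + j) = dot (h * kappa rat lam * x) w.
Proof.
move=> hh hj; rewrite /pairing dotDr mulrDr -/(pairing _ _) -/(pairing _ j) pairing_row.
by rewrite (@pairing_higher (inRP p)) ?addr0.
Qed.

Lemma inRS_mul (f g : galg rat n) : inRS p f -> inRS p g -> inRS p (f * g : galg rat n).
Proof. move=> hf hg; exact: (closed_mul (S := inRP p) inS_int inSD inSM hf hg). Qed.

Lemma inRS_gmap (f : galg int n) : inRS p (gmap rat f).
Proof. by move=> s; rewrite gmapE inR_int. Qed.

Lemma inRS_kappa_x : inRS p (kappa rat lam * x : galg rat n).
Proof. by rewrite -gmap_kappa -gmap_tab -rmorphM; apply: inRS_gmap. Qed.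

Lemma Cmem_row (w : galg rat n) : inRS p w -> Cmem (inRP p) lam (w * x : galg rat n).
Proof. by move=> hw; apply/CmemE; exists w; split=> //; exists 0; rewrite addr0; split=> //; exact: span_higher0. Qed.

Lemma Cmem_higher (j : galg rat n) : span_higher (inRP p) lam j -> Cmem (inRP p) lam j.
Proof.
move=> hj; apply/CmemE; exists 0; split; last by exists j; rewrite mul0r add0r.
by move=> s; rewrite galg0; have := inS_int 0; rewrite rmorph0.
Qed.

Lemma pairing_dual z : Lmem p lam z -> isDual p lam (pairing z).
Proof.
move=> /(LmemE lamP)[h [hh ->]]; split.
- move=> b /CmemE[w [hw [j [hj ->]]]]; rewrite pairing_Cmem //.
  apply: (closed_sum (S := inRP p) inS_int inSD) => s _; apply: inSM; last exact: hw.
  by rewrite -mulrA; apply: inRS_mul => //; apply: inRS_kappa_x.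
- by move=> b hb; apply: (@pairing_higher (inRP p)).
- by move=> b1 b2 _ _; rewrite /pairing [dot _ _]dotDr mulrDr.
- by move=> r b _ _; rewrite /pairing [dot _ (gscale _ _)]dotZr mulrCA.
Qed.

(** An element of $RS_n\kappa x$ is itself a representative in the cell module and can be paired
    with itself. *)
Lemma pairing_nondegenerate z : Lmem p lam z ->
  (forall b, Cmem (inRP p) lam b -> pairing z b = 0) -> z = 0.
Proof.
move=> hz h; have hzC : Cmem (inRP p) lam z.
  have [h' [hh' e]] := (LmemE lamP p z).1 hz.
  rewrite e; apply: Cmem_row; apply: inRS_mul => //.
  by rewrite -gmap_kappa; apply: inRS_gmap.
apply: dot_self_eq0; apply: (mulfI (_ : row_order^-1 != 0)).
  by rewrite invr_eq0 row_order_neq0.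
by rewrite mulr0; exact: h.
Qed.

Lemma dual_row f (w : galg rat n) : isDual p lam f -> inRS p w ->
  f (w * x : galg rat n) = dot w [ffun g => f (gp rat g * x : galg rat n)].
Proof.
move=> [h1 h2 h3 h4] hw.
have hg g : Cmem (inRP p) lam (gp rat g * x : galg rat n).
  by apply: Cmem_row; rewrite -gmap_gp; apply: inRS_gmap.
have sumE (r : seq 'S_n) : Cmem (inRP p) lam (\sum_(s <- r) (w s *: (gp rat s * x)) : galg rat n) /\
    f (\sum_(s <- r) (w s *: (gp rat s * x)) : galg rat n) =
    \sum_(s <- r) w s * f (gp rat s * x : galg rat n).
  elim: r => [|s r [IH1 IH2]].
    rewrite !big_nil; split; last by apply: h2; exact: span_higher0.
    by apply: Cmem_higher; exact: span_higher0.
  have hs : Cmem (inRP p) lam (w s *: (gp rat s * x) : galg rat n).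
    rewrite scalerAl; apply: Cmem_row => t; rewrite galgZ; apply: inSM; first exact: hw.
    by rewrite -gmap_gp; apply: inRS_gmap.
  have e1 : f (w s *: (gp rat s * x) : galg rat n) = w s * f (gp rat s * x : galg rat n).
    by apply: h4; [exact: hw | exact: hg].
  rewrite !big_cons; split; last first.
    rewrite -e1 -IH2; exact: h3.
  have [w1 [hw1 [j1 [hj1 ->]]]] := (CmemE _ _ _).1 hs.
  have [w2 [hw2 [j2 [hj2 ->]]]] := (CmemE _ _ _).1 IH1.
  apply/CmemE; exists (w1 + w2); split.
    by move=> t; rewrite galgD; apply: inSD; [apply: hw1 | apply: hw2].
  exists (j1 + j2); split; first exact: span_higherD.
  by rewrite mulrDl addrACA.
rewrite {1}(galg_basis w) mulr_suml.
under eq_bigr => s _ do rewrite -scalerAl.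
rewrite (sumE (index_enum _)).2; apply: eq_bigr => s _; by rewrite ffunE.
Qed.

(** The values of [f] on the tabloids $gx$ form a vector satisfying the hypotheses of
    [polytabloid_span]. *)
Lemma pairing_onto f : isDual p lam f ->
  exists2 z, Lmem p lam z & forall b, Cmem (inRP p) lam b -> pairing z b = f b.
Proof.
move=> hf; have [h1 h2 h3 h4] := hf.
pose u : galg rat n := [ffun g => f (gp rat g * x : galg rat n)].
have hg g : inRS p (gp rat g : galg rat n) by rewrite -gmap_gp; apply: inRS_gmap.
have Su s : inRP p (u s) by rewrite ffunE; apply: h1; apply: Cmem_row.
have ur : row_constant lam u.
  by move=> g g' h; rewrite !ffunE !gp_tab (@eq_tab _ _ _ (rowc lam) _ (fun k => row_of lam (g' k))).
have uk : kills_higher lam u.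
  move=> w hw; rewrite -(dual_row hf (inRS_gmap w)); apply: h2.
  rewrite -gmap_tab -rmorphM; exact: (hspan_span_higher inS_int inSM).
have [h [hh e]] := polytabloid_span lamP inS_int inSD inSM Su ur uk.
exists u; first by apply/(LmemE lamP); exists h.
move=> b /CmemE[w [hw [j [hj ->]]]].
rewrite h3; first 1 last.
- exact: Cmem_row.
- exact: Cmem_higher.
by rewrite (h2 j) // addr0 (dual_row hf) // [in LHS]e pairing_Cmem // -e dotC.
Qed.
End Duality.

(* Reducing [z0 = a E = x kappa q], the map [w x |-> w z0] of the cell module becomes
   [z |-> z kappa q], which visibly kills the higher span. *)
Lemma reduced_form (K : comNzRingType) (n : nat) (lam : seq nat) (z0 h0 : galg int n) :
  is_partition n lam ->
  (forall g : 'S_n,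
    hspan lam (xrow int lam * gp int g * xrow int lam - z0 g *: xrow int lam)) ->
  z0 = h0 * kappa int lam * xrow int lam -> star z0 = z0 ->
  exists psi : GA K n -> GA K n,
    let e : GA K n := gmap K z0 in
    let Cb := Cmem (@anyP K) lam in
    [/\ forall x, Cb x -> exists w, psi x = gmul w e,
        forall x1 x2, Cb x1 -> Cb x2 -> psi (x1 + x2) = psi x1 + psi x2,
        forall w x, Cb x -> psi (gmul w x) = gmul w (psi x),
        forall x, Cb x ->
          (psi x = 0 <-> forall y, Cb y -> formrel (@anyP K) lam x y 0)
      & forall w, exists2 x, Cb x & psi x = gmul w e].
Proof.
move=> lamP z0P z0h z0star; set X := xrow K lam : galg K n.
have anyI (m : int) : @anyP K m%:~R by [].
have anyM (c d : K) : anyP c -> anyP d -> anyP (c * d) by [].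
pose e : galg K n := gmap K z0.
pose q : galg K n := gmap K (star h0).
(* Self-adjointness of $z_0$ moves the factor $x$ of $z_0=h_0\kappa x$ to the left. *)
have eX : e = X * (kappa K lam * q).
  rewrite /e -z0star z0h !starM xrow_star star_kappa !rmorphM /= gmap_tab gmap_kappa.
  by [].
exists (fun z => (z : galg K n) * (kappa K lam * q)).
have psiE (h j : galg K n) : span_higher (@anyP K) lam j ->
    (h * X + j) * (kappa K lam * q) = h * e.
  by move=> hj; rewrite mulrDl [j * _]mulrA (span_higher_kappa lamP hj) mul0r addr0 eX [RHS]mulrA.
have CX (w : galg K n) : Cmem (@anyP K) lam (w * X : galg K n).
  by apply/CmemE; exists w; split=> //; exists 0; rewrite addr0; split=> //; exact: span_higher0.
split.
- by move=> x /CmemE[w [_ [j [hj ->]]]]; exists w; rewrite psiE.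
- by move=> x1 x2 _ _; exact: (mulrDl (x1 : galg K n) x2 (kappa K lam * q)).
- by move=> w x _; exact: (esym (mulrA (w : galg K n) x (kappa K lam * q))).
- move=> x /CmemE[h [_ [j [hj ->]]]]; rewrite psiE //.
  have form (h' j' : galg K n) : span_higher (@anyP K) lam j' ->
      span_higher (@anyP K) lam (star (h * X + j) * (h' * X + j') - dot h' (h * e) *: X).
    move=> hj'; rewrite raddfD /= starM xrow_star.
    have -> : (X * star h + star j) * (h' * X + j') - dot h' (h * e) *: X =
      (X * (star h * h') * X - dot e (star h * h') *: X) +
      (X * star h * j' + star j * (h' * X + j')).
      rewrite mulrDl mulrDr -dotMl (dotC (h * e)) !mulrA -!addrA; congr (_ + _).
      by rewrite [RHS]addrC -addrA.
    apply: span_higherD; first exact: (cell_form z0P).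
    apply: span_higherD; first exact: (span_higher_mull anyI anyM lamP).
    by apply: (span_higher_mulr anyI anyM lamP) => //; apply: (span_higher_star anyI anyM).
  split=> [h0e y /CmemE[h' [_ [j' [hj' ->]]]]|hform].
    exists (star (h * X + j) * (h' * X + j')); split; last first.
      by rewrite [gscale 0 _](scale0r (xl K n lam : galg K n)) add0r.
    by have := form h' j' hj'; rewrite h0e dot0r scale0r subr0.
  (* Testing against $y=gx$ reads off the coefficient of the image at $g$. *)
  apply/ffunP => g; rewrite galg0 -dot_gp dotC.
  have [j' [hj' ej]] := hform _ (CX (gp K g)).
  have := form (gp K g) 0 (span_higher0 _ _ _); rewrite addr0.
  have -> : star (h * X + j) * (gp K g * X) = j'.
    by transitivity (gscale 0 (xl K n lam) + j' : galg K n); rewrite // [gscale 0 _](scale0r (xl K n lam : galg K n)) add0r.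
  move=> hd; apply: (xrow_hspan_eq0 lamP (inS := @anyP K)).
  by rewrite -[_ *: _](subKr j'); apply: span_higherD => //; apply: (span_higherN anyI anyM).
move=> w; exists ((w : galg K n) * X); first exact: CX.
have h := psiE (w : galg K n) 0 (span_higher0 _ _ _); rewrite addr0 in h; exact: h.
Qed.

Theorem mainTheorem13 (p n : nat) (lam : seq nat) :
  prime p -> is_partition n lam ->
  exists a : rat,
    (* a_lam E_lam lies in R S_n y_{lam'} s_{lam'} x_lam *)
    Lmem p lam (gscale a (Elam n lam)) /\
    (* (a): an R S_n-isomorphism phi : R S_n y s x_lam -> C(lam)^⊛ under which
       c_lam corresponds to w ⊗ 1 |-> w a_lam E_lam, i.e. c_lam(x_lam) = phi(a E) *)
    (exists phi : GA rat n -> GA rat n -> rat,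
       [/\ forall z, Lmem p lam z -> isDual p lam (phi z),
           forall z1 z2 b, Lmem p lam z1 -> Lmem p lam z2 -> Cmem (inRP p) lam b ->
             phi (z1 + z2) b = phi z1 b + phi z2 b,
           forall w z b, inRS p w -> Lmem p lam z -> Cmem (inRP p) lam b ->
             phi (gmul w z) b = phi z (gmul (gstar w) b),
           forall z, Lmem p lam z -> (forall b, Cmem (inRP p) lam b -> phi z b = 0) ->
             z = 0 &
           forall f, isDual p lam f ->
             exists2 z, Lmem p lam z & forall b, Cmem (inRP p) lam b -> phi z b = f b]
       /\ (forall b, Cmem (inRP p) lam b ->
             formrel (inRP p) lam (xl rat n lam) b (phi (gscale a (Elam n lam)) b))) /\
    (* (b): D(lam) = Cbar(lam)/rad  ≅  F_p S_n * reduction(a_lam E_lam) *)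
    (exists psi : GA 'F_p n -> GA 'F_p n,
       let e := redGA p (gscale a (Elam n lam)) in
       let Cb := Cmem (@anyP 'F_p) lam in
       [/\ forall x, Cb x -> exists w, psi x = gmul w e,
           forall x1 x2, Cb x1 -> Cb x2 -> psi (x1 + x2) = psi x1 + psi x2,
           forall w x, Cb x -> psi (gmul w x) = gmul w (psi x),
           forall x, Cb x ->
             (psi x = 0 <-> forall y, Cb y -> formrel (@anyP 'F_p) lam x y 0)
         & forall w, exists2 x, Cb x & psi x = gmul w e]).
Proof.
move=> _ lamP.
have [z0 z0P] := form_vector lamP.
have [h0 z0h] := z0_polytabloid lamP z0P.
have [a ha] := z0_Eidem lamP z0P.
have Ez : gscale a (Elam n lam) = gmap rat z0 by rewrite ha.
have zL : gmap rat z0 = gmap rat h0 * kappa rat lam * xrow rat lam.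
  by rewrite z0h !rmorphM /= gmap_kappa gmap_tab.
exists a; rewrite Ez; split.
  by apply/(LmemE lamP); exists (gmap rat h0); split=> //; apply: inRS_gmap.
split.
  exists (@pairing n lam); split; first split.
  - exact: pairing_dual.
  - by move=> z1 z2 b _ _ _; rewrite /pairing [dot _ _]dotDl mulrDr.
  - by move=> w z b _ _ _; rewrite /pairing [dot (gmul _ _) _]dotMl.
  - exact: pairing_nondegenerate.
  - exact: pairing_onto.
  move=> b /CmemE[w [hw [j [hj ->]]]].
  rewrite zL (pairing_Cmem lamP _ (inRS_gmap p h0) hj) -zL /formrel.
  exists (xrow rat lam * w * xrow rat lam - dot (gmap rat z0) w *: xrow rat lam +
      xrow rat lam * j); split.
    apply: span_higherD; first exact: (cell_form z0P (@inR_int p) (@inRM p) hw).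
    apply: (span_higher_mull (@inR_int p) (@inRM p) lamP) => // s.
    by rewrite -gmap_tab; apply: inRS_gmap.
  rewrite xl_tab; transitivity (star (xrow rat lam) * (w * xrow rat lam + j)); first by [].
  by rewrite xrow_star mulrDr mulrA [RHS]addrA [_ + (_ - _)]addrC subrK.
have z0star : star z0 = z0.
  apply/ffunP => s; apply: (@intr_inj rat); rewrite starE -!gmapE ha -[in LHS](starE (a *: _)).
  by rewrite starZ (star_Eidem lamP).
(* On integral elements the reduction of $R$ modulo $p$ is the canonical map from the integers. *)
have eE : redGA p (gmap rat z0) = gmap 'F_p z0 by apply/ffunP => s; rewrite ffunE !gmapE redq_int.
have [psi hpsi] := reduced_form 'F_p lamP z0P z0h z0star.
by exists psi; rewrite eE.
Qed.
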